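(* Let $\alpha,\beta,\gamma>0$, $\delta\in\mathbb N$ ($\delta\ge1$), $0<b<c<1$, $\omega=(b,c)$. Let $\mathcal S$ be the set of steady states, endowed with the $C^2([0,1])$-topology, and let $u_0,u_1\in\mathcal S$ lie in the same path connected component of $\mathcal S$. Then for every $\hat\delta>0$ there exists $T_{\hat\delta}>0$ such that for every $T\ge T_{\hat\delta}$ there exists a control $f\in L^2((0,T)\times(0,1))$ such that the solution $u$ of $$\begin{cases}u_t=u_{xx}-\alpha u^\delta u_x+\beta u(1-u^\delta)(u^\delta-\gamma)+\chi_\omega f & \text{in }(0,T)\times(0,1),\\ u(t,0)=u(t,1)=0, & t\in(0,T),\\ u(0,x)=u_0(x), & x\in(0,1),\end{cases}$$ satisfies $\|u(T,\cdot)-u_1\|_{L^2(0,1)}\le\hat\delta$.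
   Context: $\chi_\omega$ is the characteristic function of $\omega$. Steady state: a function $u\in C^2([0,1])$ such that $u_{xx}-\alpha u^\delta u_x+\beta u(1-u^\delta)(u^\delta-\gamma)=0$ in $(0,b)\cup(c,1)$ and $u(0)=u(1)=0$ (no equation is imposed on $[b,c]$). $\mathcal S$ is the set of all steady states. Solution: since $u_0\in H_0^1(0,1)$, the solution is the (unique) strong solution, i.e. the function $u\in C([0,T];H_0^1(0,1))\cap L^2(0,T;H^2(0,1))$ with $u_t\in L^2(0,T;L^2(0,1))$, $u(0)=u_0$, satisfying the equation in $L^2(0,1)$ for a.e. $t\in(0,T)$. *)

(* Defs.v *)
From HB Require Import structures.
From mathcomp Require Import all_boot all_order all_algebra.
From mathcomp Require Import all_classical all_reals all_analysis.

Set Implicit Arguments.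
Unset Strict Implicit.
Unset Printing Implicit Defensive.

Import Order.TTheory GRing.Theory Num.Theory.
Import numFieldNormedType.Exports.

Local Open Scope classical_set_scope.
Local Open Scope ring_scope.

Section C2_functions.
Context {R : realType}.
Implicit Types (f g u : R -> R) (x : R).

(* Derivative at x relative to [0,1]: two-sided for 0 < x < 1, one-sided at
   the endpoints; the values of f outside [0,1] are never used. *)
Definition quot01 f x : R -> R := fun y => (f y - f x) / (y - x).

Definition derivable01 f :=
  forall x, x \in `[0, 1] -> cvg (quot01 f x y @[y --> within `[0, 1] x^']).

Definition deriv01 f x : R := lim (quot01 f x y @[y --> within `[0, 1] x^']).

Definition C2_01 f :=
  [/\ derivable01 f, derivable01 (deriv01 f)
    & {within `[0, 1], continuous (deriv01 (deriv01 f))}].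

Definition supnorm01 f : R := sup [set `|f x| | x in `[0, 1]].

Definition C2norm f : R :=
  supnorm01 f + supnorm01 (deriv01 f) + supnorm01 (deriv01 (deriv01 f)).

End C2_functions.

Section Sobolev.
Context {R : realType}.

Definition square_integrable {d} {T : measurableType d}
    (m : {measure set T -> \bar R}) (D : set T) (f : T -> R) :=
  measurable_fun D f /\ m.-integrable D (fun x => (f x ^+ 2)%:E).

Definition L2_interval (a b : R) (f : R -> R) :=
  square_integrable lebesgue_measure `]a, b[ f.

(* L^2((0,T) x (0,1)), which is also L^2(0,T; L^2(0,1)) *)
Definition L2_cylinder (T : R) (f : R -> R -> R) :=
  square_integrable (lebesgue_measure \x lebesgue_measure)%E
    (`]0, T[ `*` `]0, 1[) (fun p => f p.1 p.2).

(* Integrals of non-integrable functions may be 0 by convention: only meaningful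
   for elements of L^2(0,1). *)
Definition L2norm (f : R -> R) : R :=
  Num.sqrt (\int[lebesgue_measure]_(x in `]0, 1[) (f x ^+ 2)).

(* C^1_c(a,b), each function being extended by 0 to the real line *)
Definition test_function (a b : R) (phi : R -> R) :=
  [/\ forall x, derivable phi x 1, continuous (derive1 phi)
    & exists a' b', [/\ a < a', b' < b
        & forall x, x \notin `[a', b'] -> phi x = 0]].

Definition weak_derivative (a b : R) (v dv : R -> R) :=
  forall phi, test_function a b phi ->
    \int[lebesgue_measure]_(x in `]a, b[) (v x * derive1 phi x) =
    - \int[lebesgue_measure]_(x in `]a, b[) (dv x * phi x).

(* v is (a representative of an element) in H^1(0,1) and dv = v' *)
Definition H1 (v dv : R -> R) :=
  [/\ L2_interval 0 1 v, L2_interval 0 1 dv & weak_derivative 0 1 v dv].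

Definition H1norm (v dv : R -> R) : R :=
  Num.sqrt (L2norm v ^+ 2 + L2norm dv ^+ 2).

(* H^1_0(0,1), the closure of C^1_c(0,1) in H^1(0,1) (as in Brezis, chapter 8);
   since C^oo_c(0,1) is H^1-dense in C^1_c(0,1), this is also the closure of
   C^oo_c(0,1). *)
Definition H10 (v dv : R -> R) :=
  H1 v dv /\ forall e : R, 0 < e -> exists2 phi, test_function 0 1 phi &
    H1norm (fun x => v x - phi x) (fun x => dv x - derive1 phi x) < e.

(* dtu is the distributional derivative on (0,T) of u with values in L^2(0,1);
   the two sides are equal as elements of L^2(0,1), hence for a.e. x. *)
Definition weak_time_derivative (T : R) (u dtu : R -> R -> R) :=
  forall phi, test_function 0 T phi ->
    {ae lebesgue_measure, forall x : R, x \in `]0, 1[ ->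
      \int[lebesgue_measure]_(t in `]0, T[) (u t x * derive1 phi t) =
      - \int[lebesgue_measure]_(t in `]0, T[) (dtu t x * phi t)}.

End Sobolev.

Section Equation.
Context {R : realType} (alpha beta gamma : R) (delta : nat) (b c : R).

(* the values at one point of u, u_x and u_xx being v, vx and vxx *)
Definition rhs (v vx vxx : R) : R :=
  vxx - alpha * v ^+ delta * vx
  + beta * v * (1 - v ^+ delta) * (v ^+ delta - gamma).

Definition steady_state (u : R -> R) :=
  [/\ C2_01 u,
      forall x, (x \in `]0, b[) \/ (x \in `]c, 1[) ->
        rhs (u x) (deriv01 u x) (deriv01 (deriv01 u) x) = 0,
      u 0 = 0
    & u 1 = 0].

(* Functions on [0,1] are represented by functions on R, so the endpoints of the
   path are only prescribed on [0,1]. *)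
Definition steady_path_connected (u0 u1 : R -> R) :=
  exists p : R -> R -> R,
    [/\ forall s, s \in `[0, 1] -> steady_state (p s),
        forall s0, s0 \in `[0, 1] ->
          C2norm (fun x => p s x - p s0 x) @[s --> within `[0, 1] (nbhs s0)]
            --> (0 : R),
        forall x, x \in `[0, 1] -> p 0 x = u0 x
      & forall x, x \in `[0, 1] -> p 1 x = u1 x].

(* u t x is the value at time t and position x; u t is a representative of an
   element of H^1_0(0,1), which encodes the Dirichlet boundary conditions.
   sol_H10 and sol_continuous together mean u in C([0,T]; H^1_0(0,1)); sol_H2
   and sol_L2 mean u in L^2(0,T; H^2(0,1)); sol_dt and sol_dt_L2 mean that u_t is
   in L^2(0,T; L^2(0,1)). Elements of these Bochner spaces always have jointly
   measurable representatives, so sol_L2 and sol_dt_L2 do not restrict them. *)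
Record strong_solution_with (T : R) (f : R -> R -> R) (u0 : R -> R)
    (u ux uxx ut : R -> R -> R) : Prop := {
  sol_H10 : forall t, t \in `[0, T] -> H10 (u t) (ux t) ;
  sol_continuous : forall t0, t0 \in `[0, T] ->
    H1norm (fun x => u t x - u t0 x) (fun x => ux t x - ux t0 x)
      @[t --> within `[0, T] (nbhs t0)] --> (0 : R) ;
  sol_H2 : {ae lebesgue_measure, forall t : R, t \in `]0, T[ ->
    H1 (ux t) (uxx t)} ;
  sol_L2 : [/\ L2_cylinder T u, L2_cylinder T ux & L2_cylinder T uxx] ;
  sol_dt : weak_time_derivative T u ut ;
  sol_dt_L2 : L2_cylinder T ut ;
  sol_initial : {ae lebesgue_measure, forall x : R, x \in `]0, 1[ ->
    u 0 x = u0 x} ;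
  sol_equation : {ae lebesgue_measure, forall t : R, t \in `]0, T[ ->
    {ae lebesgue_measure, forall x : R, x \in `]0, 1[ ->
      ut t x = rhs (u t x) (ux t x) (uxx t x) + \1_(`]b, c[) x * f t x}}
}.

Definition strong_solution (T : R) (f : R -> R -> R) (u0 : R -> R)
    (u : R -> R -> R) :=
  exists ux uxx ut, strong_solution_with T f u0 u ux uxx ut.

End Equation.

(* Main.v *)
Require Import Defs.
From mathcomp Require Import all_boot all_order all_algebra.
From mathcomp Require Import all_classical all_reals all_analysis.
From mathcomp Require Import measurable_realfun ring lra zify.

(** Two steady states that are close to each other are joined exactly, in a fixed
    time, by a classical trajectory. Write the equation as [v_xx = v_t + F(v, v_x)]
    and solve it as a Cauchy problem in the space variable issued from [x = 0], where
    [v = 0] and [v_x] moves from [u0'(0)] to [u1'(0)] along a step of Gevrey class 2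
    in time; a source supported in [[b, c]] makes [u0] and [u1] exact solutions before
    and after the step. Two space primitives compensate the loss of one time
    derivative, which is what the Gevrey 2 scale allows, so Picard iteration
    converges. This solution is glued to its mirror image issued from [x = 1] by a
    cutoff whose slope lives in [[b, c]], and the control is the residual of the
    equation. The property of being joined by a trajectory is transitive and holds
    locally along the path, hence between its endpoints.

    The trajectory is a strong solution, and an energy estimate shows that strong
    solutions are unique: every strong solution equals [u1] at the final time, and the
    error is 0. *)

Set Implicit Arguments.
Unset Strict Implicit.
Unset Printing Implicit Defensive.

Import Order.TTheory GRing.Theory Num.Theory.
Import numFieldNormedType.Exports.

Local Open Scope classical_set_scope.
Local Open Scope ring_scope.

(** * Derivatives and primitives *)

(** Read in [x], the equation is ill-posed: every iteration consumes a time derivative. A step that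
    is constant outside a bounded interval cannot be analytic in time, so a weaker class is forced;
    the function [exp(-1/t)] has Gevrey order 2, which is the borderline case. There the cost of one
    time derivative, of order [k ^ 2] on normalized coefficients, is balanced by two integrations
    with nothing to spare, and smallness can only come from the Gevrey radius: the step must be
    slow. Its duration depends on no datum, whereas the admissible distance between the two steady
    states depends on the equation and on a bound of their [C^1] size; hence the chain of small
    moves along the path.

    No space of smooth functions of time is used. At each fixed time a function is replaced by the
    sequence of its Taylor coefficients in time, the iteration runs on such sequences for every time
    separately, and the coherence between different times is carried along as an invariant.

    The solution issued from [x = 0] has no reason to vanish at [x = 1]; this is what forces the
    second solution and the gluing. *)

Notation der f x l := (is_derive x 1 f l).

Section Derivatives.
Context {R : realType}.
Implicit Types (f g : R -> R) (x y a b l : R).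

Lemma der_eq f x l l' : der f x l -> l = l' -> der f x l'.
Proof. by move=> h <-. Qed.

Lemma der_near f g x l : (\near x, f x = g x) -> der f x l -> der g x l.
Proof. exact: near_eq_is_derive. Qed.

Lemma der_ext f g x l : f =1 g -> der f x l -> der g x l.
Proof. by move=> /funext ->. Qed.

Lemma derD f g x l m : der f x l -> der g x m -> der (fun y => f y + g y) x (l + m).
Proof. by move=> hf hg; exact: (is_deriveD hf hg). Qed.

Lemma derB f g x l m : der f x l -> der g x m -> der (fun y => f y - g y) x (l - m).
Proof. by move=> hf hg; exact: (is_deriveB hf hg). Qed.

Lemma derM f g x l m : der f x l -> der g x m ->
  der (fun y => f y * g y) x (l * g x + f x * m).
Proof.
move=> hf hg; apply: der_eq (is_deriveM hf hg) _.
by rewrite /GRing.scale /=; ring.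
Qed.

Lemma derC (c : R) x : der (fun _ => c) x 0.
Proof. exact: is_derive_cst. Qed.

Lemma derI x : der (fun y : R => y) x 1.
Proof. exact: is_derive_id. Qed.

Lemma derZ (c : R) f x l : der f x l -> der (fun y => c * f y) x (c * l).
Proof.
by move=> hf; apply: der_eq (derM (derC c x) hf) _; rewrite mul0r add0r.
Qed.

Lemma der_comp f g x l m : der f (g x) l -> der g x m -> der (fun y => f (g y)) x (l * m).
Proof. by move=> hf hg; exact: (is_derive1_comp hf hg). Qed.

Lemma derX f n x l : der f x l -> der (fun y => f y ^+ n) x (n%:R * f x ^+ n.-1 * l).
Proof.
move=> hf; elim: n => [|n IH].
  by apply: der_eq (derC 1 x) _; rewrite !mul0r.
apply: der_eq (der_ext _ (derM hf IH)) _ => [y|]; first by rewrite exprS.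
case: n {IH} => [|n]; first by rewrite !expr0 !mulr1 !mul0r mulr0 addr0 mul1r.
by rewrite -[n.+2%:R]natr1 /= exprS; ring.
Qed.

Lemma der_affine (c d x : R) : der (fun y => c * y + d) x c.
Proof.
by apply: der_eq (derD (derZ c (derI x)) (derC d x)) _; rewrite mulr1 addr0.
Qed.

Lemma der_sum n (f df : nat -> R -> R) x :
  (forall i, (i < n)%N -> der (f i) x (df i x)) ->
  der (fun y => \sum_(i < n) f i y) x (\sum_(i < n) df i x).
Proof.
elim: n => [|n IH] h.
  rewrite big_ord0; apply: der_ext (derC 0 x) => y; by rewrite big_ord0.
rewrite big_ord_recr /=.
apply: der_ext (derD (IH _) (h n _)) => // [y|i ni].
  by rewrite big_ord_recr.
by apply: h; apply: ltnW.
Qed.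

(** A form without division, in which [y = x] is allowed. [cvg01P] puts derivatives relative to
    [[0, 1]] in the same form, so that the two notions can be compared. *)
Lemma derP f x l : der f x l <->
  (forall e, 0 < e -> exists2 d, 0 < d & forall y, `|y - x| < d ->
     `|f y - f x - l * (y - x)| <= e * `|y - x|).
Proof.
split=> [[hd hl]|h].
  move=> e e0.
  have hc : h^-1 *: (f (h *: 1 + x) - f x) @[h --> 0^'] --> l.
    by rewrite -hl; exact: hd.
  have /cvgrPdist_le /(_ _ e0) [d /= d0 hd'] := hc.
  exists d => // y yd.
  have [->|yx] := eqVneq y x; first by rewrite !subrr mulr0 subrr normr0 mulr0.
  have yx0 : y - x != 0 by rewrite subr_eq0.
  have := hd' (y - x); rewrite /ball /= sub0r normrN => /(_ yd yx0).
  rewrite /GRing.scale /= mulr1 subrK => H.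
  have -> : f y - f x - l * (y - x) = - ((l - (y - x)^-1 * (f y - f x)) * (y - x)).
    by field.
  by rewrite normrN normrM ler_wpM2r.
have hc : h^-1 *: (f (h *: 1 + x) - f x) @[h --> 0^'] --> l.
  apply/cvgrPdist_le => /= e e0; have [d d0 hd] := h e e0.
  exists d => //= z; rewrite /ball /= sub0r normrN => zd z0.
  have := hd (z + x); rewrite addrK => /(_ zd).
  rewrite /GRing.scale /= mulr1 => H.
  have -> : l - z^-1 * (f (z + x) - f x) = - (f (z + x) - f x - l * z) / z by field.
  by rewrite normrM normfV normrN ler_pdivrMr // normr_gt0.
by apply: DeriveDef; [apply/cvg_ex; exists l|apply: cvg_lim].
Qed.

Lemma der_cont f x l : der f x l -> {for x, continuous f}.
Proof. by case=> /derivable1_diffP /differentiable_continuous. Qed.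

Lemma mvt f (df : R -> R) a b : a <= b ->
  (forall x, a <= x <= b -> der f x (df x)) ->
  exists2 c, a <= c <= b & f b - f a = df c * (b - a).
Proof.
move=> ab h.
have [x|y|c] := @MVT_segment R f df a b ab.
- by rewrite in_itv /= => /andP[ax xb]; apply: h; rewrite !ltW.
- apply: derivable_within_continuous => x; rewrite in_itv /= => axb.
  by have [] := h x axb.
- by rewrite in_itv /=; exists c.
Qed.

Lemma der_mono f df g dg a b : a <= b ->
  (forall x, a <= x <= b -> der f x (df x)) ->
  (forall x, a <= x <= b -> der g x (dg x)) ->
  (forall x, a <= x <= b -> df x <= dg x) -> f b - f a <= g b - g a.
Proof.
move=> ab hf hg h.
have [c cab e] := @mvt (fun y => g y - f y) (fun x => dg x - df x) a b ab
  (fun x hx => derB (hg x hx) (hf x hx)).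
rewrite -subr_ge0 (_ : _ - _ = g b - f b - (g a - f a)); last by ring.
by rewrite e mulr_ge0 // subr_ge0 ?h.
Qed.

Lemma der_mono_norm f df g dg a b : a <= b ->
  (forall x, a <= x <= b -> der f x (df x)) ->
  (forall x, a <= x <= b -> der g x (dg x)) ->
  (forall x, a <= x <= b -> `|df x| <= dg x) -> `|f b - f a| <= g b - g a.
Proof.
move=> ab hf hg h; rewrite ler_norml; apply/andP; split.
  have := @der_mono (fun x => - g x) (fun x => - dg x) f df a b ab _ hf.
  rewrite -opprD; apply=> x hx.
    by apply: der_eq (der_ext _ (derZ (-1) (hg x hx))) _ => [y|]; rewrite mulN1r.
  by have := h x hx; rewrite ler_norml => /andP[].
apply: (@der_mono f df g dg) => // x hx.
by have := h x hx; rewrite ler_norml => /andP[].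
Qed.

Lemma der_bound f df M a b :
  (forall x, Num.min a b <= x <= Num.max a b -> der f x (df x)) ->
  (forall x, Num.min a b <= x <= Num.max a b -> `|df x| <= M) ->
  `|f b - f a| <= M * `|b - a|.
Proof.
have H a' b' : a' <= b' -> (forall x, a' <= x <= b' -> der f x (df x)) ->
  (forall x, a' <= x <= b' -> `|df x| <= M) -> `|f b' - f a'| <= M * `|b' - a'|.
  move=> ab hf h; rewrite [`|b' - a'|]ger0_norm ?subr_ge0 // mulrBr.
  rewrite (_ : M * b' - M * a' = (M * b' + 0) - (M * a' + 0)); last by ring.
  apply: (der_mono_norm (df := df) (g := fun y => M * y + 0) (dg := fun=> M)) => //.
  by move=> x _; exact: der_affine.
have [ab|/ltW ba] := leP a b; first exact: H.
by move=> hf h; rewrite distrC [`|b - a|]distrC; apply: H.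
Qed.

(** The point [x] may be an endpoint: a two-sided derivative is already determined from one side.
    This serves functions that are known only on [[0, 1]], or only before or after a given time. *)
Lemma der_uniq_seg f g df dg a b x : a < b -> a <= x <= b ->
  (forall y, a <= y <= b -> f y = g y) -> der f x df -> der g x dg -> df = dg.
Proof.
move=> ab axb fg /derP hf /derP hg; apply/eqP; rewrite eq_sym -subr_eq0.
apply/negP => /negP ne.
have e0 : 0 < `|dg - df| / 4 by rewrite divr_gt0 // normr_gt0.
have [d1 d10 h1] := hf _ e0; have [d2 d20 h2] := hg _ e0.
have [y [yx [yab y1 y2]]] : exists y, y != x /\ [/\ a <= y <= b, `|y - x| < d1 & `|y - x| < d2].
  (* Moving from [x] by a quarter of [b - a] at most, towards the farther endpoint, never leaves the
     segment. *)
  pose d := Num.min (Num.min d1 d2) (b - a) / 4.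
  have d0 : 0 < d by rewrite divr_gt0 // !lt_min d10 d20 subr_gt0.
  have dle : d * 4 <= d1 /\ d * 4 <= d2 /\ d * 4 <= b - a.
    rewrite /d divfK //; split; [|split]; by rewrite !ge_min lexx ?orbT.
  have [hx|hx] := lerP x ((a + b) / 2).
    exists (x + d); rewrite (_ : x + d - x = d); last by ring.
    rewrite [`|_|]gtr0_norm //; split.
      by rewrite -subr_eq0 (_ : x + d - x = d) ?gt_eqF //; ring.
    by split; lra.
  exists (x - d); rewrite (_ : x - d - x = - d); last by ring.
  rewrite normrN [`|_|]gtr0_norm //; split.
    by rewrite -subr_eq0 (_ : x - d - x = - d) ?oppr_eq0 ?gt_eqF //; ring.
  by split; lra.
have := h1 y y1; have := h2 y y2; rewrite !fg // => H2 H1.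
have yx0 : 0 < `|y - x| by rewrite normr_gt0 subr_eq0.
have : `|dg - df| * `|y - x| <= 2 * (`|dg - df| / 4 * `|y - x|).
  rewrite -normrM (_ : (dg - df) * (y - x) = (g y - g x - df * (y - x)) - (g y - g x - dg * (y - x))); last by ring.
  by apply: le_trans (ler_normB _ _) _; rewrite [in leRHS]mulr_natl mulr2n lerD.
have : 0 < `|dg - df| * `|y - x| by rewrite mulr_gt0 // normr_gt0.
by lra.
Qed.

Lemma der_const_seg f df a b : a <= b ->
  (forall x, a <= x <= b -> der f x (df x)) ->
  (forall x, a <= x <= b -> df x = 0) -> f a = f b.
Proof.
move=> ab h0 h1; have [c cab] := mvt ab h0.
by rewrite h1 // mul0r => /eqP; rewrite subr_eq0 => /eqP ->.
Qed.

End Derivatives.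

Section Primitive.
Context {R : realType}.
Local Notation mu := (@lebesgue_measure R).
Implicit Types (f g : R -> R) (x y a b c M : R).

Let pa (a : R) (f : R -> R) (x : R) : R := \int[mu]_(t in `[a, x]) f t.

(* The base point of the integral moves left with [x], since an integral over
   [`[a, x]] is only differentiable in [x] for [a < x]. *)
Definition prim (f : R -> R) (x : R) : R := pa (- (`|x| + 1)) f x - pa (- (`|x| + 1)) f 0.

Lemma cont_integrable (f : R -> R) (a b : R) : continuous f ->
  mu.-integrable `[a, b] (EFin \o f).
Proof.
move=> cf; apply: continuous_compact_integrable; first exact: segment_compact.
exact: continuous_subspaceT.
Qed.

Let pa_der (a : R) (f : R -> R) (x : R) : continuous f -> a < x -> der (pa a f) x (f x).
Proof.
move=> cf ax.
have xx1 : x < x + 1 by rewrite ltrDl.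
have [h1 h2] := continuous_FTC1_closed xx1 (@cont_integrable f a (x + 1) cf) ax (cf x).
by rewrite derive1E in h2; exact: (DeriveDef h1 h2).
Qed.

Let pa_indep (a b : R) (f : R -> R) (x : R) : continuous f -> a < 0 -> b < 0 -> a < x -> b < x ->
  pa a f x - pa a f 0 = pa b f x - pa b f 0.
Proof.
move=> cf a0 b0 ax bx.
have H u v : u <= v -> a < u -> b < u -> pa a f u - pa b f u = pa a f v - pa b f v.
  move=> uv au bu.
  apply: (@der_const_seg R (fun y => pa a f y - pa b f y) (fun y => f y - f y)) => //.
    move=> y /andP[uy _]; apply: derB; apply: pa_der => //; exact: lt_le_trans uy.
  by move=> y _; rewrite subrr.
have [x0|/ltW x0] := leP x 0.
  by have := H _ _ x0 ax bx; lra.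
by have := H _ _ x0 a0 b0; lra.
Qed.

Lemma prim0 f : prim f 0 = 0.
Proof. by rewrite /prim subrr. Qed.

Lemma prim_der f x : continuous f -> der (prim f) x (f x).
Proof.
move=> cf.
have ax : - (`|x| + 2) < x.
  by rewrite ltrNl (le_lt_trans (ler_norm _)) // normrN ltrDl.
have a0 : - (`|x| + 2) < 0 by rewrite oppr_lt0 ltr_wpDl.
apply: der_near (der_eq (derB (pa_der cf ax) (derC (pa (- (`|x| + 2)) f 0) x)) _);
  last by rewrite subr0.
exists 1 => //= y; rewrite /ball /= => xy; rewrite /prim.
have xy1 : `|y| < `|x| + 1.
  have := ler_normB x (x - y).
  by rewrite opprB addrCA subrr addr0; lra.
have := ler_norm (- y); have := normr_ge0 y; rewrite normrN => y0 yy.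
by apply: pa_indep => //; lra.
Qed.

Lemma prim_uniq f (F : R -> R) x : continuous f -> F 0 = 0 ->
  (forall y, Num.min 0 x <= y <= Num.max 0 x -> der F y (f y)) -> F x = prim f x.
Proof.
move=> cf F0 h.
have := @der_bound R (fun y => F y - prim f y) (fun y => f y - f y) 0 0 x.
rewrite F0 prim0 !subrr subr0 mul0r normr_le0 subr_eq0 => H.
apply/eqP/H => y hy; last by rewrite subrr normr0.
exact: (derB (h y hy) (prim_der y cf)).
Qed.

Lemma prim_le f g dg x : continuous f -> 0 <= x ->
  (forall y, 0 <= y <= x -> der g y (dg y)) ->
  (forall y, 0 <= y <= x -> `|f y| <= dg y) -> `|prim f x| <= g x - g 0.
Proof.
move=> cf x0 hg h.
have := @der_mono_norm R (prim f) f g dg 0 x x0 (fun y _ => prim_der y cf) hg h.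
by rewrite prim0 subr0.
Qed.

Lemma prim_bound f M x : continuous f -> 0 <= x ->
  (forall y, 0 <= y <= x -> `|f y| <= M) -> `|prim f x| <= M * x.
Proof.
move=> cf x0 h.
have := @prim_le f (fun y => M * y + 0) (fun=> M) x cf x0.
by rewrite mulr0 !addr0 subr0; apply=> // y _; exact: der_affine.
Qed.

Lemma primB f g x : continuous f -> continuous g ->
  prim (fun y => f y - g y) x = prim f x - prim g x.
Proof.
move=> cf cg; symmetry; apply: (prim_uniq (f := fun y => f y - g y) (F := fun x => prim f x - prim g x)).
- by move=> y; apply: cvgB; [exact: cf|exact: cg].
- by rewrite !prim0 subr0.
- by move=> y _; apply: derB; exact: prim_der.
Qed.

Lemma primZ c f x : continuous f -> prim (fun y => c * f y) x = c * prim f x.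
Proof.
move=> cf; symmetry; apply: (prim_uniq (f := fun y => c * f y) (F := fun x => c * prim f x)).
- by move=> y; apply: cvgM; [exact: cvg_cst|exact: cf].
- by rewrite prim0 mulr0.
- by move=> y _; apply: derZ; exact: prim_der.
Qed.

Lemma prim_const c x : prim (fun=> c) x = c * x.
Proof.
symmetry; apply: (prim_uniq (f := fun=> c) (F := fun x => c * x)).
- by move=> y; exact: cvg_cst.
- by rewrite mulr0.
- by move=> y _; apply: der_eq (derZ c (derI y)) _; rewrite mulr1.
Qed.

End Primitive.

Global Opaque prim.

(** * A step function of Gevrey class 2 *)

Section CauchyProduct.
Context {R : realType}.
Implicit Types (a b : nat -> R).

Definition cauchy a b (k : nat) : R := \sum_(i < k.+1) a i * b (k - i)%N.

Lemma fact_mul_le i j : (i.+1`! * j.+1`! <= (i + j).+1`!)%N.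
Proof.
elim: i => [|i IH]; first by rewrite (_ : 1`! = 1)%N // mul1n add0n.
rewrite factS -mulnA addSn (factS (i + j).+1) leq_mul //; lia.
Qed.

(** The two extreme terms are [k]![each; every other term is at most]k.-1[!] by [fact_mul_le], and
    there are fewer than [k] of them. *)
Lemma sum_fact_le (k : nat) : (\sum_(i < k.+1) i`! * (k - i)`! <= 3 * k`!)%N.
Proof.
case: k => [|k]; first by rewrite big_ord_recr big_ord0.
rewrite big_ord_recr big_ord_recl /= subn0 subnn fact0 mul1n muln1.
have H : (\sum_(i < k) (bump 0 i)`! * (k.+1 - bump 0 i)`! <= \sum_(i < k) k`!)%N.
  apply: leq_sum => i _; have ik := ltn_ord i; rewrite /bump /= add1n subSS.
  have := fact_mul_le i (k - i).-1.
  by rewrite !prednK ?subn_gt0 // -addnS prednK ?subn_gt0 // subnKC // ltnW.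
rewrite sum_nat_const card_ord in H.
move: H; set S := (\sum_(i < k) _)%N => H; rewrite factS; move: (k`!)%N H => F H; nia.
Qed.

(** The constant 3 does not depend on [k]: functions of Gevrey order 2 with a given ratio form an
    algebra, which is what a polynomial nonlinearity requires. *)
Lemma cauchy_bound a b (A B w : R) k : 0 <= A -> 0 <= B -> 0 <= w ->
  (forall i, `|a i| <= A * (w ^+ i * i`!%:R)) ->
  (forall i, `|b i| <= B * (w ^+ i * i`!%:R)) ->
  `|cauchy a b k| <= 3 * A * B * (w ^+ k * k`!%:R).
Proof.
move=> A0 B0 w0 ha hb.
apply: (@le_trans _ _ (\sum_(i < k.+1) (A * B * w ^+ k) * (i`! * (k - i)`!)%:R)).
  apply: le_trans (ler_norm_sum _ _ _) _; apply: ler_sum => i _.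
  rewrite normrM; apply: le_trans (ler_pM _ _ (ha i) (hb (k - i)%N)) _ => //.
  have ik : (i <= k)%N by rewrite -ltnS ltn_ord.
  have -> : w ^+ k = w ^+ i * w ^+ (k - i) by rewrite -exprD subnKC.
  by rewrite natrM le_eqVlt; apply/orP; left; apply/eqP; ring.
rewrite -mulr_sumr -natr_sum.
rewrite (_ : 3 * A * B * (w ^+ k * k`!%:R) = A * B * w ^+ k * (3 * k`!)%:R); last first.
  by rewrite natrM; ring.
by rewrite ler_wpM2l ?ler_nat ?sum_fact_le // !mulr_ge0 // exprn_ge0.
Qed.

Lemma cauchyDB a b a' b' k :
  cauchy a b k - cauchy a' b' k =
  cauchy (fun i => a i - a' i) b k + cauchy a' (fun i => b i - b' i) k.
Proof.
rewrite /cauchy -sumrB -big_split /=; apply: eq_bigr => i _; ring.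
Qed.

Lemma cauchy_der (a b : nat -> R -> R) (t : R) (k : nat) :
  (forall i, der (a i) t (i.+1%:R * a i.+1 t)) ->
  (forall i, der (b i) t (i.+1%:R * b i.+1 t)) ->
  der (fun t => cauchy (a ^~ t) (b ^~ t) k) t
      (k.+1%:R * cauchy (a ^~ t) (b ^~ t) k.+1).
Proof.
move=> ha hb.
have := @der_sum R k.+1 (fun i t => a i t * b (k - i)%N t)
  (fun i t => i.+1%:R * a i.+1 t * b (k - i)%N t + a i t * ((k - i).+1%:R * b (k - i).+1 t)) t.
move=> /(_ (fun i _ => derM (ha i) (hb (k - i)%N))) h; apply: (der_eq h).
rewrite big_split /= /cauchy mulr_sumr.
(* Leibniz' rule for normalized coefficients: the factor [k.+1] splits as [i + (k.+1 - i)], one part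
   for each factor of the product. *)
rewrite [RHS](eq_bigr (fun i : 'I_k.+2 => i%:R * a i t * b (k.+1 - i)%N t
   + a i t * ((k.+1 - i)%:R * b (k.+1 - i)%N t))); last first.
  move=> i _; have ik : (i <= k.+1)%N by rewrite -ltnS.
  by rewrite -{1}(subnKC ik) natrD; ring.
rewrite big_split /=; congr (_ + _).
  rewrite [RHS]big_ord_recl /= !mul0r add0r; apply: eq_bigr => i _.
  by rewrite /bump /= add1n subSS.
rewrite [RHS]big_ord_recr /= subnn mul0r mulr0 addr0; apply: eq_bigr => i _.
by rewrite subSn // -ltnS.
Qed.

End CauchyProduct.

(** * The flat function, the bump and the step *)

Section GevreyStep.
Context {R : realType}.
Implicit Types (t y : R) (l : seq (R * nat)).

Lemma natS_neq0 n : n.+1%:R != 0 :> R.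
Proof. by rewrite pnatr_eq0. Qed.

Lemma fact_neq0 n : n`!%:R != 0 :> R.
Proof. by rewrite pnatr_eq0 -lt0n fact_gt0. Qed.

(* The derivatives of [expR (- t^-1)] are linear combinations of these functions,
   which take values in [0, 1]: bounding a derivative amounts to bounding the sum of
   the absolute values of its coefficients. *)
Definition exp_inv (m : nat) (t : R) : R :=
  if 0 < t then t^-1 ^+ m * expR (- t^-1) / m`!%:R else 0.

Lemma exp_inv_le0 m t : t <= 0 -> exp_inv m t = 0.
Proof. by rewrite /exp_inv; case: ltP. Qed.

Lemma pow_fact_le_exp (y : R) m : 0 <= y -> y ^+ m / m`!%:R <= expR y.
Proof.
elim: m y => [|m IH] y y0; first by rewrite expr0 fact0 divr1 -expR0 ler_expR.
have := @der_mono R (fun y => (m.+1`!%:R)^-1 * y ^+ m.+1) (fun y => y ^+ m / m`!%:R) expR expR 0 y y0.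
have -> : (m.+1`!%:R)^-1 * (0:R) ^+ m.+1 = 0 by rewrite expr0n mulr0.
rewrite subr0 expR0 => H.
rewrite mulrC; apply: le_trans (H _ _ _) _; last by rewrite lerBlDr lerDl.
- move=> x hx; apply: der_eq (derZ _ (derX m.+1 (derI x))) _.
  rewrite factS natrM /= mulr1 invfM.
  have := fact_neq0 m; have := natS_neq0 m; move: (m.+1%:R) (m`!%:R) => a F a0 F0.
  by field; rewrite a0 F0.
- by move=> x /andP[x0 _]; exact: IH.
Qed.

Lemma exp_inv_ge0 m t : 0 <= exp_inv m t.
Proof.
rewrite /exp_inv; case: ltP => // t0.
by rewrite !mulr_ge0 ?expR_ge0 ?exprn_ge0 ?invr_ge0 ?ler0n // ltW.
Qed.

Lemma exp_inv_le1 m t : exp_inv m t <= 1.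
Proof.
rewrite /exp_inv; case: ltP => // t0.
rewrite expRN mulrAC ler_pdivrMr ?expR_gt0 // mul1r.
by apply: pow_fact_le_exp; rewrite invr_ge0 ltW.
Qed.

(** This serves at [t = 0]: as [exp_inv m.+2] is bounded, [exp_inv m] is of order [t ^+ 2] there and
    its derivative vanishes. *)
Lemma exp_inv_sq m t : 0 < t -> exp_inv m t = (m.+1 * m.+2)%:R * exp_inv m.+2 t * t ^+ 2.
Proof.
move=> t0; rewrite /exp_inv t0 !factS !natrM 2!exprS.
have := fact_neq0 m; have := natS_neq0 m; have := natS_neq0 m.+1.
move: (m.+1%:R) (m.+2%:R) (m`!%:R) => a b F b0 a0 F0.
by field; rewrite a0 b0 F0 gt_eqF.
Qed.

Lemma exp_inv_der m t :
  der (exp_inv m) t ((m.+1 * m.+2)%:R * exp_inv m.+2 t - (m * m.+1)%:R * exp_inv m.+1 t).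
Proof.
have [t0|t0|->] := ltrgtP t 0.
- rewrite !exp_inv_le0 ?ltW // !mulr0 subrr; apply: der_near (derC 0 t).
  exists (- t); first by rewrite /= oppr_gt0.
  move=> y; rewrite /ball /= => ty.
  by rewrite exp_inv_le0 //; have := ler_norm (y - t); rewrite distrC; lra.
- apply: (@der_near R (fun t => (m`!%:R)^-1 * (t^-1 ^+ m * expR (- t^-1)))).
    exists t => //= y; rewrite /ball /= => ty; rewrite /exp_inv ifT; first by ring.
    by have := ler_norm (t - y); lra.
  have hi : der (fun t => t^-1) t (- t ^- 2).
    have tn0 : t != 0 by rewrite gt_eqF.
    by apply: der_eq (is_deriveV tn0 (derI t)) _; rewrite /GRing.scale /= mulr1.
  have hni : der (fun t => - t^-1) t (t ^- 2).
    by apply: der_eq (der_ext _ (derZ (-1) hi)) _ => [y|]; rewrite mulN1r ?opprK.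
  apply: der_eq (derZ _ (derM (derX m hi) (der_comp (is_derive_expR _) hni))) _.
  rewrite /exp_inv t0 !factS !natrM.
  case: m => [|m].
    rewrite !expr0 !mul0r subr0 mul1r add0r !mul1r fact0 !expr2.
    by field; rewrite gt_eqF.
  rewrite /= !exprS; set e := expR _.
  have := fact_neq0 m; have := natS_neq0 m; have := natS_neq0 m.+1; have := natS_neq0 m.+2.
  rewrite !factS !natrM -[m.+3%:R]natr1 -[m.+2%:R]natr1.
  move: (m.+1%:R) (m`!%:R) => a F c0 b0 a0 F0.
  by field; rewrite a0 b0 c0 F0 gt_eqF.
rewrite !exp_inv_le0 // !mulr0 subrr; apply/derP => e e0.
have M0 : 0 < (m.+1 * m.+2)%:R :> R by rewrite ltr0n.
exists (e / (m.+1 * m.+2)%:R); first by rewrite divr_gt0.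
move=> y; rewrite !subr0 mul0r subr0 (exp_inv_le0 m (lexx 0)) subr0 => yd.
have [y0|y0] := lerP y 0; first by rewrite exp_inv_le0 // normr0 mulr_ge0 // ltW.
rewrite exp_inv_sq // !normrM mulrA; apply: ler_pM => //.
rewrite (gtr0_norm M0) ger0_norm ?exp_inv_ge0 //.
move: yd; rewrite ltr_pdivlMr // mulrC => /ltW; apply: le_trans.
by rewrite ler_wpM2r // ler_piMr ?exp_inv_le1 // ltW.
Qed.

Definition eval_comb l t := \sum_(q <- l) q.1 * exp_inv q.2 t.
Definition norm_comb l := \sum_(q <- l) `|q.1|.

Definition diff_comb l : seq (R * nat) :=
  flatten [seq [:: (q.1 * (q.2.+1 * q.2.+2)%:R, q.2.+2); (- (q.1 * (q.2 * q.2.+1)%:R), q.2.+1)] | q <- l].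

Lemma eval_comb_der l t : der (eval_comb l) t (eval_comb (diff_comb l) t).
Proof.
elim: l => [|[a m] l IH]; rewrite /eval_comb /diff_comb /=.
  by rewrite big_nil; apply: der_ext (derC 0 t) => y; rewrite big_nil.
apply: der_eq (der_ext _ (derD (derZ a (exp_inv_der m t)) IH)) _.
  by move=> y; rewrite big_cons.
by rewrite !big_cons /= /eval_comb /diff_comb; ring.
Qed.

Lemma norm_diff_comb l k : all (fun q => q.2 <= k.*2)%N l ->
  norm_comb (diff_comb l) <= norm_comb l * (8 * k.+1 ^ 2)%:R /\ all (fun q => q.2 <= k.+1.*2)%N (diff_comb l).
Proof.
elim: l => [|[a m] l IH] /=; first by rewrite /norm_comb /diff_comb !big_nil mul0r.
move=> /andP[mk /IH [h1 h2]]; split; last first.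
  by rewrite h2 andbT; apply/andP; split; lia.
rewrite /norm_comb /diff_comb /= !big_cons /= mulrDl addrA; apply: lerD; last exact: h1.
rewrite normrN !normrM !normr_nat -mulrDr ler_wpM2l // -natrD ler_nat; nia.
Qed.

Lemma eval_comb_bound l t : `|eval_comb l t| <= norm_comb l.
Proof.
apply: le_trans (ler_norm_sum _ _ _) _; apply: ler_sum => q _.
by rewrite normrM ler_piMr // ger0_norm ?exp_inv_ge0 // exp_inv_le1.
Qed.

Definition comb_iter k := iter k diff_comb [:: (1, 0%N)].

Lemma comb_iter_bound k : norm_comb (comb_iter k) <= (8 ^ k * k`! ^ 2)%:R /\ all (fun q => q.2 <= k.*2)%N (comb_iter k).
Proof.
elim: k => [|k [h1 h2]]; first by rewrite /comb_iter /norm_comb /= big_seq1 normr1.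
have [h3 h4] := norm_diff_comb h2; split; last exact: h4.
apply: le_trans h3 _; apply: le_trans (ler_wpM2r _ h1) _; first exact: ler0n.
rewrite -natrM ler_nat factS expnMn; apply: eq_leq.
by rewrite (expnS 8 k) mulnACA (mulnC _ 8)%N (mulnC (k`! ^ 2)%N).
Qed.

(* Here and below, the index [k] of a jet is the order of a derivative divided by
   [k`!], so that products of functions become Cauchy products. *)
Definition flat_jet k t := (k`!%:R)^-1 * eval_comb (comb_iter k) t.

Lemma flat_jet_der k t : der (flat_jet k) t (k.+1%:R * flat_jet k.+1 t).
Proof.
apply: der_eq (derZ _ (eval_comb_der (comb_iter k) t)) _; rewrite /flat_jet [comb_iter k.+1]iterS factS natrM.
by field; rewrite !nat1r !pnatr_eq0 -lt0n fact_gt0.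
Qed.

Lemma flat_jet_bound k t : `|flat_jet k t| <= 1 * (8 ^+ k * k`!%:R).
Proof.
have k0 : 0 < k`!%:R :> R by rewrite ltr0n fact_gt0.
rewrite /flat_jet normrM normfV normr_nat mulrC ler_pdivrMr // mul1r.
apply: le_trans (eval_comb_bound _ _) _; apply: le_trans (comb_iter_bound k).1 _.
by rewrite natrM natrX -mulrA -natrM.
Qed.

Lemma flat_jet_le0 k t : t <= 0 -> flat_jet k t = 0.
Proof.
move=> t0; rewrite /flat_jet /eval_comb big1 ?mulr0 // => q _; by rewrite exp_inv_le0 // mulr0.
Qed.

Lemma flat_jet0 t : flat_jet 0 t = exp_inv 0 t.
Proof. by rewrite /flat_jet /comb_iter /eval_comb /= big_seq1 fact0 invr1 !mul1r. Qed.

Definition flat_jet_rev k t := (-1) ^+ k * flat_jet k (1 - t).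

Lemma flat_jet_rev_der k t : der (flat_jet_rev k) t (k.+1%:R * flat_jet_rev k.+1 t).
Proof.
have h : der (fun y => 1 - y) t (-1).
  by apply: der_eq (derB (derC 1 t) (derI t)) _; rewrite sub0r.
by apply: der_eq (derZ _ (der_comp (flat_jet_der k _) h)) _; rewrite /flat_jet_rev exprS; ring.
Qed.

Lemma flat_jet_rev_bound k t : `|flat_jet_rev k t| <= 1 * (8 ^+ k * k`!%:R).
Proof. by rewrite /flat_jet_rev normrM normrX normrN1 expr1n [X in X <= _]mul1r; exact: flat_jet_bound. Qed.

Definition bump_jet k t := cauchy (flat_jet ^~ t) (flat_jet_rev ^~ t) k.

Lemma bump_jet_der k t : der (bump_jet k) t (k.+1%:R * bump_jet k.+1 t).
Proof.
exact: (@cauchy_der R flat_jet flat_jet_rev t k (flat_jet_der ^~ t) (flat_jet_rev_der ^~ t)).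
Qed.

Lemma bump_jet_bound k t : `|bump_jet k t| <= 3 * (8 ^+ k * k`!%:R).
Proof.
have := @cauchy_bound R (flat_jet ^~ t) (flat_jet_rev ^~ t) 1 1 8 k ler01 ler01.
by rewrite !mulr1; apply=> // i; [exact: flat_jet_bound|exact: flat_jet_rev_bound].
Qed.

Lemma bump_jet_out k t : t <= 0 \/ 1 <= t -> bump_jet k t = 0.
Proof.
move=> h; rewrite /bump_jet /cauchy big1 // => i _; case: h => h.
  by rewrite flat_jet_le0 // mul0r.
by rewrite /flat_jet_rev (@flat_jet_le0 _ (1 - t)) ?mulr0 // subr_le0.
Qed.

Lemma bump_jet0E t : bump_jet 0 t = exp_inv 0 t * exp_inv 0 (1 - t).
Proof. by rewrite /bump_jet /cauchy big_ord_recr big_ord0 /= add0r /flat_jet_rev expr0 mul1r !flat_jet0. Qed.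

Lemma bump_jet0_cont : continuous (bump_jet 0).
Proof. by move=> t; exact: (der_cont (bump_jet_der 0 t)). Qed.

Lemma bump_jet0_ge0 t : 0 <= bump_jet 0 t.
Proof. by rewrite bump_jet0E mulr_ge0 ?exp_inv_ge0. Qed.

Lemma prim_bump_mono a b : a <= b -> prim (bump_jet 0) a <= prim (bump_jet 0) b.
Proof.
move=> ab; have := @der_mono R (fun=> 0) (fun=> 0) (prim (bump_jet 0)) (bump_jet 0) a b ab.
rewrite subr0 subr_ge0; apply=> x _ //; [exact: prim_der bump_jet0_cont|exact: bump_jet0_ge0].
Qed.

Definition bump_mass := prim (bump_jet 0) 1.

Lemma bump_mass_gt0 : 0 < bump_mass.
Proof.
have h : 1/4 <= 3/4 :> R by lra.
(* On [[1/4, 3/4]] both [x^-1] and [(1 - x)^-1] are at most 4, so the bump is at least [expR (-8)]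
   there. *)
have := @der_mono R (fun x => expR (-8) * x + 0) (fun=> expR (-8)) (prim (bump_jet 0)) (bump_jet 0) _ _ h
  (fun x _ => der_affine _ _ x) (fun x _ => prim_der x bump_jet0_cont).
have h1 : prim (bump_jet 0) (3/4) <= bump_mass by apply: prim_bump_mono; lra.
have h2 : 0 <= prim (bump_jet 0) (1/4) by rewrite -(prim0 (bump_jet 0)); apply: prim_bump_mono; lra.
have e0 := @expR_gt0 R (-8).
move=> H; suff : forall x : R, 1 / 4 <= x <= 3 / 4 -> expR (-8) <= bump_jet 0 x by move/H; lra.
move=> x /andP[x1 x2]; rewrite bump_jet0E /exp_inv !ifT; [|lra|lra].
rewrite !expr0 !fact0 !mul1r !divr1 -expRD ler_expR.
have i4 y : 1/4 <= y -> y^-1 <= 4 :> R.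
  by move=> y4; rewrite -[leRHS]invrK lef_pV2 ?posrE ?invr_gt0 //; lra.
by have := i4 x x1; have := i4 (1 - x); lra.
Qed.

Lemma prim_bump_le0 t : t <= 0 -> prim (bump_jet 0) t = 0.
Proof.
move=> t0; rewrite -[RHS](prim0 (bump_jet 0)).
apply: (@der_const_seg R (prim (bump_jet 0)) (bump_jet 0) t 0) => // x.
  by move=> _; exact: prim_der bump_jet0_cont.
by move=> /andP[_ x0]; apply: bump_jet_out; left.
Qed.

Lemma prim_bump_ge1 t : 1 <= t -> prim (bump_jet 0) t = bump_mass.
Proof.
move=> t1; apply/esym.
apply: (@der_const_seg R (prim (bump_jet 0)) (bump_jet 0) 1 t) => // x.
  by move=> _; exact: prim_der bump_jet0_cont.
by move=> /andP[x0 _]; apply: bump_jet_out; right.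
Qed.

(** The jet of the normalized primitive of the bump: integration moves index [k'] to [k'.+1] and
    divides by [k'.+1]. *)
Definition gstep (k : nat) (t : R) : R :=
  if k is k'.+1 then bump_jet k' t / (k%:R * bump_mass) else prim (bump_jet 0) t / bump_mass.

Lemma gstep_der k t : der (gstep k) t (k.+1%:R * gstep k.+1 t).
Proof.
have c0 : bump_mass != 0 by rewrite gt_eqF ?bump_mass_gt0.
case: k => [|k].
  apply: der_eq (der_ext _ (derZ bump_mass^-1 (prim_der t bump_jet0_cont))) _ => [y|].
    by rewrite mulrC.
  by rewrite /gstep; field.
apply: der_eq (der_ext _ (derZ (k.+1%:R * bump_mass)^-1 (bump_jet_der k t))) _ => [y|].
  by rewrite mulrC.
have := natS_neq0 k; have := natS_neq0 k.+1; rewrite /gstep.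
by move: (k.+1%:R) (k.+2%:R) => a b b0 a0; field; rewrite c0 a0 b0.
Qed.

Lemma gstep_le0 k t : t <= 0 -> gstep k t = 0.
Proof.
move=> t0; case: k => [|k] /=; last by rewrite bump_jet_out ?mul0r //; left.
by rewrite prim_bump_le0 // mul0r.
Qed.

Lemma gstep_ge1 k t : 1 <= t -> gstep k t = (k == 0%N)%:R.
Proof.
move=> t0; case: k => [|k] /=; last by rewrite bump_jet_out ?mul0r //; right.
by rewrite prim_bump_ge1 // divff // gt_eqF ?bump_mass_gt0.
Qed.

Lemma gstep01 t : 0 <= gstep 0 t <= 1.
Proof.
have c0 := bump_mass_gt0; rewrite /gstep ler_pdivrMr // mul1r.
rewrite pmulr_lge0 ?invr_gt0 //; apply/andP; split.
  have [t0|/ltW t0] := leP t 0; first by rewrite prim_bump_le0.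
  by rewrite -(prim0 (bump_jet 0)); exact: prim_bump_mono.
have [t1|/ltW t1] := leP t 1; first exact: prim_bump_mono.
by rewrite prim_bump_ge1.
Qed.

Lemma gstep_bound : exists2 A : R, 0 < A & forall k t, `|gstep k t| <= A * (8 ^+ k * k`!%:R).
Proof.
have ci : 0 < bump_mass^-1 by rewrite invr_gt0 bump_mass_gt0.
exists (1 + 3 / bump_mass) => [|[|k] t]; first lra.
  have := gstep01 t => /andP[h0 h1]; rewrite ger0_norm // expr0 mul1r mulr1.
  by apply: le_trans h1 _; lra.
rewrite /gstep normrM normfV (gtr0_norm (mulr_gt0 _ bump_mass_gt0)) ?ltr0n //.
apply: (@le_trans _ _ (3 / bump_mass * (8 ^+ k.+1 * k.+1`!%:R))); last first.
  by rewrite ler_wpM2r ?lerDr // mulr_ge0 // exprn_ge0.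
rewrite invfM mulrCA mulrC ler_pdivrMr ?ltr0n //.
rewrite mulrC [leRHS]mulrC.
apply: le_trans (ler_wpM2l (ltW ci) (bump_jet_bound k t)) _.
rewrite exprS factS natrM.
have -> : k.+1%:R * (3 / bump_mass * (8 * 8 ^+ k * (k.+1%:R * k`!%:R))) =
   bump_mass^-1 * (3 * (8 ^+ k * k`!%:R)) * (8 * (k.+1 * k.+1)%:R) :> R by rewrite natrM; ring.
rewrite ler_peMr //; first by rewrite !mulr_ge0 // ?exprn_ge0 // ltW.
by rewrite -natrM ler1n.
Qed.

End GevreyStep.

(** * Jets in time *)

Section RealPreliminaries.
Context {R : realType}.

(** Composition with [clamp] makes a function known on [[0, 1]] into one on the line, for which
    continuity can be stated globally and [prim] applied. *)
Definition clamp (x : R) : R := Num.max 0 (Num.min x 1).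

Lemma clamp_id (x : R) : 0 <= x <= 1 -> clamp x = x.
Proof. by move=> /andP[x0 x1]; rewrite /clamp min_l // max_r. Qed.

Lemma clamp_itv (x : R) : 0 <= clamp x <= 1.
Proof. by rewrite /clamp le_max lexx /= ge_max ler01 ge_min lexx orbT. Qed.

Lemma clamp_cont : continuous clamp.
Proof.
move=> x; apply: (@continuous_max R R (fun=> 0) (fun x => Num.min x 1)).
  exact: cvg_cst.
by apply: (@continuous_min R R id (fun=> 1)); [exact: cvg_id|exact: cvg_cst].
Qed.

Lemma taylor2 (f f1 f2 : R -> R) (M s t : R) :
  (forall x : R, der f x (f1 x)) -> (forall x : R, der f1 x (f2 x)) ->
  (forall x : R, `|f2 x| <= M) ->
  `|f t - f s - (t - s) * f1 s| <= M * (t - s) ^+ 2.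
Proof.
move=> h h1 h2.
have -> : f t - f s - (t - s) * f1 s = (f t - f1 s * t) - (f s - f1 s * s) by ring.
rewrite -real_normK ?num_real // expr2 mulrA.
have M0 : 0 <= M := le_trans (normr_ge0 _) (h2 0).
apply: (@der_bound R (fun x => f x - f1 s * x) (fun x => f1 x - f1 s)).
  by move=> x _; apply: der_eq (derB (h x) (derZ (f1 s) (derI x))) _; rewrite mulr1.
move=> x hx; apply: le_trans (@der_bound R f1 f2 M s x _ _) _ => //.
rewrite ler_wpM2l //; move: hx; have [st|/ltW ts] := leP s t => /andP[h3 h4].
  by rewrite !ger0_norm ?subr_ge0 // lerB.
by rewrite !ler0_norm ?subr_le0 // !opprB lerB.
Qed.

(** Together with [taylor2] this trades differentiability in time for an inequality with a uniform
    constant, which survives integration in space and passage to a limit. *)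
Lemma der_of_taylor (f : R -> R) (l M s : R) :
  (forall t, `|f t - f s - (t - s) * l| <= M * (t - s) ^+ 2) -> der f s l.
Proof.
move=> h; apply/derP => e e0.
have M1 : 0 < `|M| + 1 by rewrite ltr_wpDl.
exists (e / (`|M| + 1)); first by rewrite divr_gt0.
move=> y; rewrite ltr_pdivlMr // => hy; rewrite [l * _]mulrC.
apply: le_trans (h y) _; rewrite -real_normK ?num_real // expr2 mulrA ler_wpM2r //.
apply: le_trans (ltW hy); rewrite mulrC ler_wpM2l //.
by apply: le_trans (ler_norm _) _; rewrite lerDl.
Qed.

(** The intervals of radius [2 * C / 2 ^+ n] around [u n] are nested; the limit is the supremum of
    their left ends. *)
Lemma geometric_limit (u : nat -> R) (C : R) :
  (forall n, `|u n.+1 - u n| <= C / 2 ^+ n) ->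
  exists l, forall n, `|l - u n| <= 2 * C / 2 ^+ n.
Proof.
move=> h.
pose a n := u n - 2 * C / 2 ^+ n; pose b n := u n + 2 * C / 2 ^+ n.
have C0 : 0 <= C by have := h 0%N; rewrite expr0 divr1; exact: le_trans.
have e2 n : 2 * C / 2 ^+ n.+1 = C / 2 ^+ n.
  by rewrite exprS; field; rewrite expf_neq0.
have cn n : 0 <= C / 2 ^+ n by rewrite divr_ge0 // exprn_ge0.
have e3 n : 2 * C / 2 ^+ n = C / 2 ^+ n + C / 2 ^+ n by ring.
have aS n : a n <= a n.+1.
  by have := h n; have := cn n; rewrite /a e2 e3 ler_norml => ? /andP[]; lra.
have bS n : b n.+1 <= b n.
  by have := h n; have := cn n; rewrite /b e2 e3 ler_norml => ? /andP[]; lra.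
have am n m : (n <= m)%N -> a n <= a m.
  by move=> nm; apply: (@homo_leq _ a <=%R) => //; exact: le_trans.
have bm n m : (n <= m)%N -> b m <= b n.
  by move=> nm; apply: (@homo_leq _ b (fun x y => y <= x)) => // x y z xy yz; exact: le_trans xy.
have ab n m : a n <= b m.
  apply: le_trans (am _ _ (leq_maxl n m)) _; apply: le_trans (bm _ _ (leq_maxr n m)).
  by rewrite /a /b; have := cn (maxn n m); rewrite e3; lra.
exists (sup (range a)) => n.
have h1 : a n <= sup (range a).
  by apply: ub_le_sup; [exists (b 0%N) => _ [m _ <-]|exists n].
have h2 : sup (range a) <= b n.
  by apply: ge_sup; [exists (a 0%N); exists 0%N|move=> _ [m _ <-]].
by move: h1 h2; rewrite /a /b ler_norml => h1 h2; apply/andP; split; lra.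
Qed.

Lemma geometric_le0 (x C : R) : (forall n, x <= C / 2 ^+ n) -> x <= 0.
Proof.
move=> h; rewrite leNgt; apply/negP => x0.
have C0 : 0 < C by have := h 0%N; rewrite expr0 divr1; exact: lt_le_trans.
have [n hn] : exists n, C / x < 2 ^+ n.
  exists (Num.truncn (C / x)).+1; apply: lt_trans (truncnS_gt _) _.
  by rewrite -natrX ltr_nat ltn_expl.
have := h n; rewrite ler_pdivlMr ?exprn_gt0 //.
by move: hn; rewrite ltr_pdivrMr // mulrC => hn /le_lt_trans/(_ hn); rewrite ltxx.
Qed.

End RealPreliminaries.

Section Jets.
Context {R : realType}.
Implicit Types (a b q : nat -> R -> R) (th mu M N x : R).

(* A jet [q k x] stands for the [k]-th Taylor coefficient in time, at a fixed
   time, of a function of time and space.  The weights in [jbnd] are those of the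
   Gevrey class of order 2 with a radius shrinking like [expR (- x)]; this is what
   makes two space primitives absorb one time derivative. *)
Definition jbnd th mu M q := forall k x, 0 <= x <= 1 ->
  `|q k x| <= M * expR (mu * x) * ((th * expR x) ^+ k * k`!%:R).

Definition jcont q := forall k, continuous (fun x => q k (clamp x)).

Definition jsub a b k x := a k x - b k x.
Definition jadd a b k x := a k x + b k x.
Definition jmul a b k x := cauchy (a ^~ x) (b ^~ x) k.
Definition jcst (w : R -> R) k x := w x *+ (k == 0%N).
Definition jprim q k x := prim (fun z => q k (clamp z)) x.
(** The jet of the time derivative. *)
Definition jshift q k x := k.+1%:R * q k.+1 x.

Lemma jbnd_le th mu M M' q : 0 <= th -> M <= M' -> jbnd th mu M q -> jbnd th mu M' q.
Proof.
move=> th0 MM h k x hx; apply: le_trans (h k x hx) _.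
by rewrite -!mulrA ler_wpM2r // !mulr_ge0 ?expR_ge0 ?exprn_ge0 // mulr_ge0 ?expR_ge0.
Qed.

Lemma jbnd_add th mu M N a b : jbnd th mu M a -> jbnd th mu N b -> jbnd th mu (M + N) (jadd a b).
Proof.
move=> ha hb k x hx; apply: le_trans (ler_normD _ _) _.
by rewrite !mulrDl lerD ?ha ?hb.
Qed.

Lemma jbnd_sub th mu M N a b : jbnd th mu M a -> jbnd th mu N b -> jbnd th mu (M + N) (jsub a b).
Proof.
move=> ha hb k x hx; apply: le_trans (ler_normB _ _) _.
by rewrite !mulrDl lerD ?ha ?hb.
Qed.

Lemma jbnd_ext th mu M a b : (forall k x, 0 <= x <= 1 -> a k x = b k x) ->
  jbnd th mu M a -> jbnd th mu M b.
Proof. by move=> e h k x hx; rewrite -e //; exact: h. Qed.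

(** Only one factor carries [expR (mu * x)], since otherwise the product would carry its square.
    This is why functions are bounded with [mu = 0] and differences with [mu]. *)
Lemma jbnd_mul th mu M N a b : 0 <= th -> 0 <= M -> 0 <= N ->
  jbnd th 0 M a -> jbnd th mu N b -> jbnd th mu (3 * M * N) (jmul a b).
Proof.
move=> th0 M0 N0 ha hb k x hx.
rewrite -[3 * M * N * _]mulrA; apply: cauchy_bound => //.
- by rewrite mulr_ge0 ?expR_ge0.
- by rewrite mulr_ge0 ?expR_ge0.
- by move=> i; have := ha i x hx; rewrite mul0r expR0 mulr1.
- by move=> i; exact: hb.
Qed.

Lemma jmulC a b k x : jmul a b k x = jmul b a k x.
Proof.
rewrite /jmul /cauchy (reindex_inj rev_ord_inj) /=; apply: eq_bigr => i _.
by rewrite subSS mulrC subKn // -ltnS.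
Qed.

Lemma jbnd_cst th M w : 0 <= th -> (forall x, 0 <= x <= 1 -> `|w x| <= M) -> jbnd th 0 M (jcst w).
Proof.
move=> th0 h k x hx; rewrite /jcst mul0r expR0 mulr1.
have M0 : 0 <= M := le_trans (normr_ge0 _) (h x hx).
case: k => [|k]; first by rewrite expr0 fact0 !mulr1 mulr1n; exact: h.
by rewrite mulr0n normr0 !mulr_ge0 // exprn_ge0 // mulr_ge0 ?expR_ge0.
Qed.

Lemma jbnd_mu0 th mu M q : 0 <= th -> 0 <= M -> 0 <= mu ->
  jbnd th mu M q -> jbnd th 0 (M * expR mu) q.
Proof.
move=> th0 M0 mu0 h k x hx; apply: le_trans (h k x hx) _.
rewrite mul0r expR0 mulr1 ler_wpM2r //; last first.
  by rewrite ler_wpM2l // ler_expR; have /andP[_ x1] := hx; rewrite ler_piMr.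
by rewrite mulr_ge0 // exprn_ge0 // mulr_ge0 ?expR_ge0.
Qed.

Lemma jcont_add a b : jcont a -> jcont b -> jcont (jadd a b).
Proof. by move=> ha hb k x; apply: cvgD; [exact: ha|exact: hb]. Qed.

Lemma jcont_sub a b : jcont a -> jcont b -> jcont (jsub a b).
Proof. by move=> ha hb k x; apply: cvgB; [exact: ha|exact: hb]. Qed.

Lemma jcont_mul a b : jcont a -> jcont b -> jcont (jmul a b).
Proof.
move=> ha hb k; rewrite /jmul /cauchy.
suff H n m : continuous (fun x => \sum_(i < n) a i (clamp x) * b (m - i)%N (clamp x)) by exact: H.
elim: n => [|n IH] x.
  by under eq_fun do rewrite big_ord0; exact: cvg_cst.
under eq_fun do rewrite big_ord_recr /=.
by apply: cvgD; [exact: IH|apply: cvgM; [exact: ha|exact: hb]].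
Qed.

Lemma jcont_cst w : continuous (fun x => w (clamp x)) -> jcont (jcst w).
Proof.
by move=> h [|k] x; rewrite /jcst; [exact: h|under eq_fun do rewrite mulr0n; exact: cvg_cst].
Qed.

Lemma jcont_prim q : jcont q -> jcont (jprim q).
Proof.
move=> h k x; rewrite /jprim; apply: (@continuous_comp _ _ _ clamp (prim _)).
  exact: clamp_cont.
exact: (der_cont (prim_der _ (h k))).
Qed.

Lemma jcont_shift q : jcont q -> jcont (jshift q).
Proof. by move=> h k x; apply: cvgM; [exact: cvg_cst|exact: h]. Qed.

Lemma jprim_sub a b k x : jcont a -> jcont b -> jprim (jsub a b) k x = jprim a k x - jprim b k x.
Proof. by move=> ha hb; rewrite /jprim (primB x (ha k) (hb k)). Qed.

(** In [x] the whole weight is a single exponential of rate [mu + k%:R], and integrating it divides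
    by that rate. *)
Lemma weightE th mu (C : R) k x : C * expR (mu * x) * ((th * expR x) ^+ k * k`!%:R) =
  C * (th ^+ k * k`!%:R) * expR ((mu + k%:R) * x).
Proof. by rewrite mulrDl expRD expRM_natl exprMn; ring. Qed.

Lemma jprim_bound_exp q (C c x : R) k : jcont q -> 0 < c -> 0 <= x <= 1 ->
  (forall x, 0 <= x <= 1 -> `|q k x| <= C * expR (c * x)) -> `|jprim q k x| <= C / c * expR (c * x).
Proof.
move=> cq c0 /andP[x0 x1] h.
have C0 : 0 <= C by have := h 0; rewrite lexx ler01 mulr0 expR0 mulr1 => /(_ isT); exact: le_trans.
have := @prim_le R (fun z => q k (clamp z)) (fun z => C / c * expR (c * z)) (fun z => C * expR (c * z)) x (cq k) x0.
move=> H; apply: le_trans (H _ _) _.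
- move=> y _.
  have hc : der (fun y => c * y) y c by apply: der_eq (derZ c (derI y)) _; rewrite mulr1.
  apply: der_eq (derZ (C / c) (der_comp (is_derive_expR (c * y)) hc)) _.
  by field; rewrite gt_eqF.
- move=> y /andP[y0 yx]; rewrite clamp_id ?y0 ?(le_trans yx) //; apply: h.
  by rewrite y0 (le_trans yx).
by rewrite gerBl mulr_ge0 ?expR_ge0 // divr_ge0 // ltW.
Qed.

Lemma jbnd_prim_gain th mu N q k x : 0 <= th -> 0 < mu -> 0 <= N -> jcont q -> 0 <= x <= 1 ->
  (forall x, 0 <= x <= 1 -> `|q k x| <= N * expR (mu * x) * ((th * expR x) ^+ k * k`!%:R)) ->
  `|jprim q k x| <= N / (mu + k%:R) * expR (mu * x) * ((th * expR x) ^+ k * k`!%:R).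
Proof.
move=> th0 mu0 N0 cq hx h; rewrite weightE.
have c0 : 0 < mu + k%:R by rewrite ltr_wpDr.
rewrite (_ : N / (mu + k%:R) * _ = N * (th ^+ k * k`!%:R) / (mu + k%:R)); last by ring.
by apply: jprim_bound_exp => // y hy; rewrite -weightE; exact: h.
Qed.

(** Of the gain only [mu^-1] is kept, as in Bielecki's weighted norms: a large [mu] makes the
    nonlinear term contracting. *)
Lemma jbnd_prim th mu N q : 0 <= th -> 0 < mu -> 0 <= N -> jcont q -> jbnd th mu N q ->
  jbnd th mu (N / mu) (jprim q).
Proof.
move=> th0 mu0 N0 cq h k x hx.
apply: le_trans (jbnd_prim_gain th0 mu0 N0 cq hx (h k)) _.
rewrite -!mulrA ler_wpM2l // ler_wpM2r ?lef_pV2 ?posrE ?ltr_wpDr ?lerDl //.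
by rewrite !mulr_ge0 ?expR_ge0 // exprn_ge0 // mulr_ge0 ?expR_ge0.
Qed.

(** The derivative costs [k.+1] by its definition and [k.+1] more through the factorial of the
    weight; each primitive gains [(mu + k.+1%:R)^-1]. What remains is [th * expR x]. No choice of
    [mu] makes it small uniformly in [k], so the smallness has to come from [th]. *)
Lemma jbnd_shift_prim2 th mu N q : 0 <= th -> 0 < mu -> 0 <= N -> jcont q -> jbnd th mu N q ->
  jbnd th mu (N * (th * expR 1)) (jshift (jprim (jprim q))).
Proof.
move=> th0 mu0 N0 cq h k x hx.
have m0 : 0 < mu + k.+1%:R by rewrite ltr_wpDr.
have H y : 0 <= y <= 1 -> _ := fun hy => jbnd_prim_gain th0 mu0 N0 cq hy (h k.+1).
have N1 : 0 <= N / (mu + k.+1%:R) by rewrite divr_ge0 // ltW.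
have {H} := jbnd_prim_gain th0 mu0 N1 (jcont_prim cq) hx H.
rewrite /jshift normrM normr_nat => H.
apply: le_trans (ler_wpM2l _ H) _ => //.
set m := mu + _ in m0 N1 *.
rewrite factS natrM exprS.
set E := expR (mu * x); set w := _ ^+ k; set f := k`!%:R.
have E0 : 0 <= E by rewrite expR_ge0.
have w0 : 0 <= w by rewrite exprn_ge0 // mulr_ge0 ?expR_ge0.
have ex : expR x <= expR 1 by rewrite ler_expR; have /andP[] := hx.
have km : k.+1%:R / m <= 1 by rewrite ler_pdivrMr // mul1r lerDr ltW.
have km0 : 0 <= k.+1%:R / m by rewrite divr_ge0 // ltW.
rewrite [leLHS](_ : _ = N * (k.+1%:R / m * (k.+1%:R / m)) * (th * expR x) * (E * w * f)); last by ring.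
rewrite [leRHS](_ : _ = N * 1 * (th * expR 1) * (E * w * f)); last by ring.
apply: ler_wpM2r; first by rewrite !mulr_ge0.
apply: ler_pM.
- by rewrite mulr_ge0 // mulr_ge0.
- by rewrite mulr_ge0 ?expR_ge0.
- by rewrite ler_wpM2l // mulr_ile1.
- by rewrite ler_wpM2l.
Qed.

(** Polynomials in [v] and [v_x] as syntax: the nonlinearity can then be evaluated on numbers and on
    jets alike, and its estimates follow by induction. *)
Inductive pexpr := PVal | PSlope | PCst of R | PAdd of pexpr & pexpr | PMul of pexpr & pexpr.

Fixpoint peval (e : pexpr) (v p : R) : R :=
  match e with
  | PVal => v | PSlope => p | PCst c => c
  | PAdd e1 e2 => peval e1 v p + peval e2 v p
  | PMul e1 e2 => peval e1 v p * peval e2 v p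
  end.

Fixpoint jeval (e : pexpr) a b : nat -> R -> R :=
  match e with
  | PVal => a | PSlope => b | PCst c => jcst (fun=> c)
  | PAdd e1 e2 => jadd (jeval e1 a b) (jeval e2 a b)
  | PMul e1 e2 => jmul (jeval e1 a b) (jeval e2 a b)
  end.

Lemma jeval_ext e a b a' b' x : (forall k, a k x = a' k x) -> (forall k, b k x = b' k x) ->
  forall k, jeval e a b k x = jeval e a' b' k x.
Proof.
move=> ha hb; elim: e => [||c|e1 IH1 e2 IH2|e1 IH1 e2 IH2] k //=.
  by rewrite /jadd IH1 IH2.
by rewrite /jmul /cauchy; apply: eq_bigr => i _; rewrite IH1 IH2.
Qed.

Lemma jeval_cont e a b : jcont a -> jcont b -> jcont (jeval e a b).
Proof.
move=> ha hb; elim: e => [||c|e1 IH1 e2 IH2|e1 IH1 e2 IH2] //=.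
- by apply: jcont_cst => x; exact: cvg_cst.
- exact: jcont_add.
- exact: jcont_mul.
Qed.

Lemma jeval0 e a b x : jeval e a b 0%N x = peval e (a 0%N x) (b 0%N x).
Proof.
elim: e => [||c|e1 IH1 e2 IH2|e1 IH1 e2 IH2] //=.
  by rewrite /jadd IH1 IH2.
by rewrite /jmul /cauchy big_ord_recr big_ord0 /= add0r IH1 IH2.
Qed.

Lemma jeval_cst e w p k x : jeval e (jcst w) (jcst p) k x = jcst (fun x => peval e (w x) (p x)) k x.
Proof.
elim: e k => [||c|e1 IH1 e2 IH2|e1 IH1 e2 IH2] k //=.
  by rewrite /jadd IH1 IH2 /jcst mulrnDl.
rewrite /jmul /cauchy; under eq_bigr do rewrite IH1 IH2.
rewrite big_ord_recl /= subn0 big1 ?addr0.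
  by rewrite /jcst eqxx mulr1n mulrnAr.
by move=> i _; rewrite {1}/jcst /= mulr0n mul0r.
Qed.

(** The order of quantifiers matters: [L] must not depend on [mu], because [mu] is later chosen from
    [L]. *)
Lemma jeval_lip e B : 0 <= B -> exists C, exists2 L, 0 <= C /\ 0 <= L &
  forall th mu a b a' b', 0 <= th ->
    jbnd th 0 B a -> jbnd th 0 B b -> jbnd th 0 B a' -> jbnd th 0 B b' ->
    jbnd th 0 C (jeval e a b) /\
    forall N, 0 <= N -> jbnd th mu N (jsub a a') -> jbnd th mu N (jsub b b') ->
      jbnd th mu (L * N) (jsub (jeval e a b) (jeval e a' b')).
Proof.
move=> B0; elim: e => [||c|e1 [C1 [L1 [C10 L10] IH1]] e2 [C2 [L2 [C20 L20] IH2]]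
   |e1 [C1 [L1 [C10 L10] IH1]] e2 [C2 [L2 [C20 L20] IH2]]] /=.
- exists B, 1; first by split=> //; exact: ler01.
  by move=> th mu a b a' b' th0 ha hb ha' hb'; split=> // N N0 h1 h2; rewrite mul1r.
- exists B, 1; first by split=> //; exact: ler01.
  by move=> th mu a b a' b' th0 ha hb ha' hb'; split=> // N N0 h1 h2; rewrite mul1r.
- exists `|c|, 0; first by [].
  move=> th mu a b a' b' th0 ha hb ha' hb'; split; first exact: jbnd_cst.
  move=> N N0 _ _ k x hx; rewrite /jsub subrr normr0 mul0r !mul0r //.
- exists (C1 + C2), (L1 + L2); first by rewrite !addr_ge0.
  move=> th mu a b a' b' th0 ha hb ha' hb'.
  have [h1 h1'] := IH1 th mu a b a' b' th0 ha hb ha' hb'.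
  have [h2 h2'] := IH2 th mu a b a' b' th0 ha hb ha' hb'.
  split; first exact: jbnd_add.
  move=> N N0 da db; rewrite mulrDl.
  apply: jbnd_ext (jbnd_add (h1' N N0 da db) (h2' N N0 da db)) => k x _.
  by rewrite /jadd /jsub; ring.
exists (3 * C1 * C2), (3 * C2 * L1 + 3 * C1 * L2); first by rewrite addr_ge0 !mulr_ge0.
move=> th mu a b a' b' th0 ha hb ha' hb'.
have [h1 h1'] := IH1 th mu a b a' b' th0 ha hb ha' hb'.
have [h2 h2'] := IH2 th mu a b a' b' th0 ha hb ha' hb'.
(* The difference of two products is split as in [cauchyDB], where the second term keeps the primed
   first factor; its bound is the induction hypothesis with the two pairs exchanged. *)
have [h3 _] := IH1 th mu a' b' a b th0 ha' hb' ha hb.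
split; first exact: jbnd_mul.
move=> N N0 da db; rewrite mulrDl -!mulrA ![C1 * (_ * _)]mulrA ![C2 * (_ * _)]mulrA !mulrA.
have k1 := jbnd_mul th0 C20 (mulr_ge0 L10 N0) h2 (h1' N N0 da db).
have k2 := jbnd_mul th0 C10 (mulr_ge0 L20 N0) h3 (h2' N N0 da db).
rewrite -![_ * _ * L1 * N]mulrA -![_ * _ * L2 * N]mulrA.
apply: jbnd_ext (jbnd_add k1 k2) => k x _.
rewrite /jadd jmulC /jsub /jmul.
by rewrite (cauchyDB (jeval e1 a b ^~ x) (jeval e2 a b ^~ x)).
Qed.

(* A time-dependent jet is consistent when it consists of actual Taylor
   coefficients. *)
Definition jder (q : R -> nat -> R -> R) := forall k (t x : R), 0 <= x <= 1 ->
  der (fun s => q s k x) t (k.+1%:R * q t k.+1 x).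

Lemma jder_add (q r : R -> nat -> R -> R) : jder q -> jder r -> jder (fun t => jadd (q t) (r t)).
Proof. by move=> hq hr k t x hx; rewrite /jadd mulrDr; apply: derD; [exact: hq|exact: hr]. Qed.

Lemma jder_sub (q r : R -> nat -> R -> R) : jder q -> jder r -> jder (fun t => jsub (q t) (r t)).
Proof. by move=> hq hr k t x hx; rewrite /jsub mulrBr; apply: derB; [exact: hq|exact: hr]. Qed.

Lemma jder_cst w : jder (fun=> jcst w).
Proof. by move=> k t x _; rewrite /jcst /= mulr0n mulr0; exact: derC. Qed.

Lemma jder_mul (q r : R -> nat -> R -> R) : jder q -> jder r -> jder (fun t => jmul (q t) (r t)).
Proof.
move=> hq hr k t x hx; rewrite /jmul.
exact: (@cauchy_der R (fun i t => q t i x) (fun i t => r t i x) t k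
  (fun i => hq i t x hx) (fun i => hr i t x hx)).
Qed.

Lemma jder_shift (q : R -> nat -> R -> R) : jder q -> jder (fun t => jshift (q t)).
Proof.
move=> hq k t x hx; rewrite /jshift; apply: der_eq (derZ _ (hq k.+1 t x hx)) _; ring.
Qed.

Lemma jder_eval e (q r : R -> nat -> R -> R) : jder q -> jder r -> jder (fun t => jeval e (q t) (r t)).
Proof.
move=> hq hr; elim: e => [||c|e1 IH1 e2 IH2|e1 IH1 e2 IH2] //=.
- exact: jder_cst.
- exact: jder_add.
- exact: jder_mul.
Qed.

(** A majorant of the weight of [jbnd] that is independent of [x]. It loses the gain of the
    primitives, so it only serves limits and time derivatives, where constants may depend on [k]. *)
Definition wgt th mu k : R := expR (`|mu|) * ((th * expR 1) ^+ k * k`!%:R).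

Lemma wgt_ge0 th mu k : 0 <= th -> 0 <= wgt th mu k.
Proof.
by move=> th0; rewrite /wgt !mulr_ge0 ?expR_ge0 // exprn_ge0 // mulr_ge0 ?expR_ge0.
Qed.

Lemma jbnd_wgt th mu M q k x : 0 <= th -> 0 <= M -> jbnd th mu M q -> 0 <= x <= 1 ->
  `|q k x| <= M * wgt th mu k.
Proof.
move=> th0 M0 h hx; apply: le_trans (h k x hx) _; rewrite /wgt -mulrA ler_wpM2l //.
have /andP[x0 x1] := hx.
apply: ler_pM; rewrite ?expR_ge0 ?mulr_ge0 ?exprn_ge0 ?mulr_ge0 ?expR_ge0 //.
  rewrite ler_expR; apply: le_trans (ler_norm _) _.
  by rewrite normrM ler_piMr // ger0_norm.
rewrite ler_wpM2r // lerXn2r ?nnegrE ?mulr_ge0 ?expR_ge0 // ler_wpM2l //.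
by rewrite ler_expR.
Qed.

Lemma jtaylor th mu M (q : R -> nat -> R -> R) k (s t x : R) : 0 <= th -> 0 <= M ->
  jder q -> (forall t, jbnd th mu M (q t)) -> 0 <= x <= 1 ->
  `|q t k x - q s k x - (t - s) * (k.+1%:R * q s k.+1 x)| <=
    (k.+1 * k.+2)%:R * (M * wgt th mu k.+2) * (t - s) ^+ 2.
Proof.
move=> th0 M0 hq hb hx.
apply: (@taylor2 R (fun t => q t k x) (fun t => k.+1%:R * q t k.+1 x)
  (fun t => k.+1%:R * (k.+2%:R * q t k.+2 x))).
- by move=> y; exact: hq.
- by move=> y; apply: derZ; exact: hq.
- move=> y; rewrite natrM mulrA normrM normrM !normr_nat ler_wpM2l ?mulr_ge0 //.
  exact: jbnd_wgt.
Qed.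

(** Differentiation under the integral sign: the quadratic Taylor remainder is bounded uniformly in
    space, so it can be integrated. *)
Lemma jder_prim th mu M (q : R -> nat -> R -> R) : 0 <= th -> 0 <= M ->
  jder q -> (forall t, jbnd th mu M (q t)) -> (forall t, jcont (q t)) ->
  jder (fun t => jprim (q t)).
Proof.
move=> th0 M0 hq hb hc k t x hx.
apply: (@der_of_taylor _ _ _ ((k.+1 * k.+2)%:R * (M * wgt th mu k.+2))) => s.
have cS : continuous (fun z => (s - t) * (k.+1%:R * q t k.+1 (clamp z))).
  by move=> z; apply: cvgM; [exact: cvg_cst|apply: cvgM; [exact: cvg_cst|exact: hc]].
have cD : continuous (fun z => q s k (clamp z) - q t k (clamp z)).
  by move=> z; apply: cvgB; exact: hc.
rewrite /jprim -(primZ _ _ (hc t k.+1)) -primZ -?primB //; last first.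
- by move=> z; apply: cvgM; [exact: cvg_cst|exact: hc].
- exact: hc.
- exact: hc.
have /andP[x0 x1] := hx.
apply: le_trans (@prim_bound R _ ((k.+1 * k.+2)%:R * (M * wgt th mu k.+2) * (s - t) ^+ 2) x _ x0 _) _.
- by move=> z; apply: cvgB; [exact: cD|exact: cS].
- by move=> y _; apply: jtaylor => //; exact: clamp_itv.
rewrite ler_piMr //; apply: mulr_ge0; last exact: sqr_ge0.
by rewrite mulr_ge0 // mulr_ge0 // wgt_ge0.
Qed.

End Jets.

(** * Picard iteration in the space variable *)

Section Picard.
Context {R : realType}.
Variables (e : @pexpr R) (W P H : R -> R) (D L A h th mu : R).
Hypothesis cW : continuous (fun x => W (clamp x)).
Hypothesis cP : continuous (fun x => P (clamp x)).
Hypothesis cH : continuous (fun x => H (clamp x)).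
Hypothesis WD : forall x : R, 0 <= x <= 1 -> `|W x| <= D.
Hypothesis PD : forall x : R, 0 <= x <= 1 -> `|P x| <= D.
Hypothesis L0 : 0 <= L.
Hypothesis lip : forall a b a' b',
    jbnd th 0 (D + 1) a -> jbnd th 0 (D + 1) b ->
    jbnd th 0 (D + 1) a' -> jbnd th 0 (D + 1) b' ->
    forall N, 0 <= N -> jbnd th mu N (jsub a a') -> jbnd th mu N (jsub b b') ->
      jbnd th mu (L * N) (jsub (jeval e a b) (jeval e a' b')).
Hypothesis th0 : 0 <= th.
Hypothesis th1 : th * expR 1 <= 1 / 4.
Hypothesis mu1 : 1 <= mu.
Hypothesis muL : 4 * L <= mu.
Hypothesis Hh : forall x : R, 0 <= x <= 1 -> `|H x| <= h.
Hypothesis Ah : A * h <= expR (- mu) / 2.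

(** The radius of the ball for the iteration. Since [r * expR mu] is 1, jets of the ball are bounded
    by 1 in the sense of [jbnd th 0], and adding them to data bounded by [D] stays where the
    Lipschitz constant for [D + 1] is valid. *)
Let r := expR (- mu).

(** The unknown [q] is the jet of [v_x - P], so that [v] is [W + jprim q]; the nonlinearity is
    counted from its value at [(W, P)]. *)
Definition nonlin (q : nat -> R -> R) :=
  jsub (jeval e (jadd (jcst W) (jprim q)) (jadd (jcst P) q)) (jeval e (jcst W) (jcst P)).

(** The equation [v_xx = v_t + F(v, v_x)] with its source, integrated once in space. The shifted
    double primitive is the integral of [v_t]; [phi * H] carries both the change of slope at [x = 0]
    and the change of source. *)
Definition picard_op (phi : nat -> R) (q : nat -> R -> R) : nat -> R -> R :=
  jadd (fun k x => phi k * H x) (jadd (jshift (jprim (jprim q))) (jprim (nonlin q))).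

Let mu0 : 0 < mu. Proof. exact: lt_le_trans mu1. Qed.
Let D0 : 0 <= D.
Proof. by have := @WD 0; rewrite lexx ler01 => /(_ isT); exact: le_trans. Qed.
Let h0 : 0 <= h.
Proof. by have := @Hh 0; rewrite lexx ler01 => /(_ isT); exact: le_trans. Qed.
Let r0 : 0 < r. Proof. exact: expR_gt0. Qed.

Lemma jcont_nonlin q : jcont q -> jcont (nonlin q).
Proof.
move=> cq; apply: jcont_sub; apply: jeval_cont; try exact: jcont_cst.
  by apply: jcont_add; [exact: jcont_cst|exact: jcont_prim].
by apply: jcont_add => //; exact: jcont_cst.
Qed.

Lemma jcont_picard phi q : jcont q -> jcont (picard_op phi q).
Proof.
move=> cq; apply: jcont_add.
  by move=> k x; apply: cvgM; [exact: cvg_cst|exact: cH].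
apply: jcont_add; first by apply/jcont_shift/jcont_prim/jcont_prim.
by apply/jcont_prim/jcont_nonlin.
Qed.

Let ball_small q : jbnd th mu r q -> jbnd th 0 1 q.
Proof.
move=> hq; have := jbnd_mu0 th0 (ltW r0) (ltW mu0) hq.
by rewrite /r -expRD addNr expR0.
Qed.

Let prim_ball q : jcont q -> jbnd th mu r q -> jbnd th mu r (jprim q).
Proof.
move=> cq hq; apply: jbnd_le (jbnd_prim th0 mu0 (ltW r0) cq hq) => //.
by rewrite ler_pdivrMr // ler_peMr // ltW.
Qed.

Let shifted w q : (forall x, 0 <= x <= 1 -> `|w x| <= D) -> jbnd th mu r q ->
  jbnd th 0 (D + 1) (jadd (jcst w) q).
Proof. by move=> hw hq; apply: jbnd_add; [exact: jbnd_cst|exact: ball_small]. Qed.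

(** One quarter comes from the time derivative, by the smallness of [th], and one quarter from the
    nonlinearity, by the size of [mu]. *)
Lemma picard_contract phi q q' N : 0 <= N -> jcont q -> jcont q' ->
  jbnd th mu r q -> jbnd th mu r q' -> jbnd th mu N (jsub q q') ->
  jbnd th mu (N / 2) (jsub (picard_op phi q) (picard_op phi q')).
Proof.
move=> N0 cq cq' hq hq' hN.
have hJ : jbnd th mu N (jsub (jprim q) (jprim q')).
  apply: (@jbnd_le _ _ _ (N / mu)) => //.
    by rewrite ler_pdivrMr // ler_peMr.
  apply: jbnd_ext (jbnd_prim th0 mu0 N0 (jcont_sub cq cq') hN) => k x _.
  by rewrite jprim_sub.
have hK : jbnd th mu (N / 4) (jshift (jprim (jprim (jsub q q')))).
  apply: jbnd_le (jbnd_shift_prim2 th0 mu0 N0 (jcont_sub cq cq') hN) => //.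
  by rewrite ler_wpM2l // ; move: th1; rewrite mul1r.
have hL : jbnd th mu (L * N) (jsub (nonlin q) (nonlin q')).
  apply: (@jbnd_ext R _ _ _ (jsub (jeval e (jadd (jcst W) (jprim q)) (jadd (jcst P) q))
     (jeval e (jadd (jcst W) (jprim q')) (jadd (jcst P) q')))).
    by move=> k x _; rewrite /nonlin /jsub; ring.
  apply: lip => //; try (apply: shifted => //; exact: prim_ball).
    by apply: jbnd_ext hJ => k x _; rewrite /jsub /jadd; ring.
  by apply: jbnd_ext hN => k x _; rewrite /jsub /jadd; ring.
have hM : jbnd th mu (N / 4) (jprim (jsub (nonlin q) (nonlin q'))).
  have cn := jcont_sub (jcont_nonlin cq) (jcont_nonlin cq').
  apply: jbnd_le (jbnd_prim th0 mu0 (mulr_ge0 L0 N0) cn hL) => //.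
  rewrite ler_pdivrMr //; move: muL N0; nra.
rewrite (_ : N / 2 = N / 4 + N / 4); last by lra.
apply: jbnd_ext (jbnd_add hK hM) => k x _.
rewrite /picard_op /jadd jprim_sub; [|exact: jcont_nonlin|exact: jcont_nonlin].
have E k' x' : jprim (jsub q q') k' x' = jsub (jprim q) (jprim q') k' x'.
  by rewrite jprim_sub.
rewrite /jshift; have -> : jprim (jprim (jsub q q')) k.+1 x = jprim (jsub (jprim q) (jprim q')) k.+1 x.
  by rewrite {1 3}/jprim; congr (prim _ x); apply/funext => z; rewrite E.
by rewrite jprim_sub ?/jsub; [ring|exact: jcont_prim|exact: jcont_prim].
Qed.

Definition gevrey_seq (phi : nat -> R) := forall k, `|phi k| <= A * (th ^+ k * k`!%:R).

Let zero_jet : nat -> R -> R := fun _ _ => 0.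

Let zero_cont : jcont zero_jet.
Proof. by move=> k x; exact: cvg_cst. Qed.

Let zero_ball N : 0 <= N -> jbnd th mu N zero_jet.
Proof.
move=> N0 k x hx; rewrite normr0 !mulr_ge0 ?expR_ge0 // exprn_ge0 // mulr_ge0 ?expR_ge0 //.
Qed.

Let prim_zero k x : jprim zero_jet k x = 0.
Proof. by rewrite /jprim (prim_const 0) mul0r. Qed.

Let picard_zero phi k x : picard_op phi zero_jet k x = phi k * H x.
Proof.
rewrite /picard_op /jadd /jshift.
have J2 j y : jprim (jprim zero_jet) j y = 0.
  rewrite -(prim_zero j y) {1 3}/jprim; congr (prim _ _); apply/funext => z.
  exact: prim_zero.
have N0 j y : nonlin zero_jet j y = 0.
  rewrite /nonlin /jsub (@jeval_ext R e _ _ (jcst W) (jcst P) y) ?subrr // => i.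
    by rewrite /jadd prim_zero addr0.
  by rewrite /jadd addr0.
rewrite J2 mulr0 add0r.
have -> : jprim (nonlin zero_jet) k x = 0.
  by rewrite -(prim_zero k x) /jprim; congr (prim _ _); apply/funext => z; rewrite N0.
by rewrite addr0.
Qed.

Lemma source_bound phi : gevrey_seq phi -> jbnd th mu (r / 2) (fun k x => phi k * H x).
Proof.
move=> hphi k x hx; have /andP[x0 x1] := hx.
rewrite normrM.
apply: (@le_trans _ _ (A * (th ^+ k * k`!%:R) * h)).
  by apply: ler_pM => //; (exact: hphi || exact: Hh).
rewrite exprMn -expRM_natl.
have w0 : 0 <= th ^+ k * k`!%:R by rewrite mulr_ge0 // exprn_ge0.
rewrite (_ : A * _ * h = A * h * (th ^+ k * k`!%:R)); last by ring.
rewrite (_ : _ / 2 * _ * _ = r / 2 * (th ^+ k * k`!%:R) * (expR (mu * x) * expR (k%:R * x))); last by ring.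
have e1 : 1 <= expR (mu * x) * expR (k%:R * x).
  rewrite -expRD -expR0 ler_expR addr_ge0 // mulr_ge0 //; exact: ltW.
apply: (@le_trans _ _ (r / 2 * (th ^+ k * k`!%:R))); first by rewrite ler_wpM2r.
by rewrite ler_peMr // mulr_ge0 // divr_ge0 // ltW.
Qed.

(** Half of the radius pays for the distance to the image of the zero jet, by contraction, and half
    for that image, which is the source itself. *)
Lemma picard_ball phi q : gevrey_seq phi -> jcont q -> jbnd th mu r q ->
  jbnd th mu r (picard_op phi q).
Proof.
move=> hphi cq hq.
have h1 : jbnd th mu (r / 2) (jsub (picard_op phi q) (picard_op phi zero_jet)).
  apply: picard_contract => //; [exact: ltW|exact/zero_ball/ltW|].
  by apply: jbnd_ext hq => k x _; rewrite /jsub subr0.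
rewrite (_ : r = r / 2 + r / 2); last by lra.
apply: jbnd_ext (jbnd_add h1 (source_bound hphi)) => k x _.
by rewrite /jadd /jsub picard_zero subrK.
Qed.

Definition is_fixed phi (q : nat -> R -> R) := forall k x, 0 <= x <= 1 -> q k x = picard_op phi q k x.

(** Applied at a single time, this identifies the solution before and after the step, where an
    explicit jet is also a fixed point. *)
Lemma picard_unique phi q q' : jcont q -> jcont q' -> jbnd th mu r q -> jbnd th mu r q' ->
  is_fixed phi q -> is_fixed phi q' -> forall k x, 0 <= x <= 1 -> q k x = q' k x.
Proof.
move=> cq cq' hq hq' fq fq' k x hx.
have H1 n : jbnd th mu (2 * r / 2 ^+ n) (jsub q q').
  elim: n => [|n IH].
    by rewrite expr0 divr1 mulr_natl mulr2n; exact: jbnd_sub.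
  rewrite exprS invfM mulrA [_ / 2 * _]mulrAC.
  have N0 : 0 <= 2 * r / 2 ^+ n by rewrite divr_ge0 ?exprn_ge0 // mulr_ge0 // ltW.
  apply: jbnd_ext (picard_contract phi N0 cq cq' hq hq' IH) => j y hy.
  by rewrite /jsub -fq // -fq'.
apply/eqP; rewrite -subr_eq0 -normr_le0.
apply: (@geometric_le0 R _ (2 * r * wgt th mu k)) => n.
rewrite mulrAC; apply: (@jbnd_wgt _ _ _ _ (jsub q q')) => //.
by rewrite divr_ge0 ?exprn_ge0 // mulr_ge0 // ltW.
Qed.

Variable phi : R -> nat -> R.
Hypothesis phi_bound : forall t, gevrey_seq (phi t).
Hypothesis phi_der : forall k (t : R), der (fun t => phi t k) t (k.+1%:R * phi t k.+1).

Fixpoint picard n t : nat -> R -> R :=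
  if n is m.+1 then picard_op (phi t) (picard m t) else zero_jet.

Let picard_cont n t : jcont (picard n t).
Proof. by elim: n => [|n IH] //=; exact: jcont_picard. Qed.

Let picard_in n t : jbnd th mu r (picard n t).
Proof.
by elim: n => [|n IH] /=; [exact/zero_ball/ltW|exact: picard_ball].
Qed.

Let picard_jder n : jder (picard n).
Proof.
elim: n => [|n IH].
  by move=> k t x _; rewrite /= /zero_jet mulr0; exact: derC.
have dJ : jder (fun t => jprim (picard n t)).
  exact: (@jder_prim R th mu r (picard n) th0 (ltW r0) IH (picard_in n) (@picard_cont n)).
have cJ t : jcont (jprim (picard n t)) by exact: jcont_prim.
apply: jder_add.
  move=> k t x hx; rewrite mulrA.
  apply: der_eq (der_ext _ (derZ (H x) (phi_der k t))) _ => [y|]; [exact: mulrC|ring].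
apply: jder_add; first apply: jder_shift.
  by apply: (@jder_prim R th mu r _ th0 (ltW r0) dJ _ cJ) => t; exact: prim_ball.
have hN t : jbnd th mu (L * r) (nonlin (picard n t)).
  apply: lip; [| | | |exact: ltW| | ].
  - by apply: shifted => //; exact: prim_ball.
  - exact: shifted.
  - by apply: (@jbnd_le _ _ _ D) => //; [rewrite lerDl|exact: jbnd_cst].
  - by apply: (@jbnd_le _ _ _ D) => //; [rewrite lerDl|exact: jbnd_cst].
  - apply: jbnd_ext (prim_ball (@picard_cont n t) (picard_in n t)) => k x _.
    by rewrite /jsub /jadd; ring.
  - by apply: jbnd_ext (picard_in n t) => k x _; rewrite /jsub /jadd; ring.
apply: (@jder_prim R th mu (L * r) _ th0 (mulr_ge0 L0 (ltW r0)) _ hN) => [|t]; last exact: jcont_nonlin.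
apply: jder_sub; apply: jder_eval; do ?exact: jder_cst.
  by apply: jder_add => //; exact: jder_cst.
by apply: jder_add => //; exact: jder_cst.
Qed.

Let picard_step n t : jbnd th mu (2 * r / 2 ^+ n) (jsub (picard n.+1 t) (picard n t)).
Proof.
elim: n => [|n IH].
  by rewrite expr0 divr1 mulr_natl mulr2n; apply: jbnd_sub; exact: picard_in.
rewrite exprS invfM mulrA [_ / 2 * _]mulrAC.
apply: (@picard_contract (phi t) (picard n.+1 t) (picard n t)) => //; try exact: picard_in; try exact: picard_cont.
by rewrite divr_ge0 ?exprn_ge0 // mulr_ge0 // ltW.
Qed.

(** The fixed-point equation at time [t] involves only the sequence [phi t], so all times are solved
    independently. That the solutions are the Taylor coefficients of one function of time is proved
    for every iterate and passes to the limit through the quadratic remainder of [jtaylor]. *)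
Lemma picard_solution : exists Q : R -> nat -> R -> R,
  [/\ forall t, jbnd th mu r (Q t), forall t, jcont (Q t), jder Q
    & forall t, is_fixed (phi t) (Q t)].
Proof.
have cn n : 0 <= 2 * r / 2 ^+ n by rewrite divr_ge0 ?exprn_ge0 // mulr_ge0 // ltW.
have [Q hQ] : exists Q : R -> nat -> R -> R, forall t k x, 0 <= x <= 1 -> forall n,
    `|Q t k x - picard n t k x| <= 2 * (2 * r * expR (mu * x) * ((th * expR x) ^+ k * k`!%:R)) / 2 ^+ n.
  have H1 (p : R * nat * R) : exists l, 0 <= p.2 <= 1 -> forall n,
     `|l - picard n p.1.1 p.1.2 p.2| <= 2 * (2 * r * expR (mu * p.2) * ((th * expR p.2) ^+ p.1.2 * p.1.2`!%:R)) / 2 ^+ n.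
    have [hx|] := boolP (0 <= p.2 <= 1); last by move=> _; exists 0.
    have [n|l hl] := @geometric_limit R (fun n => picard n p.1.1 p.1.2 p.2)
      (2 * r * expR (mu * p.2) * ((th * expR p.2) ^+ p.1.2 * p.1.2`!%:R)); last by exists l.
    have := picard_step n p.1.1 p.1.2 hx; rewrite /jsub.
    by rewrite (_ : 2 * r / 2 ^+ n * _ * _ = 2 * r * expR (mu * p.2) * ((th * expR p.2) ^+ p.1.2 * p.1.2`!%:R) / 2 ^+ n) //; ring.
  have [f hf] := choice H1.
  by exists (fun t k x => f (t, k, x)) => t k x hx n; have := hf (t, k, x) hx n.
have hQj n t : jbnd th mu (2 * (2 * r / 2 ^+ n)) (jsub (Q t) (picard n t)).
  move=> k x hx; apply: le_trans (hQ t k x hx n) _.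
  by rewrite le_eqVlt; apply/orP; left; apply/eqP; ring.
have hQw n t k x : 0 <= x <= 1 -> `|Q t k x - picard n t k x| <= (4 * r * wgt th mu k) / 2 ^+ n.
  move=> hx; have := @jbnd_wgt _ _ _ _ _ k x th0 (mulr_ge0 (ler0n R 2) (cn n)) (hQj n t) hx.
  by rewrite (_ : 2 * (2 * r / 2 ^+ n) * _ = 4 * r * wgt th mu k / 2 ^+ n) //; ring.
have Qb t : jbnd th mu r (Q t).
  move=> k x hx; rewrite -subr_le0.
  apply: (@geometric_le0 R _ (4 * r * wgt th mu k)) => n.
  have := hQw n t k x hx; have := picard_in n t k hx.
  have := ler_normD (Q t k x - picard n t k x) (picard n t k x); rewrite subrK.
  lra.
have Qc t : jcont (Q t).
  move=> k x; apply/cvgrPdist_le => /= eps eps0.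
  have [n hn] : exists n, 4 * r * wgt th mu k / 2 ^+ n <= eps / 4.
    apply: contrapT => hno.
    have := @geometric_le0 R (eps / 4) (4 * r * wgt th mu k).
    have hh n : eps / 4 <= 4 * r * wgt th mu k / 2 ^+ n.
      by rewrite leNgt; apply/negP => /ltW hlt; apply: hno; exists n.
    by move=> /(_ hh); lra.
  have /cvgrPdist_le /(_ (eps / 2)) := @picard_cont n t k x.
  rewrite /= divr_gt0 // => /(_ isT); apply: filterS => y hy.
  have h1 := hQw n t k _ (clamp_itv x); have h2 := hQw n t k _ (clamp_itv y).
  rewrite (_ : Q t k (clamp x) - Q t k (clamp y) = (Q t k (clamp x) - picard n t k (clamp x)) +
    ((picard n t k (clamp x) - picard n t k (clamp y)) - (Q t k (clamp y) - picard n t k (clamp y)))); last by ring.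
  apply: le_trans (ler_normD _ _) _; have := ler_normB (picard n t k (clamp x) - picard n t k (clamp y)) (Q t k (clamp y) - picard n t k (clamp y)).
  lra.
exists Q; split => //.
- move=> k t x hx.
  apply: (@der_of_taylor R _ _ ((k.+1 * k.+2)%:R * (r * wgt th mu k.+2))) => s.
  rewrite -subr_le0.
  apply: (@geometric_le0 R _ (4 * r * wgt th mu k + 4 * r * wgt th mu k +
     `|s - t| * (k.+1%:R * (4 * r * wgt th mu k.+1)))) => n.
  have T := @jtaylor R th mu r _ k t s x th0 (ltW r0) (picard_jder n) (picard_in n) hx.
  have h1 := hQw n s k x hx; have h2 := hQw n t k x hx; have h3 := hQw n t k.+1 x hx.
  have h4 := ler_wpM2l (mulr_ge0 (normr_ge0 (s - t)) (ler0n R k.+1)) h3.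
  rewrite lerBlDr.
  rewrite (_ : Q s k x - Q t k x - _ = (Q s k x - picard n s k x) - (Q t k x - picard n t k x)
    - ((s - t) * k.+1%:R * (Q t k.+1 x - picard n t k.+1 x)) +
    (picard n s k x - picard n t k x - (s - t) * (k.+1%:R * picard n t k.+1 x))); last by ring.
  apply: le_trans (ler_normD _ _) _; rewrite lerD //.
  apply: le_trans (ler_normB _ _) _; rewrite [leRHS]mulrDl; apply: lerD.
    by apply: le_trans (ler_normB _ _) _; rewrite mulrDl lerD.
  by rewrite 2!normrM normr_nat; move: h4; rewrite !mulrA.
- move=> t k x hx; apply/eqP; rewrite -subr_eq0 -normr_le0.
  apply: (@geometric_le0 R _ (4 * r * wgt th mu k + 4 * r * wgt th mu k)) => n.
  have h1 := hQw n.+1 t k x hx.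
  have h2 := picard_contract (phi t) (mulr_ge0 (ler0n R 2) (cn n)) (Qc t) (@picard_cont n t) (Qb t) (picard_in n t) (hQj n t).
  have h3 := @jbnd_wgt _ _ _ _ _ k x th0 _ h2 hx.
  have N0 : 0 <= 2 * (2 * r / 2 ^+ n) / 2 by rewrite divr_ge0 // mulr_ge0.
  move: (h3 N0); rewrite /jsub -/(picard n.+1 t) => h4.
  rewrite (_ : Q t k x - _ = (Q t k x - picard n.+1 t k x) - (picard_op (phi t) (Q t) k x - picard n.+1 t k x)); last by ring.
  apply: le_trans (ler_normB _ _) _; rewrite mulrDl lerD //.
    apply: le_trans h1 _; apply: ler_wpM2l.
      by rewrite mulr_ge0 ?wgt_ge0 // mulr_ge0 // ltW.
    by rewrite lef_pV2 ?posrE ?exprn_gt0 // exprS ler_peMl ?exprn_ge0 // ler1n.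
  apply: le_trans h4 _; rewrite (_ : _ / 2 * _ = (2 * r * wgt th mu k) / 2 ^+ n); last by field; rewrite expf_neq0.
  rewrite ler_wpM2r ?invr_ge0 ?exprn_ge0 // ler_wpM2r ?wgt_ge0 // ler_wpM2r ?ltW //.
  by rewrite ltr_nat.
Qed.

End Picard.

(** * Trajectories *)

Section JointContinuity.
Context {R : realType}.
Implicit Types (g h : R -> R -> R) (w : R -> R) (t s x : R).

Definition jc g := continuous (fun p : R * R => g p.1 (clamp p.2)).

Lemma jc_intro g (L : R) : (forall t, continuous (fun x => g t (clamp x))) ->
  (forall t s x, 0 <= x <= 1 -> `|g t x - g s x| <= L * `|t - s|) -> jc g.
Proof.
move=> cg hL [t0 x0]; apply/cvgrPdist_le => /= eps eps0.
have L1 : 0 < `|L| + 1 by rewrite ltr_wpDl.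
have c1 : p.1 @[p --> (t0, x0)] --> t0 by exact: cvg_fst.
have c2 : (g t0 (clamp p.2)) @[p --> (t0, x0)] --> g t0 (clamp x0).
  apply: (@cvg_comp _ _ _ snd (fun x => g t0 (clamp x)) _ (nbhs x0)); last exact: cg.
  exact: cvg_snd.
have e1 : 0 < eps / 2 / (`|L| + 1) by rewrite !divr_gt0.
have e2 : 0 < eps / 2 by rewrite divr_gt0.
move/cvgrPdist_le : c1 => /(_ _ e1) c1; move/cvgrPdist_le : c2 => /(_ _ e2) c2.
near=> p.
rewrite (_ : _ - _ = (g t0 (clamp x0) - g t0 (clamp p.2)) + (g t0 (clamp p.2) - g p.1 (clamp p.2))); last by ring.
apply: le_trans (ler_normD _ _) _; rewrite [leRHS]splitr lerD //; first by near: p.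
apply: le_trans (hL _ _ _ (clamp_itv _)) _.
have h1 : `|t0 - p.1| <= eps / 2 / (`|L| + 1) by near: p.
rewrite ler_pdivlMr // in h1; apply: le_trans h1; rewrite mulrC ler_wpM2l //.
by apply: le_trans (ler_norm _) _; rewrite lerDl.
Unshelve. all: by end_near.
Qed.

Lemma jcD g h : jc g -> jc h -> jc (fun t x => g t x + h t x).
Proof. by move=> hg hh p; apply: cvgD; [exact: hg|exact: hh]. Qed.

Lemma jcB g h : jc g -> jc h -> jc (fun t x => g t x - h t x).
Proof. by move=> hg hh p; apply: cvgB; [exact: hg|exact: hh]. Qed.

Lemma jcM g h : jc g -> jc h -> jc (fun t x => g t x * h t x).
Proof. by move=> hg hh p; apply: cvgM; [exact: hg|exact: hh]. Qed.

Lemma jcC (c : R) : jc (fun _ _ => c).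
Proof. by move=> p; exact: cvg_cst. Qed.

Lemma jc_ext g h : (forall t x, 0 <= x <= 1 -> g t x = h t x) -> jc g -> jc h.
Proof.
move=> e hg; rewrite /jc (_ : (fun p => _) = (fun p => g p.1 (clamp p.2))) //.
by apply/funext => p; rewrite e // clamp_itv.
Qed.

Lemma jc_time w : continuous w -> jc (fun t _ => w t).
Proof.
move=> hw [t x]; apply: (@cvg_comp _ _ _ fst w _ (nbhs t)); last exact: hw.
exact: cvg_fst.
Qed.

Lemma jc_space w : continuous (fun x => w (clamp x)) -> jc (fun _ x => w x).
Proof.
move=> hw [t x]; apply: (@cvg_comp _ _ _ snd (fun x => w (clamp x)) _ (nbhs x)); last exact: hw.
exact: cvg_snd.
Qed.

Lemma jc_peval e g h : jc g -> jc h -> jc (fun t x => peval e (g t x) (h t x)).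
Proof.
move=> hg hh; elim: e => [||c|e1 IH1 e2 IH2|e1 IH1 e2 IH2] //=.
- exact: jcC.
- exact: jcD.
- exact: jcM.
Qed.

Lemma jc_comp (T : topologicalType) (f1 f2 : T -> R) g (z : T) : jc g ->
  {for z, continuous f1} -> {for z, continuous f2} ->
  {for z, continuous (fun y => g (f1 y) (clamp (f2 y)))}.
Proof.
move=> hg c1 c2.
exact: (@cvg_comp2 _ _ _ _ (nbhs z) (nbhs (f1 z)) (nbhs (f2 z)) _ _ _ _ f1 f2
  (fun a b => g a (clamp b)) c1 c2 (hg (f1 z, f2 z))).
Qed.

Lemma jc_shift g (a : R) : jc g -> jc (fun t x => g (t - a) x).
Proof.
move=> hg p; apply: (jc_comp (f1 := fun p : R * R => p.1 - a) (f2 := snd) hg); last exact: cvg_snd.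
by apply: cvgB; [exact: cvg_fst|exact: cvg_cst].
Qed.

Lemma clamp_rev x : clamp (1 - x) = 1 - clamp x.
Proof.
have [x0|x0] := leP 0 x; last first.
  rewrite {2}/clamp (min_l (_ : x <= 1)) ?(max_l (ltW x0)); last by lra.
  by rewrite /clamp (min_r (_ : 1 <= 1 - x)) ?max_r; lra.
have [x1|x1] := leP x 1; first by rewrite !clamp_id; lra.
rewrite {2}/clamp (min_r (ltW x1)) max_r // subrr.
by rewrite /clamp (min_l (_ : 1 - x <= 1)) ?max_l; lra.
Qed.

Lemma jc_rev g : jc g -> jc (fun t x => g t (1 - x)).
Proof.
move=> hg p; rewrite /continuous_at /=.
under eq_fun do rewrite -clamp_rev.
rewrite -clamp_rev.
apply: (jc_comp (f1 := fst) (f2 := fun p : R * R => 1 - p.2) hg); first exact: cvg_fst.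
by apply: cvgB; [exact: cvg_cst|exact: cvg_snd].
Qed.

Lemma jc_slice g t : jc g -> continuous (fun x => g t (clamp x)).
Proof.
by move=> hg x; apply: (jc_comp (f1 := fun=> t) (f2 := id) hg); [exact: cvg_cst|exact: cvg_id].
Qed.

Lemma jc_slice_time g x : jc g -> continuous (fun t => g t (clamp x)).
Proof.
by move=> hg t; apply: (jc_comp (f1 := id) (f2 := fun=> x) hg); [exact: cvg_id|exact: cvg_cst].
Qed.

(** Compactness of [[0, 1]] makes joint continuity uniform in [x]; this yields continuity in time
    with values in [H^1]. *)
Lemma jc_uniform g t0 (eps : R) : jc g -> 0 < eps ->
  \forall t \near t0, forall x, 0 <= x <= 1 -> `|g t x - g t0 x| <= eps.
Proof.
move=> hg eps0.
have /compact_near_coveringP K := @segment_compact R 0 1.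
suff : \forall t \near t0, `[(0 : R), 1] `<=` (fun x => `|g t (clamp x) - g t0 (clamp x)| <= eps).
  apply: filterS => t H x hx; rewrite -(clamp_id hx).
  by apply: H; rewrite /= in_itv.
apply: (K R (nbhs t0) (fun t x => `|g t (clamp x) - g t0 (clamp x)| <= eps)) => x _.
have e2 : 0 < eps / 2 by rewrite divr_gt0.
have /cvgrPdist_le /(_ _ e2) [[A B] /= [hA hB] h1] := hg (t0, x).
exists (B, A) => //= -[y t] /= [By At].
have ht0 := nbhs_singleton hA.
rewrite (_ : _ - _ = (g t0 (clamp x) - g t0 (clamp y)) - (g t0 (clamp x) - g t (clamp y))); last by ring.
apply: le_trans (ler_normB _ _) _; rewrite [leRHS]splitr lerD //.
  by have := h1 (t0, y) (conj ht0 By).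
by have := h1 (t, y) (conj At By).
Qed.

Lemma jc_bounded g (a b : R) : jc g -> exists M : R, forall t x, a <= t <= b -> 0 <= x <= 1 -> `|g t x| <= M.
Proof.
move=> hg.
have cK : compact (`[a, b] `*` `[(0:R), 1]).
  by apply: compact_setX; exact: segment_compact.
have cI : compact ((fun p : R * R => g p.1 (clamp p.2)) @` (`[a, b] `*` `[(0:R), 1])).
  by apply: continuous_compact cK; apply: continuous_subspaceT.
have [M [Mr hM]] := compact_bounded cI.
exists (M + 1) => t x ht hx.
apply: (hM (M + 1)); first by rewrite ltrDl.
exists (t, x); first by split; rewrite /= in_itv.
by rewrite /= clamp_id.
Qed.

End JointContinuity.

(** * The Cauchy problem in space between two nearby profiles *)

Section Trajectories.
Context {R : realType}.
Implicit Types (v vx vxx vt : R -> R -> R) (W P S : R -> R) (t s x : R).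

(** Values at positions outside [[0, 1]] enter only through the two-sided space derivatives at the
    endpoints. *)
Record traj v vx vxx vt : Prop := {
  traj_x : forall t x, 0 <= x <= 1 -> der (v t) x (vx t x) ;
  traj_xx : forall t x, 0 <= x <= 1 -> der (vx t) x (vxx t x) ;
  traj_t : forall t x, 0 <= x <= 1 -> der (fun s => v s x) t (vt t x) ;
  traj_cont : jc v ;
  traj_cont_x : jc vx ;
  traj_cont_xx : jc vxx ;
  traj_cont_t : jc vt }.

Definition C2_data W P S := [/\ forall x, der W x (P x), forall x, der P x (S x) & continuous S].

Lemma cont_clamp W : continuous W -> continuous (fun x => W (clamp x)).
Proof. by move=> cW x; apply: (@continuous_comp _ _ _ clamp W); [exact: clamp_cont|exact: cW]. Qed.

Lemma der_continuous W P : (forall x, der W x (P x)) -> continuous W.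
Proof. by move=> h x; exact: (der_cont (h x)). Qed.

Lemma cont_peval e W P : continuous W -> continuous P -> continuous (fun x : R => peval e (W x) (P x)).
Proof.
move=> hg hh; elim: e => [||c|e1 IH1 e2 IH2|e1 IH1 e2 IH2] //= x.
- exact: cvg_cst.
- by apply: cvgD; [exact: IH1|exact: IH2].
- by apply: cvgM; [exact: IH1|exact: IH2].
Qed.

Lemma jbnd_cst_mu (th mu M : R) (w : R -> R) : 0 <= th -> 0 <= mu -> (forall x : R, 0 <= x <= 1 -> `|w x| <= M) -> jbnd th mu M (jcst w).
Proof.
move=> th0 mu0 h k x hx; have := jbnd_cst th0 h k hx.
rewrite mul0r expR0 mulr1 => hb; apply: le_trans hb _.
have M0 : 0 <= M := le_trans (normr_ge0 _) (h x hx).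
have /andP[x0 _] := hx.
rewrite ler_wpM2r //; first by rewrite mulr_ge0 // exprn_ge0 // mulr_ge0 ?expR_ge0.
by rewrite ler_peMr // -expR0 ler_expR mulr_ge0.
Qed.

Lemma Q_lipschitz (th mu M : R) (Q : R -> nat -> R -> R) k t s x : 0 <= th -> 0 <= M -> jder Q ->
  (forall t, jbnd th mu M (Q t)) -> 0 <= x <= 1 ->
  `|Q t k x - Q s k x| <= k.+1%:R * (M * wgt th mu k.+1) * `|t - s|.
Proof.
move=> th0 M0 hQ hb hx.
apply: (@der_bound R (fun t => Q t k x) (fun t => k.+1%:R * Q t k.+1 x)).
  by move=> y _; exact: hQ.
by move=> y _; rewrite normrM normr_nat ler_wpM2l //; exact: (@jbnd_wgt R th mu M (Q y) k.+1 x th0 M0 (hb y) hx).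
Qed.

Lemma jc_jet (th mu M : R) (Q : R -> nat -> R -> R) k : 0 <= th -> 0 <= M -> jder Q ->
  (forall t, jbnd th mu M (Q t)) -> (forall t, jcont (Q t)) -> jc (fun t => Q t k).
Proof.
move=> th0 M0 hQ hb hc; apply: (@jc_intro R _ (k.+1%:R * (M * wgt th mu k.+1))).
  by move=> t; exact: hc.
by move=> t s x; exact: Q_lipschitz.
Qed.

(* [F W P] stands for [fun x => peval e (W x) (P x)]. The source [H] is chosen so
   that the constant jet [P1 - P0] is the solution when the step equals [1]. *)
Lemma transition (e : @pexpr R) (D : R) : exists eta, exists2 tau, 0 < eta /\ 0 < tau &
  forall W0 P0 S0 W1 P1 S1, C2_data W0 P0 S0 -> C2_data W1 P1 S1 -> W0 0 = 0 -> W1 0 = 0 ->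
  (forall x, 0 <= x <= 1 -> [/\ `|W0 x| <= D, `|P0 x| <= D, `|W1 x| <= D & `|P1 x| <= D]) ->
  (forall x, 0 <= x <= 1 -> `|W1 x - W0 x| <= eta /\ `|P1 x - P0 x| <= eta) ->
  exists v, exists vx, exists vxx, exists vt,
  [/\ traj v vx vxx vt, forall t, v t 0 = 0,
    forall t x, 0 <= x <= 1 -> vxx t x = vt t x + peval e (v t x) (vx t x)
      + (1 - gstep 0 (t / tau)) * (S0 x - peval e (W0 x) (P0 x))
      + gstep 0 (t / tau) * (S1 x - peval e (W1 x) (P1 x)),
    forall t x, t <= 0 -> 0 <= x <= 1 -> v t x = W0 x
  & forall t x, tau <= t -> 0 <= x <= 1 -> v t x = W1 x].
Proof.
(* A negative [D] contradicts the bounds at [x = 0], so any constants will do. *)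
have [D0|Dn] := leP 0 D; last first.
  exists 1, 1; first by split; exact: ltr01.
  move=> W0 P0 S0 W1 P1 S1 _ _ _ _ /(_ 0); rewrite lexx ler01 => /(_ isT) [h].
  by have := le_lt_trans (le_trans (normr_ge0 _) h) Dn; rewrite ltxx.
have [C [L [C0 L0] lip]] := jeval_lip e (addr_ge0 D0 ler01).
have [A A0 hA] := @gstep_bound R.
pose mu := 4 * L + 1; pose r := expR (- mu) : R.
have mu1 : 1 <= mu by rewrite /mu lerDr mulr_ge0.
have mu0 : 0 <= mu by exact: le_trans mu1.
have muL : 4 * L <= mu by rewrite /mu lerDl.
have r0 : 0 < r by exact: expR_gt0.
(* The step has Gevrey ratio 8, and slowing it down by [tau] divides the ratio by [tau]. The value
   of [tau] makes [th * expR 1] equal to [1 / 4]. *)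
pose tau : R := 32 * expR 1; pose th := 8 / tau.
have tau0 : 0 < tau by rewrite mulr_gt0 ?expR_gt0.
have th0 : 0 <= th by rewrite divr_ge0 // ltW.
have th1 : th * expR 1 <= 1 / 4.
  have := @expR_gt0 R 1; rewrite /th /tau => e0; rewrite le_eqVlt; apply/orP; left; apply/eqP.
  by field; rewrite gt_eqF.
(* The size allowed for [H]: the source then takes at most half of the radius [r]. *)
pose h := r / 2 / A.
have h0 : 0 < h by rewrite !divr_gt0.
have Ah : A * h <= r / 2 by rewrite /h mulrC divfK // gt_eqF.
(* The first bound keeps the constant jet [P1 - P0] in the ball; the second bounds [H], whose two
   parts are at most [eta] and [L * eta]. *)
pose eta := Num.min r (h / (1 + L)).
have L1 : 0 < 1 + L by rewrite ltr_wpDr.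
have eta0 : 0 < eta by rewrite lt_min r0 divr_gt0.
have etar : eta <= r by rewrite /eta ge_min lexx.
have etah : eta * (1 + L) <= h by rewrite -ler_pdivlMr // /eta ge_min lexx orbT.
exists eta, tau => // W0 P0 S0 W1 P1 S1 [dW0 dP0 cS0] [dW1 dP1 cS1] z0 z1 hD hE.
have cW0 := der_continuous dW0; have cP0 := der_continuous dP0.
have cW1 := der_continuous dW1; have cP1 := der_continuous dP1.
pose F0 x := peval e (W0 x) (P0 x); pose F1 x := peval e (W1 x) (P1 x).
have cF0 : continuous F0 by exact: cont_peval.
have cF1 : continuous F1 by exact: cont_peval.
pose dF x := F1 (clamp x) - F0 (clamp x).
have cdF : continuous dF by move=> x; apply: cvgB; exact: cont_clamp.
pose H x := (P1 x - P0 x) - prim dF x.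
have dH x : der H x (S1 x - S0 x - dF x).
  exact: (derB (derB (dP1 x) (dP0 x)) (prim_der x cdF)).
have cH : continuous (fun x => H (clamp x)) by exact/cont_clamp/(der_continuous dH).
have bnd0 w : (forall x, 0 <= x <= 1 -> `|w x| <= D) -> jbnd th 0 (D + 1) (jcst w).
  by move=> hw; apply: (@jbnd_le _ _ _ D) => //; [rewrite lerDl|exact: jbnd_cst].
have bW0 : jbnd th 0 (D + 1) (jcst W0) by apply: bnd0 => x /hD [].
have bP0 : jbnd th 0 (D + 1) (jcst P0) by apply: bnd0 => x /hD [].
have bW1 : jbnd th 0 (D + 1) (jcst W1) by apply: bnd0 => x /hD [].
have bP1 : jbnd th 0 (D + 1) (jcst P1) by apply: bnd0 => x /hD [].
have subE (w w' : R -> R) : jsub (jcst w) (jcst w') = jcst (fun x => w x - w' x).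
  by apply/funext => k; apply/funext => x; rewrite /jsub /jcst mulrnBl.
(* The Lipschitz estimate for [peval] is the one for jets, read at index 0 on jets constant in
   time. *)
have hdF x : `|dF x| <= L * eta.
  have [_ H1] := lip th 0 _ _ _ _ th0 bW1 bP1 bW0 bP0.
  have := H1 eta (ltW eta0); rewrite !subE.
  have a1 : jbnd th 0 eta (jcst (fun x => W1 x - W0 x)) by apply: jbnd_cst => // y /hE [].
  have a2 : jbnd th 0 eta (jcst (fun x => P1 x - P0 x)) by apply: jbnd_cst => // y /hE [].
  move=> /(_ a1 a2 0%N (clamp x) (clamp_itv x)).
  by rewrite /jsub !jeval0 /jcst /= !mulr1n mul0r expR0 ?expr0 ?fact0 !mulr1.
have hH x : 0 <= x <= 1 -> `|H x| <= h.
  move=> hx; have /andP[x0 x1] := hx; apply: le_trans etah; rewrite mulrDr mulr1.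
  apply: le_trans (ler_normB _ _) _; apply: lerD; first by have [] := hE x hx.
  apply: le_trans (@prim_bound R dF (L * eta) x cdF x0 (fun y _ => hdF y)) _.
  by rewrite mulrC [eta * _]mulrC ler_piMl // mulr_ge0 // ltW.
pose phi t k := gstep k (t / tau) / tau ^+ k.
have phi_b t : gevrey_seq A th (phi t).
  move=> k; rewrite /phi normrM normfV (gtr0_norm (exprn_gt0 _ tau0)).
  rewrite ler_pdivrMr ?exprn_gt0 //.
  rewrite (_ : A * _ * _ = A * (8 ^+ k * k`!%:R)); first exact: hA.
  by rewrite /th expr_div_n; field; rewrite expf_neq0 // gt_eqF.
have phi_d k t : der (fun t => phi t k) t (k.+1%:R * phi t k.+1).
  have h1 : der (fun t => t / tau) t (tau^-1).
    by apply: der_eq (der_ext _ (derZ tau^-1 (derI t))) _ => [y|]; [exact: mulrC|rewrite mulr1].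
  apply: der_eq (der_ext _ (derZ (tau ^+ k)^-1 (der_comp (gstep_der k _) h1))) _ => [y|].
    by rewrite mulrC.
  by rewrite /phi exprS; field; rewrite expf_neq0 gt_eqF.
have hD0 x : 0 <= x <= 1 -> `|W0 x| <= D by move=> /hD [].
have hD1 x : 0 <= x <= 1 -> `|P0 x| <= D by move=> /hD [].
have lip' := fun a b a' b' => lip th mu a b a' b' th0.
have lip'' a b a' b' : jbnd th 0 (D + 1) a -> jbnd th 0 (D + 1) b ->
    jbnd th 0 (D + 1) a' -> jbnd th 0 (D + 1) b' ->
    forall N, 0 <= N -> jbnd th mu N (jsub a a') -> jbnd th mu N (jsub b b') ->
      jbnd th mu (L * N) (jsub (jeval e a b) (jeval e a' b')).
  by move=> h1 h2 h3 h4; have [_] := lip' a b a' b' h1 h2 h3 h4.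
have cW0' := cont_clamp cW0; have cP0' := cont_clamp cP0.
have [Q [Qb Qc Qd Qf]] := picard_solution cW0' cP0' cH hD0 hD1 L0 lip'' th0 th1 mu1 muL hH Ah phi_b phi_d.
have Quniq := picard_unique cW0' cP0' hD0 hD1 L0 lip'' th0 th1 mu1 muL.
have dJ : jder (fun t => jprim (Q t)) by exact: (@jder_prim R th mu r Q th0 (ltW r0) Qd Qb Qc).
have cJ t : jcont (jprim (Q t)) by exact: jcont_prim.
have bJ t : jbnd th mu (r / mu) (jprim (Q t)).
  by apply: jbnd_prim => //; [exact: lt_le_trans mu1|exact: ltW].
have rmu : 0 <= r / mu by rewrite divr_ge0 // ltW.
have cQ : jc (fun t => Q t 0%N) by exact: (@jc_jet th mu r Q 0%N th0 (ltW r0) Qd Qb Qc).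
have cJ0 : jc (fun t => jprim (Q t) 0%N) by exact: (@jc_jet th mu (r / mu) _ 0%N th0 rmu dJ bJ cJ).
have cJ1 : jc (fun t => jprim (Q t) 1%N) by exact: (@jc_jet th mu (r / mu) _ 1%N th0 rmu dJ bJ cJ).
pose v t x := W0 x + jprim (Q t) 0%N x.
(* The expression through [picard_op] replaces [P0 x + Q t 0 x], to which it is equal on [[0, 1]]
   only: its terms are primitives, hence it has two-sided derivatives at the endpoints too. *)
pose vx t x := P0 x + picard_op e W0 P0 H (phi t) (Q t) 0%N x.
pose vt t x := jprim (Q t) 1%N x.
pose nl t x := nonlin e W0 P0 (Q t) 0%N (clamp x).
pose vxx t x := S0 x + (phi t 0%N * (S1 x - S0 x - dF x) + (vt t (clamp x) + nl t x)).
have vxE t x : 0 <= x <= 1 -> vx t x = P0 x + Q t 0%N x by move=> hx; rewrite /vx -Qf.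
have nlE t x : 0 <= x <= 1 -> nl t x = peval e (v t x) (vx t x) - F0 x.
  by move=> hx; rewrite /nl clamp_id // /nonlin /jsub !jeval0 vxE.
have phi0 t : phi t 0%N = gstep 0 (t / tau) by rewrite /phi expr0 divr1.
have cv : jc v by apply: jcD => //; apply: jc_space; exact: cont_clamp.
have cvx : jc vx.
  apply: (@jc_ext R (fun t x => P0 x + Q t 0%N x)); first by move=> t x /vxE.
  by apply: jcD => //; apply: jc_space; exact: cont_clamp.
have v_at_0 t : v t 0 = 0 by rewrite /v z0 /jprim prim0 addr0.
exists v, vx, vxx, vt; split; [split| exact: v_at_0| | | ].
  + move=> t x hx; rewrite vxE //.
    have h1 := prim_der x (@Qc t 0%N); rewrite clamp_id // in h1.
    exact: (derD (dW0 x) h1).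
  + move=> t x hx.
    have h2 : der (jshift (jprim (jprim (Q t))) 0%N) x (vt t (clamp x)).
      by apply: der_eq (derZ _ (prim_der x (@cJ t 1%N))) _; rewrite mul1r.
    have h3 := prim_der x (@jcont_nonlin _ e _ _ cW0' cP0' _ (@Qc t) 0%N).
    exact: (derD (dP0 x) (derD (derZ (phi t 0%N) (dH x)) (derD h2 h3))).
  + move=> t x hx; have := derD (derC (W0 x) t) (dJ 0%N t x hx).
    by rewrite add0r mul1r.
  + exact: cv.
  + exact: cvx.
  + apply: (@jc_ext R (fun t x => S0 x + (gstep 0 (t / tau) * (S1 x - S0 x - (F1 x - F0 x)) +
        (vt t x + (peval e (v t x) (vx t x) - F0 x))))).
      by move=> t x hx; rewrite /vxx /dF nlE // phi0 clamp_id.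
    apply: jcD; first by apply: jc_space; exact: cont_clamp.
    apply: jcD; last first.
      apply: jcD => //; apply: jcB; first exact: jc_peval.
      by apply: jc_space; exact: cont_clamp.
    apply: jcM.
      apply: (jc_time (w := fun t => gstep 0 (t / tau))) => t.
      have := der_cont (phi_d 0%N t); rewrite (_ : (fun t => phi t 0%N) = (fun t => gstep 0 (t / tau))) //.
      by apply/funext => s; exact: phi0.
    apply: (jc_space (w := fun x => S1 x - S0 x - (F1 x - F0 x))) => x.
    by apply: cvgB; apply: cvgB; exact: cont_clamp.
  + exact: cJ1.
- move=> t x hx; rewrite /vxx nlE // /dF !clamp_id // phi0 /F0 /F1; ring.
- move=> t x t0 hx; rewrite /v.
  (* Before the step all coefficients [phi t] vanish, and the zero jet is a fixed point. *)
  pose z : nat -> R -> R := fun _ _ => 0.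
  have zE : z = jcst (fun=> 0) by apply/funext => k; apply/funext => y; rewrite /jcst mul0rn.
  have phiz k : phi t k = 0.
    by rewrite /phi gstep_le0 ?mul0r // pmulr_lle0 ?invr_gt0.
  have cz : jcont z by move=> k y; exact: cvg_cst.
  have bz : jbnd th mu r z.
    rewrite zE; apply: jbnd_cst_mu => // y _; rewrite normr0; exact: ltW.
  have Jz k y : jprim z k y = 0 by rewrite /jprim (prim_const 0) mul0r.
  have JJz k y : jprim (jprim z) k y = 0.
    by rewrite -(Jz k y) {1 3}/jprim; congr (prim _ _); apply/funext => u; rewrite Jz.
  have Nz : nonlin e W0 P0 z = z.
    apply/funext => k; apply/funext => y; rewrite /nonlin /jsub.
    rewrite (@jeval_ext R e _ _ (jcst W0) (jcst P0)) ?subrr // => j.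
      by rewrite /jadd Jz addr0.
    by rewrite /jadd addr0.
  have fz : is_fixed e W0 P0 H (phi t) z.
    by move=> k y hy; rewrite /picard_op Nz /jadd /jshift JJz Jz phiz mul0r mulr0 !addr0.
  have Qz := Quniq H (phi t) (Q t) z (@Qc t) cz (Qb t) bz (@Qf t) fz.
  rewrite /jprim (_ : (fun z => _) = (fun=> 0)) ?prim_const ?mul0r ?addr0 //.
  by apply/funext => y; rewrite Qz ?clamp_itv.
- move=> t x t1 hx; rewrite /v.
  (* After the step [phi t] is the jet of the constant 1. For the constant jet [P1 - P0] the
     primitive in [H] cancels that of the nonlinear term, and the time derivative is zero. *)
  pose z := jcst (fun x => P1 x - P0 x).
  have phiz k : phi t k = (k == 0%N)%:R.
    rewrite /phi gstep_ge1 ?ler_pdivlMr ?mul1r //; case: k => [|k]; last by rewrite mul0r.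
    by rewrite expr0 divr1.
  have cz : jcont z by apply: jcont_cst => y; apply: cvgB; exact: cont_clamp.
  have bz : jbnd th mu r z.
    by apply: jbnd_cst_mu => // y hy; have [_ h2] := hE y hy; exact: le_trans h2 etar.
  have Jz k y : 0 <= y <= 1 -> jprim z k y = jcst (fun x => W1 x - W0 x) k y.
    move=> hy; rewrite /jprim /z /jcst; case: k => [|k]; last first.
      by rewrite mulr0n (_ : (fun z => _) = (fun=> 0)) ?prim_const ?mul0r //; apply/funext => u; rewrite mulr0n.
    rewrite !mulr1n; apply/esym.
    apply: (@prim_uniq R _ (fun y => W1 y - W0 y)).
    - exact: (cz 0%N).
    - by rewrite z0 z1 subrr.
    - move=> u; have /andP[y0 y1] := hy; rewrite min_l // max_r // => /andP[u0 uy].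
      rewrite clamp_id ?u0 ?(le_trans uy) // mulr1n; exact: derB.
  have JJz k y : 0 <= y <= 1 -> jprim (jprim z) k.+1 y = 0.
    move=> hy; rewrite {1}/jprim (_ : (fun z => _) = (fun=> 0)) ?prim_const ?mul0r //.
    by apply/funext => u; rewrite Jz ?clamp_itv.
  have Nz k y : 0 <= y <= 1 -> nonlin e W0 P0 z k y = jcst (fun x => F1 x - F0 x) k y.
    move=> hy; rewrite /nonlin /jsub (@jeval_ext R e _ _ (jcst W1) (jcst P1)).
    - by rewrite !jeval_cst /jcst -mulrnBl.
    - by move=> j; rewrite /jadd Jz // /jcst -mulrnDl addrC subrK.
    - by move=> j; rewrite /jadd /z /jcst -mulrnDl addrC subrK.
  have JNz k y : jprim (nonlin e W0 P0 z) k y = prim dF y *+ (k == 0%N).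
    rewrite /jprim; case: k => [|k].
      by rewrite mulr1n; congr (prim _ _); apply/funext => u; rewrite Nz ?clamp_itv.
    rewrite mulr0n (_ : (fun z => _) = (fun=> 0)) ?prim_const ?mul0r //.
    by apply/funext => u; rewrite Nz ?clamp_itv.
  have fz : is_fixed e W0 P0 H (phi t) z.
    move=> k y hy; rewrite /picard_op /jadd /jshift JJz // mulr0 add0r JNz phiz /z /jcst /H.
    by case: k => [|k]; rewrite ?mulr1n ?mulr0n ?mul1r ?mul0r ?subrK ?addr0.
  have Qz := Quniq H (phi t) (Q t) z (@Qc t) cz (Qb t) bz (@Qf t) fz.
  have -> : jprim (Q t) 0%N x = jprim z 0%N x.
    by rewrite /jprim; congr (prim _ _); apply/funext => y; rewrite Qz ?clamp_itv.
  by rewrite Jz // /jcst mulr1n addrC subrK.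
Qed.

End Trajectories.

(** * Exact trajectories between steady states *)

Section OneSidedDerivatives.
Context {R : realType}.
Implicit Types (f g G : R -> R) (x y l : R).

Lemma clamp_lip x y : `|clamp y - clamp x| <= `|y - x|.
Proof.
suff H (a b : R) : a <= b -> `|clamp b - clamp a| <= `|b - a|.
  by have [xy|/ltW yx] := leP x y; [exact: H|rewrite distrC [leRHS]distrC; exact: H].
move=> ab; rewrite [leRHS]ger0_norm ?subr_ge0 // /clamp.
have [a0|a0] := leP a 1; have [b0|b0] := leP b 1; rewrite /Num.max;
  do ?case: ifP => ?; rewrite ?subrr ?normr0 ?ger0_norm; lra.
Qed.

Lemma cvg01P f x l : 0 <= x <= 1 ->
  (quot01 f x y @[y --> within `[0, 1] x^'] --> l) <->
  (forall e, 0 < e -> exists2 d, 0 < d & forall y, 0 <= y <= 1 -> `|y - x| < d ->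
     `|f y - f x - l * (y - x)| <= e * `|y - x|).
Proof.
move=> hx; split.
  move=> /cvgrPdist_le h e e0; have [d /= d0 hd] := h e e0; exists d => // y hy yd.
  have [->|yx] := eqVneq y x; first by rewrite !subrr mulr0 subrr normr0 mulr0.
  have yx0 : y - x != 0 by rewrite subr_eq0.
  have := hd y; rewrite /ball /= distrC => /(_ yd yx).
  rewrite in_itv /= => /(_ hy) H.
  rewrite (_ : _ - _ - _ = - ((l - quot01 f x y) * (y - x))); last by rewrite /quot01; field.
  by rewrite normrN normrM ler_wpM2r.
move=> h; apply/cvgrPdist_le => /= e e0; have [d d0 hd] := h e e0.
exists d => //= y; rewrite /ball /= distrC => yd yx; rewrite in_itv /= => hy.
have := hd y hy yd.
have yx0 : y - x != 0 by rewrite subr_eq0.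
rewrite (_ : l - quot01 f x y = - (f y - f x - l * (y - x)) / (y - x)); last by rewrite /quot01; field.
by rewrite normrM normfV normrN ler_pdivrMr // normr_gt0.
Qed.

Lemma within01_proper x : 0 <= x <= 1 -> ProperFilter (within `[0, 1] x^').
Proof.
move=> /andP[x0 x1]; apply: Build_ProperFilter_ex => P [d /= d0 hd].
pose e := Num.min d 1 / 2.
have e0 : 0 < e by rewrite divr_gt0 // lt_min d0 ltr01.
have ed : e < d /\ e <= 1 / 2.
  have : Num.min d 1 <= d by rewrite ge_min lexx.
  have : Num.min d 1 <= 1 by rewrite ge_min lexx orbT.
  by rewrite /e => h1 h2; split; lra.
have [xh|xh] := leP x (1/2).
  exists (x + e); apply: hd.
  - rewrite /ball /= (_ : x - (x + e) = - e); last by ring.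
    by rewrite normrN gtr0_norm //; case: ed.
  - by rewrite -subr_eq0 (_ : x + e - x = e) ?gt_eqF //; ring.
  - by rewrite in_itv /=; apply/andP; split; case: ed => *; lra.
exists (x - e); apply: hd.
- rewrite /ball /= (_ : x - (x - e) = e); last by ring.
  by rewrite gtr0_norm //; case: ed.
- by rewrite -subr_eq0 (_ : x - e - x = - e) ?oppr_eq0 ?gt_eqF //; ring.
- by rewrite in_itv /=; apply/andP; split; case: ed => *; lra.
Qed.

Lemma cvg01_of_der f G x l : 0 <= x <= 1 -> (forall y, 0 <= y <= 1 -> f y = G y) ->
  der G x l -> quot01 f x y @[y --> within `[0, 1] x^'] --> l.
Proof.
move=> hx fG /derP h; apply/cvg01P => // e e0; have [d d0 hd] := h e e0.
by exists d => // y hy yd; rewrite !fG //; exact: hd.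
Qed.

Lemma deriv01_of_der f G x l : 0 <= x <= 1 -> (forall y, 0 <= y <= 1 -> f y = G y) ->
  der G x l -> deriv01 f x = l.
Proof.
move=> hx fG hl; have PF := within01_proper hx.
by apply: (cvg_lim (@Rhausdorff R)); exact: cvg01_of_der fG hl.
Qed.

Lemma derivable01P f x : derivable01 f -> 0 <= x <= 1 ->
  forall e, 0 < e -> exists2 d, 0 < d & forall y, 0 <= y <= 1 -> `|y - x| < d ->
     `|f y - f x - deriv01 f x * (y - x)| <= e * `|y - x|.
Proof.
move=> hf hx; have PF := within01_proper hx.
by apply/(cvg01P f (deriv01 f x) hx); apply: hf; rewrite in_itv.
Qed.

(** Composed with [clamp], [f] is continuous on the line, and the mean value theorem asks for
    derivatives at interior points only, where the relative derivative is an ordinary one. *)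
Lemma derivable01_unique f G : derivable01 f ->
  (forall y, 0 <= y <= 1 -> der G y (deriv01 f y)) -> f 0 = G 0 ->
  forall x, 0 <= x <= 1 -> f x = G x.
Proof.
move=> hf hG f0 x /andP[x0 x1].
have cf : continuous (fun y => f (clamp y)).
  move=> y; apply/cvgrPdist_le => /= e e0.
  have [d d0 hd] := derivable01P hf (clamp_itv y) ltr01.
  pose m := `|deriv01 f (clamp y)| + 1.
  have m0 : 0 < m by rewrite ltr_wpDl.
  exists (Num.min d (e / m)) => /=; first by rewrite lt_min d0 divr_gt0.
  move=> z; rewrite /ball /= lt_min => /andP[yz1 yz2].
  have cl := clamp_lip y z; rewrite [leRHS]distrC in cl.
  have := hd (clamp z) (clamp_itv z) (le_lt_trans cl yz1).
  rewrite mul1r => H.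
  rewrite distrC (_ : f (clamp z) - _ = (f (clamp z) - f (clamp y) - deriv01 f (clamp y) * (clamp z - clamp y))
    + deriv01 f (clamp y) * (clamp z - clamp y)); last by ring.
  apply: le_trans (ler_normD _ _) _; apply: le_trans (lerD H (lexx _)) _.
  rewrite normrM -[X in X + _]mul1r -mulrDl addrC -/m.
  by rewrite ltr_pdivlMr // mulrC in yz2; apply: le_trans (ltW yz2); rewrite ler_wpM2l // ltW.
have [c|y|c _] := @MVT_segment R (fun y => f (clamp y) - G y) (fun y => deriv01 f y - deriv01 f y) 0 x x0.
- rewrite in_itv /= => /andP[c0 cx].
  have c01 : 0 <= c <= 1 by apply/andP; split; lra.
  apply: derB; last exact: hG.
  apply/derP => e e0; have [d d0 hd] := derivable01P hf c01 e0.
  exists (Num.min d (Num.min c (1 - c))); first by rewrite !lt_min d0 c0; lra.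
  move=> y; rewrite !lt_min => /and3P[y1 y2 y3].
  have y01 : 0 <= y <= 1.
    by have := ler_norm (y - c); have := ler_norm (- (y - c)); rewrite normrN => *; apply/andP; split; lra.
  by rewrite !clamp_id //; exact: hd.
- move: y; apply: continuous_in_subspaceT => y; rewrite inE /= in_itv /= => /andP[y0 yx].
  apply: cvgB; first exact: cf.
  by apply: (der_cont (hG y _)); rewrite y0 (le_trans yx).
- rewrite subrr mul0r !clamp_id ?lexx ?ler01 ?x0 ?x1 //.
  by rewrite f0 subrr subr0 => /eqP; rewrite subr_eq0 => /eqP.
Qed.

Lemma within01_clamp f : {within `[0, 1], continuous f} -> continuous (fun x => f (clamp x)).
Proof.
move=> /subspace_continuousP h x.
have := h (clamp x); rewrite /= in_itv /= => /(_ (clamp_itv x)) /cvgrPdist_le H.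
apply/cvgrPdist_le => /= e e0; have [d /= d0 hd] := H e e0.
exists d => //= y; rewrite /ball /= => xy; apply: hd.
  by rewrite /ball /=; apply: le_lt_trans xy; rewrite distrC [leRHS]distrC; exact: clamp_lip.
by rewrite /= in_itv /=; exact: clamp_itv.
Qed.

(** Since [u] is arbitrary outside [[0, 1]], it is rebuilt there by integrating its clamped second
    derivative twice. *)
Lemma C2_extension (u : R -> R) : C2_01 u -> exists W, exists P, exists S,
  [/\ C2_data W P S, forall x, 0 <= x <= 1 -> W x = u x,
      forall x, 0 <= x <= 1 -> P x = deriv01 u x
    & forall x, 0 <= x <= 1 -> S x = deriv01 (deriv01 u) x].
Proof.
case=> d1 d2 /within01_clamp cS.
pose S x := deriv01 (deriv01 u) (clamp x).
pose P x := deriv01 u 0 + prim S x.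
have dP x : der P x (S x).
  by apply: der_eq (derD (derC _ x) (prim_der x cS)) _; rewrite add0r.
have cP : continuous P by exact: der_continuous dP.
pose W x := u 0 + prim P x.
have dW x : der W x (P x).
  by apply: der_eq (derD (derC _ x) (prim_der x cP)) _; rewrite add0r.
have SE x : 0 <= x <= 1 -> S x = deriv01 (deriv01 u) x by move=> hx; rewrite /S clamp_id.
have PE x : 0 <= x <= 1 -> deriv01 u x = P x.
  move=> hx; apply: (@derivable01_unique _ P d2 _ _ x hx); last by rewrite /P prim0 addr0.
  by move=> y hy; rewrite -SE.
have WE x : 0 <= x <= 1 -> u x = W x.
  move=> hx; apply: (@derivable01_unique _ W d1 _ _ x hx); last by rewrite /W prim0 addr0.
  by move=> y hy; rewrite PE.
exists W, P, S; split; [exact: And3 dW dP cS|by move=> x /WE| by move=> x /PE|exact: SE].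
Qed.

(** An unbounded set has a default value as [sup], so boundedness has to be established, here from
    continuity. *)
Lemma supnorm01_ge f G x : continuous G -> (forall y, 0 <= y <= 1 -> f y = G y) -> 0 <= x <= 1 ->
  `|f x| <= supnorm01 f.
Proof.
move=> cG fG hx.
have [M hM] : exists M : R, forall y, 0 <= y <= 1 -> `|G y| <= M.
  have [M hM] := @jc_bounded R (fun _ y => G y) 0 0 (jc_space (cont_clamp cG)).
  by exists M => y hy; apply: (hM 0); rewrite ?lexx.
apply: ub_le_sup.
  by exists M => _ [y hy <-]; rewrite /= in_itv /= in hy; rewrite fG //; exact: hM.
by exists x => //; rewrite /= in_itv.
Qed.

Lemma C2norm_sub_ge (u0 u1 W0 P0 S0 W1 P1 S1 : R -> R) :
  C2_data W0 P0 S0 -> C2_data W1 P1 S1 ->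
  (forall x, 0 <= x <= 1 -> W0 x = u0 x) -> (forall x, 0 <= x <= 1 -> W1 x = u1 x) ->
  forall x, 0 <= x <= 1 -> `|W1 x - W0 x| <= C2norm (fun x => u1 x - u0 x) /\
     `|P1 x - P0 x| <= C2norm (fun x => u1 x - u0 x).
Proof.
move=> [a1 a2 a3] [b1 b2 b3] e0 e1.
set u := fun x => _.
have c1 : continuous (fun x => W1 x - W0 x).
  by move=> x; apply: cvgB; [exact: (der_continuous b1)|exact: (der_continuous a1)].
have c2 : continuous (fun x => P1 x - P0 x).
  by move=> x; apply: cvgB; [exact: (der_continuous b2)|exact: (der_continuous a2)].
have c3 : continuous (fun x => S1 x - S0 x) by move=> x; apply: cvgB; [exact: b3|exact: a3].
have uE y : 0 <= y <= 1 -> u y = W1 y - W0 y by move=> hy; rewrite /u e0 ?e1.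
have uE' y : 0 <= y <= 1 -> deriv01 u y = P1 y - P0 y.
  by move=> hy; apply: (deriv01_of_der hy uE); exact: derB.
have uE'' y : 0 <= y <= 1 -> deriv01 (deriv01 u) y = S1 y - S0 y.
  by move=> hy; apply: (deriv01_of_der hy uE'); exact: derB.
move=> x hx.
have h1 := supnorm01_ge c1 uE hx; have h2 := supnorm01_ge c2 uE' hx.
have h3 := supnorm01_ge c3 uE'' hx.
have n1 := normr_ge0 (u x); have n2 := normr_ge0 (deriv01 u x); have n3 := normr_ge0 (deriv01 (deriv01 u) x).
by rewrite -uE // -uE' // /C2norm; split; lra.
Qed.

End OneSidedDerivatives.

(** * Trajectories of the controlled equation *)

Section Reach.
Context {R : realType} (alpha beta gamma : R) (delta : nat) (b c : R).
Hypothesis b_gt0 : 0 < b.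
Hypothesis b_lt_c : b < c.
Hypothesis c_lt1 : c < 1.
Implicit Types (v vx vxx vt : R -> R -> R) (W P S u : R -> R) (t s x : R).

Fixpoint ppow n : @pexpr R := if n is m.+1 then PMul PVal (ppow m) else PCst 1.

Lemma ppowE n (v p : R) : peval (ppow n) v p = v ^+ n.
Proof. by elim: n => [|n IH] //=; rewrite IH exprS. Qed.

(** The convection coefficient is a parameter because the reflection [x -> 1 - x] reverses its
    sign. *)
Definition Fexpr (a : R) : @pexpr R :=
  PAdd (PMul (PCst a) (PMul (ppow delta) PSlope))
    (PMul (PCst (- beta)) (PMul PVal (PMul (PAdd (PCst 1) (PMul (PCst (-1)) (ppow delta)))
       (PAdd (ppow delta) (PCst (- gamma)))))).

Lemma FexprE a (v p s : R) : rhs a beta gamma delta v p s = s - peval (Fexpr a) v p.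
Proof. by rewrite /rhs /= ppowE; ring. Qed.

Definition uncontrolled x := (0 < x < b) \/ (c < x < 1).

Definition pde v vx vxx vt := forall t x, uncontrolled x ->
  vt t x = rhs alpha beta gamma delta (v t x) (vx t x) (vxx t x).

(** Trajectories are defined for all times and at rest outside [[0, tau]]: they can then be
    concatenated, and prolonged to any later final time. No control appears, since nothing is asked
    on [[b, c]]. *)
Definition reach u0 u1 := exists tau v vx vxx vt,
  [/\ 0 <= tau, traj v vx vxx vt & pde v vx vxx vt] /\
  [/\ forall t, v t 0 = 0 /\ v t 1 = 0,
      forall t x, t <= 0 -> 0 <= x <= 1 -> v t x = u0 x
    & forall t x, tau <= t -> 0 <= x <= 1 -> v t x = u1 x].

Lemma uncontrolled01 x : uncontrolled x -> 0 <= x <= 1.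
Proof.
case=> /andP[h1 h2]; first by rewrite (ltW h1) (ltW (lt_trans h2 (lt_trans b_lt_c c_lt1))).
by rewrite (ltW h2) (ltW (lt_trans b_gt0 (lt_trans b_lt_c h1))).
Qed.

Definition steady_data W P S := [/\ C2_data W P S, W 0 = 0, W 1 = 0 &
  forall x, uncontrolled x -> S x = peval (Fexpr alpha) (W x) (P x)].

Lemma steady_dataP u : steady_state alpha beta gamma delta b c u ->
  exists W, exists P, exists S, steady_data W P S /\ forall x, 0 <= x <= 1 -> W x = u x.
Proof.
case=> /C2_extension [W [P [S [h1 h2 h3 h4]]]] he u0 u1.
exists W, P, S; split => //; split => //; rewrite ?h2 ?lexx ?ler01 //.
move=> x hx; have x01 := uncontrolled01 hx.
have := he x; rewrite !in_itv /= -h2 // -h3 // -h4 // FexprE => H.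
by apply/eqP; rewrite -subr_eq0; apply/eqP/H; case: hx; [left|right].
Qed.

Lemma traj_stationary W P S : C2_data W P S -> traj (fun=> W) (fun=> P) (fun=> S) (fun _ _ => 0).
Proof.
case=> h1 h2 h3; split => //.
- by move=> t x _; exact: derC.
- by apply/jc_space/cont_clamp/(der_continuous h1).
- by apply/jc_space/cont_clamp/(der_continuous h2).
- exact/jc_space/cont_clamp.
- exact: jcC.
Qed.

Lemma reach_refl W P S u : steady_data W P S -> (forall x, 0 <= x <= 1 -> W x = u x) -> reach u u.
Proof.
case=> h1 h2 h3 h4 hu; exists 0, (fun=> W), (fun=> P), (fun=> S), (fun _ _ => 0); split.
  split => //; first exact: traj_stationary.
  by move=> t x hx; rewrite FexprE h4 // subrr.
by split => // t x _ hx; exact: hu.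
Qed.

Lemma traj_const_time v vx vxx vt v' vx' vxx' vt' t t' :
  traj v vx vxx vt -> traj v' vx' vxx' vt' ->
  (forall x, 0 <= x <= 1 -> v t x = v' t' x) ->
  forall x, 0 <= x <= 1 -> vx t x = vx' t' x /\ vxx t x = vxx' t' x.
Proof.
move=> h h' e.
have ex x : 0 <= x <= 1 -> vx t x = vx' t' x.
  by move=> hx; apply: (der_uniq_seg ltr01 hx e); [exact: (traj_x h)|exact: (traj_x h')].
move=> x hx; split; first exact: ex.
by apply: (der_uniq_seg ltr01 hx ex); [exact: (traj_xx h)|exact: (traj_xx h')].
Qed.

(** The formula [v t + w (t - T) - v T] avoids a case distinction in time, hence any matching at
    [T]: at every time one of the first two terms rests at [u1] and cancels the third. The equation
    is nonlinear, but only one trajectory is ever left in it. *)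
Lemma reach_trans u0 u1 u2 : reach u0 u1 -> reach u1 u2 -> reach u0 u2.
Proof.
move=> [T [v [vx [vxx [vt [[T0 hv pv] [bv iv ev]]]]]]].
move=> [T' [w [wx [wxx [wt [[T0' hw pw] [bw iw ew]]]]]]].
exists (T + T'), (fun t x => v t x + w (t - T) x - v T x),
  (fun t x => vx t x + wx (t - T) x - vx T x),
  (fun t x => vxx t x + wxx (t - T) x - vxx T x),
  (fun t x => vt t x + wt (t - T) x).
have shift_der t x : 0 <= x <= 1 -> der (fun t => w (t - T) x) t (wt (t - T) x).
  move=> hx; have h : der (fun t => t - T) t 1.
    by apply: der_eq (derB (derI t) (derC T t)) _; rewrite subr0.
  have := der_comp (f := fun s => w s x) (g := fun t => t - T) (traj_t hw _ hx) h.
  by rewrite mulr1.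
split; [split|split].
- exact: addr_ge0.
- split.
  + move=> t x hx; apply: derB; last exact: (traj_x hv).
    by apply: derD; [exact: (traj_x hv)|exact: (traj_x hw)].
  + move=> t x hx; apply: derB; last exact: (traj_xx hv).
    by apply: derD; [exact: (traj_xx hv)|exact: (traj_xx hw)].
  + move=> t x hx.
    have := derB (derD (traj_t hv t hx) (shift_der t x hx)) (derC (v T x) t).
    by rewrite subr0.
  + apply: jcB; first by apply: jcD; [exact: (traj_cont hv)|exact/jc_shift/(traj_cont hw)].
    exact/jc_space/jc_slice/(traj_cont hv).
  + apply: jcB; first by apply: jcD; [exact: (traj_cont_x hv)|exact/jc_shift/(traj_cont_x hw)].
    exact/jc_space/jc_slice/(traj_cont_x hv).
  + apply: jcB; first by apply: jcD; [exact: (traj_cont_xx hv)|exact/jc_shift/(traj_cont_xx hw)].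
    exact/jc_space/jc_slice/(traj_cont_xx hv).
  + by apply: jcD; [exact: (traj_cont_t hv)|exact/jc_shift/(traj_cont_t hw)].
- move=> t x hx; have x01 := uncontrolled01 hx.
  have [tT|/ltW tT] := leP t T.
    have tT0 : t - T <= 0 by rewrite subr_le0.
    have e y : 0 <= y <= 1 -> w (t - T) y = v T y by move=> hy; rewrite iw // ev.
    have [e1 e2] := traj_const_time hw hv e x01.
    have e3 : wt (t - T) x = 0.
      apply: (@der_uniq_seg R (fun t => w t x) (fun=> u1 x) _ _ (t - T - 1) (t - T) (t - T)).
      - by rewrite gtrBl.
      - by rewrite lexx andbT gerBl ler01.
      - by move=> s /andP[_ s1]; rewrite iw // (le_trans s1).
      - exact: (traj_t hw).
    by rewrite e // e1 e2 e3 !addrK addr0; exact: pv.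
  have tT0 : 0 <= t - T by rewrite subr_ge0.
  have e y : 0 <= y <= 1 -> v t y = v T y by move=> hy; rewrite !ev.
  have [e1 e2] := traj_const_time hv hv e x01.
  have e3 : vt t x = 0.
    apply: (@der_uniq_seg R (fun t => v t x) (fun=> u1 x) _ _ t (t + 1) t).
    - by rewrite ltrDl.
    - by rewrite lexx lerDl ler01.
    - by move=> s /andP[s1 _]; rewrite ev // (le_trans tT).
    - exact: (traj_t hv).
  rewrite e // e1 e2 e3 add0r ![_ T x + _]addrC !addrK; exact: pw.
- move=> t; have [h1 h2] := bv t; have [h3 h4] := bv T; have [h5 h6] := bw (t - T).
  by rewrite h1 h2 h3 h4 h5 h6 addr0 subrr.
- move=> t x t0 hx; rewrite iw //; last by lra.
  by rewrite (ev T) // addrK iv.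
- move=> t x t0 hx; rewrite (ev T) // (ev t) //; last by lra.
  by rewrite addrC addKr ew //; lra.
Qed.

Lemma reach_ext u0 u1 w0 w1 : (forall x, 0 <= x <= 1 -> u0 x = w0 x) ->
  (forall x, 0 <= x <= 1 -> u1 x = w1 x) -> reach u0 u1 -> reach w0 w1.
Proof.
move=> e0 e1 [T [v [vx [vxx [vt [h [bv iv ev]]]]]]].
exists T, v, vx, vxx, vt; split; first exact: h.
split; first exact: bv.
  by move=> t x t0 hx; rewrite -e0 // iv.
by move=> t x t0 hx; rewrite -e1 // ev.
Qed.

Let w : R := c - b.
Let cutoff x := 1 - gstep 0 ((x - b) / w).
Let cutoff1 x := - gstep 1 ((x - b) / w) / w.
(** The entries of [gstep] are divided by factorials, whence the factor 2 in a second derivative. *)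
Let cutoff2 x := - (2 * gstep 2 ((x - b) / w)) / w ^+ 2.

Let w0 : 0 < w. Proof. by rewrite subr_gt0. Qed.

Let der_rescale x : der (fun x => (x - b) / w) x w^-1.
Proof.
apply: der_eq (der_ext _ (der_affine w^-1 (- b / w) x)) _ => // y.
by rewrite mulrDl mulrC.
Qed.

Let cutoff_der x : der cutoff x (cutoff1 x).
Proof.
apply: der_eq (derB (derC 1 x) (der_comp (gstep_der 0 _) (der_rescale x))) _.
by rewrite /cutoff1; ring.
Qed.

Let cutoff1_der x : der cutoff1 x (cutoff2 x).
Proof.
apply: der_eq (der_ext _ (derZ (- w^-1) (der_comp (gstep_der 1 _) (der_rescale x)))) _.
  by move=> y; rewrite /cutoff1; ring.
by rewrite /cutoff2; field; rewrite gt_eqF.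
Qed.

Let cutoff2_cont : continuous cutoff2.
Proof.
have h x : der cutoff2 x (- (2 / w ^+ 2) * (3 * gstep 3 ((x - b) / w) * w^-1)).
  apply: der_ext (derZ (- (2 / w ^+ 2)) (der_comp (gstep_der 2 _) (der_rescale x))).
  by move=> y; rewrite /cutoff2; ring.
by move=> x; exact: (der_cont (h x)).
Qed.

Let cutoff_left x : x <= b -> [/\ cutoff x = 1, cutoff1 x = 0 & cutoff2 x = 0].
Proof.
move=> xb; have h : (x - b) / w <= 0 by rewrite pmulr_lle0 ?invr_gt0 // subr_le0.
by rewrite /cutoff /cutoff1 /cutoff2 !gstep_le0 // mulr0 oppr0 !mul0r addr0.
Qed.

Let cutoff_right x : c <= x -> [/\ cutoff x = 0, cutoff1 x = 0 & cutoff2 x = 0].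
Proof.
move=> xb; have h : 1 <= (x - b) / w by rewrite ler_pdivlMr // mul1r lerD2r.
by rewrite /cutoff /cutoff1 /cutoff2 !gstep_ge1 //= mulr0 oppr0 !mul0r subrr.
Qed.

Lemma peval_rev (v p : R) : peval (Fexpr (- alpha)) v (- p) = peval (Fexpr alpha) v p.
Proof. by rewrite /= !ppowE; ring. Qed.

Lemma der_rev (f df : R -> R) x : der f (1 - x) (df (1 - x)) -> der (fun x => f (1 - x)) x (- df (1 - x)).
Proof.
move=> h; have h1 : der (fun y => 1 - y) x (-1).
  by apply: der_eq (derB (derC 1 x) (derI x)) _; rewrite sub0r.
by have := der_comp (f := f) (g := fun y => 1 - y) h h1; rewrite mulrN1.
Qed.

Lemma C2_data_rev W P S : C2_data W P S ->
  C2_data (fun x => W (1 - x)) (fun x => - P (1 - x)) (fun x => S (1 - x)).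
Proof.
move=> [h1 h2 h3]; split.
- by move=> x; exact: der_rev.
- move=> x; apply: der_eq (der_ext _ (derZ (-1) (der_rev (h2 (1 - x))))) _ => [y|]; ring.
- move=> x; apply: (@continuous_comp _ _ _ (fun x => 1 - x) S); last exact: h3.
  by apply: cvgB; [exact: cvg_cst|exact: cvg_id].
Qed.

Lemma rev01 x : 0 <= x <= 1 -> 0 <= 1 - x <= 1.
Proof. by move=> /andP[h1 h2]; apply/andP; split; lra. Qed.

(** Both Cauchy problems are solved on the whole of [[0, 1]], each ignoring the condition at the
    other end. To the left of [b] the glued function is the first solution and to the right of [c]
    the second; the sources vanish there because both data are steady. Before and after the step the
    two solutions agree, so gluing does not alter the end states. *)
Lemma reach_close (D : R) : exists2 eta : R, 0 < eta &
  forall W0 P0 S0 W1 P1 S1, steady_data W0 P0 S0 -> steady_data W1 P1 S1 ->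
  (forall x, 0 <= x <= 1 -> [/\ `|W0 x| <= D, `|P0 x| <= D, `|W1 x| <= D & `|P1 x| <= D]) ->
  (forall x, 0 <= x <= 1 -> `|W1 x - W0 x| <= eta /\ `|P1 x - P0 x| <= eta) ->
  reach W0 W1.
Proof.
have [eL [tL [eL0 tL0] HL]] := transition (Fexpr alpha) D.
have [eR [tR [eR0 tR0] HR]] := transition (Fexpr (- alpha)) D.
exists (Num.min eL eR); first by rewrite lt_min eL0.
move=> W0 P0 S0 W1 P1 S1 [c0 z0 o0 s0] [c1 z1 o1 s1] hD hE.
have [x hx||l [lx [lxx [lt [hl l0 le li lf]]]]] := HL W0 P0 S0 W1 P1 S1 c0 c1 z0 z1.
- exact: hD.
- by move=> x /hE [h1 h2]; move: h1 h2; rewrite !le_min => /andP[? _] /andP[? _].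
have rz0 : W0 (1 - 0) = 0 by rewrite subr0.
have rz1 : W1 (1 - 0) = 0 by rewrite subr0.
have [x hx||r [rx [rxx [rt [hr r0 re ri rf]]]]] := HR _ _ _ _ _ _ (C2_data_rev c0) (C2_data_rev c1) rz0 rz1.
- by rewrite !normrN; apply: hD; exact: rev01.
- move=> x /rev01 /hE [h1 h2]; move: h1 h2; rewrite !le_min => /andP[_ ?] /andP[_ ?].
  by rewrite -opprD normrN.
exists (Num.max tL tR),
 (fun t x => cutoff x * l t x + (1 - cutoff x) * r t (1 - x)),
 (fun t x => cutoff1 x * (l t x - r t (1 - x)) + (cutoff x * lx t x - (1 - cutoff x) * rx t (1 - x))),
 (fun t x => cutoff2 x * (l t x - r t (1 - x)) + 2 * (cutoff1 x * (lx t x + rx t (1 - x))) +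
   (cutoff x * lxx t x + (1 - cutoff x) * rxx t (1 - x))),
 (fun t x => cutoff x * lt t x + (1 - cutoff x) * rt t (1 - x)).
have dm x : der (fun x => 1 - cutoff x) x (- cutoff1 x).
  by apply: der_eq (derB (derC 1 x) (cutoff_der x)) _; rewrite sub0r.
have jk : jc (fun _ x => cutoff x).
  by apply/jc_space/cont_clamp/(der_continuous cutoff_der).
have jk1 : jc (fun _ x => cutoff1 x).
  by apply/jc_space/cont_clamp/(der_continuous cutoff1_der).
have jk2 : jc (fun _ x => cutoff2 x) by apply/jc_space/cont_clamp.
have jm : jc (fun _ x => 1 - cutoff x) by apply: jcB => //; exact: jcC.
split; [split|split].
- by rewrite le_max ltW.
- split.
  + move=> t x hx.
    have d1 := derM (cutoff_der x) (traj_x hl t hx).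
    have d2 := derM (dm x) (der_rev (traj_x hr t (rev01 hx))).
    by apply: der_eq (derD d1 d2) _; ring.
  + move=> t x hx.
    have d1 := derB (traj_x hl t hx) (der_rev (traj_x hr t (rev01 hx))).
    have d2 := derM (cutoff_der x) (traj_xx hl t hx).
    have d3 := derM (dm x) (der_rev (traj_xx hr t (rev01 hx))).
    by apply: der_eq (derD (derM (cutoff1_der x) d1) (derB d2 d3)) _; ring.
  + move=> t x hx.
    exact: (derD (derZ _ (traj_t hl t hx)) (derZ _ (traj_t hr t (rev01 hx)))).
  + by apply: jcD; apply: jcM => //; [exact: (traj_cont hl)|exact: (jc_rev (traj_cont hr))].
  + apply: jcD; first by apply: jcM => //; apply: jcB; [exact: (traj_cont hl)|exact: (jc_rev (traj_cont hr))].
    by apply: jcB; apply: jcM => //; [exact: (traj_cont_x hl)|exact: (jc_rev (traj_cont_x hr))].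
  + apply: jcD; first apply: jcD.
    * by apply: jcM => //; apply: jcB; [exact: (traj_cont hl)|exact: (jc_rev (traj_cont hr))].
    * apply: jcM; first exact: jcC.
      by apply: jcM => //; apply: jcD; [exact: (traj_cont_x hl)|exact: (jc_rev (traj_cont_x hr))].
    * by apply: jcD; apply: jcM => //; [exact: (traj_cont_xx hl)|exact: (jc_rev (traj_cont_xx hr))].
  + by apply: jcD; apply: jcM => //; [exact: (traj_cont_t hl)|exact: (jc_rev (traj_cont_t hr))].
- move=> t x hx; have x01 := uncontrolled01 hx; have y01 := rev01 x01.
  rewrite FexprE; case: (hx) => /andP[h1 h2].
    have [-> -> ->] := cutoff_left (ltW h2).
    rewrite subrr !mul0r !mul1r !addr0 !add0r subr0 mulr0 add0r.
    rewrite le // s0 // s1 // !subrr !mulr0 !addr0.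
    by rewrite addrK.
  have [-> -> ->] := cutoff_right (ltW h1).
  rewrite subr0 !mul0r !mul1r !add0r mulr0 add0r.
  rewrite re // (_ : 1 - (1 - x) = x); last by ring.
  rewrite !peval_rev -s0 // -s1 // !subrr !mulr0 !addr0.
  by rewrite -peval_rev opprK addrK.
- move=> t; split.
    have [-> _ _] := cutoff_left (ltW b_gt0).
    by rewrite l0 mulr0 subrr mul0r addr0.
  have [-> _ _] := cutoff_right (ltW c_lt1).
  by rewrite subrr r0 mulr0 mul0r addr0.
- move=> t x t0 hx; rewrite li // ri ?rev01 // (_ : 1 - (1 - x) = x); ring.
- move=> t x; rewrite ge_max => /andP[t1 t2] hx.
  rewrite lf // rf ?rev01 // (_ : 1 - (1 - x) = x); ring.
Qed.

(** The distance in [reach_close] is uniform over data bounded by [D]; being within 1 of [W0]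
    provides such a bound. Both directions are recorded because [path_reach] arrives at the supremum
    by one and leaves it by the other. *)
Lemma reach_local W0 P0 S0 : steady_data W0 P0 S0 -> exists2 eta : R, 0 < eta &
  forall W1 P1 S1, steady_data W1 P1 S1 ->
  (forall x, 0 <= x <= 1 -> `|W1 x - W0 x| <= eta /\ `|P1 x - P0 x| <= eta) ->
  reach W0 W1 /\ reach W1 W0.
Proof.
move=> s0; have [[d1 d2 _] _ _ _] := s0.
have bounded (f : R -> R) : continuous f -> exists M : R, forall x, 0 <= x <= 1 -> `|f x| <= M.
  move=> cf; have [M hM] := @jc_bounded R (fun _ y => f y) 0 0 (jc_space (cont_clamp cf)).
  by exists M => y hy; apply: (hM 0); rewrite ?lexx.
have [M1 h1] := bounded _ (der_continuous d1).
have [M2 h2] := bounded _ (der_continuous d2).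
have [eta e0 H] := reach_close (Num.max M1 M2 + 1).
exists (Num.min eta 1); first by rewrite lt_min e0 ltr01.
move=> W1 P1 S1 s1 hE.
have hb x : 0 <= x <= 1 -> [/\ `|W0 x| <= Num.max M1 M2 + 1, `|P0 x| <= Num.max M1 M2 + 1,
    `|W1 x| <= Num.max M1 M2 + 1 & `|P1 x| <= Num.max M1 M2 + 1].
  move=> hx; have [k1 k2] := hE x hx.
  have l1 := h1 x hx; have l2 := h2 x hx.
  have m1 : M1 <= Num.max M1 M2 by rewrite le_max lexx.
  have m2 : M2 <= Num.max M1 M2 by rewrite le_max lexx orbT.
  have m3 : Num.min eta 1 <= 1 by rewrite ge_min lexx orbT.
  have n1 := ler_normD (W1 x - W0 x) (W0 x); have n2 := ler_normD (P1 x - P0 x) (P0 x).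
  by rewrite !subrK in n1 n2; split; lra.
have e1 : Num.min eta 1 <= eta by rewrite ge_min lexx.
split.
  apply: (H _ _ _ _ _ _ s0 s1 hb) => x /hE [k1 k2].
  by split; [exact: le_trans k1 e1|exact: le_trans k2 e1].
apply: (H _ _ _ _ _ _ s1 s0) => x; first by move=> /hb [].
move=> /hE [k1 k2]; rewrite distrC [`|P0 x - _|]distrC.
by split; [exact: le_trans k1 e1|exact: le_trans k2 e1].
Qed.

(** The supremum of the parameters reached is itself reached, from a parameter just below it; were
    it less than 1, one more local move would pass it. *)
Lemma path_reach u0 u1 : steady_path_connected alpha beta gamma delta b c u0 u1 -> reach u0 u1.
Proof.
case=> p [ps pc p0 p1].
have steady s : 0 <= s <= 1 -> exists W P S, steady_data W P S /\ forall x, 0 <= x <= 1 -> W x = p s x.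
  by move=> hs; apply: steady_dataP; apply: ps; rewrite in_itv.
have local s : 0 <= s <= 1 -> exists2 d : R, 0 < d & forall s', 0 <= s' <= 1 -> `|s' - s| < d ->
    reach (p s) (p s') /\ reach (p s') (p s).
  move=> hs; have [W [P [S [sW eW]]]] := steady s hs.
  have [eta eta0 H] := reach_local sW.
  have hs' : s \in `[0, 1] by rewrite in_itv.
  have /cvgrPdist_le /(_ _ eta0) [d /= d0 hd] := pc s hs'.
  exists d => // s' hs1 sd; have [W' [P' [S' [sW' eW']]]] := steady s' hs1.
  have [cW _ _ _] := sW; have [cW' _ _ _] := sW'.
  have hn : C2norm (fun x => p s' x - p s x) <= eta.
    have := hd s'; rewrite /ball /= distrC => /(_ sd); rewrite in_itv /= => /(_ hs1).
    by rewrite sub0r normrN; apply: le_trans; exact: ler_norm.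
  have [x hx|r1 r2] := H W' P' S' sW'.
    have [k1 k2] := C2norm_sub_ge cW cW' eW eW' hx.
    by split; exact: le_trans hn.
  by split; [exact: (reach_ext eW eW' r1)|exact: (reach_ext eW' eW r2)].
have r01 : reach u0 (p 0).
  have s0 : 0 <= (0 : R) <= 1 by rewrite lexx ler01.
  have [W [P [S [sW eW]]]] := steady 0 s0.
  have h0 x : 0 <= x <= 1 -> p 0 x = u0 x by move=> hx; apply: p0; rewrite in_itv.
  exact: (reach_ext h0 (fun _ _ => erefl) (reach_refl sW eW)).
suff H : reach u0 (p 1).
  by apply: (reach_ext _ _ H) => // x hx; apply: p1; rewrite in_itv.
pose A := [set s : R | 0 <= s <= 1 /\ reach u0 (p s)].
have A0 : A 0 by split; rewrite ?lexx ?ler01.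
have hsA : has_sup A by split; [exists 0|exists 1 => s [/andP[_ s1] _]].
have m0 : 0 <= sup A by apply: ub_le_sup => //; case: hsA.
have m1 : sup A <= 1 by apply: ge_sup; [exists 0|move=> s [/andP[_ s1] _]].
have m01 : 0 <= sup A <= 1 by rewrite m0.
have [d d0 hd] := local _ m01.
have rm : reach u0 (p (sup A)).
  have [s [s01 rs] sd] := sup_adherent d0 hsA.
  have sA : s <= sup A by apply: ub_le_sup; [case: hsA|split].
  have [|r1 r2] := hd s s01; first by rewrite ler0_norm ?subr_le0 //; lra.
  exact: reach_trans rs r2.
have [<-//|m2] := eqVneq (sup A) 1.
have m3 : sup A < 1 by rewrite lt_neqAle m2.
pose s := Num.min 1 (sup A + d / 2).
have s01 : 0 <= s <= 1.
  by rewrite /s le_min ler01 ge_min lexx /= andbT addr_ge0 // divr_ge0 // ltW.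
have ms : sup A < s by rewrite /s lt_min m3 ltrDl divr_gt0.
have sd : s <= sup A + d / 2 by rewrite /s ge_min lexx orbT.
have [|r1 r2] := hd s s01; first by rewrite ger0_norm ?subr_ge0 ?(ltW ms) //; lra.
have : s <= sup A by apply: ub_le_sup; [case: hsA|split => //; exact: reach_trans rm r1].
by rewrite leNgt ms.
Qed.

End Reach.

(** * Square integrable functions *)

Section AlmostEverywhere.
Context {R : realType}.
Local Notation mu := (@lebesgue_measure R).
Implicit Types (P Q S V : R -> Prop).

Lemma ae_imp P Q : {ae mu, forall x, P x} -> (forall x, P x -> Q x) -> {ae mu, forall x, Q x}.
Proof. by move=> hP h; exact: (@filterS _ _ (ae_filter_ringOfSetsType mu) _ _ h hP). Qed.

Lemma ae_imp2 P Q S : {ae mu, forall x, P x} -> {ae mu, forall x, Q x} ->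
  (forall x, P x -> Q x -> S x) -> {ae mu, forall x, S x}.
Proof. by move=> hP hQ h; exact: (@filterS2 _ _ (ae_filter_ringOfSetsType mu) _ _ _ h hP hQ). Qed.

Lemma ae_imp3 P Q S V : {ae mu, forall x, P x} -> {ae mu, forall x, Q x} -> {ae mu, forall x, S x} ->
  (forall x, P x -> Q x -> S x -> V x) -> {ae mu, forall x, V x}.
Proof. by move=> hP hQ hS h; exact: (@filterS3 _ _ (ae_filter_ringOfSetsType mu) _ _ _ _ h hP hQ hS). Qed.

Lemma ae_and P Q : {ae mu, forall x, P x} -> {ae mu, forall x, Q x} -> {ae mu, forall x, P x /\ Q x}.
Proof. by move=> hP hQ; apply: (ae_imp2 hP hQ). Qed.

Lemma ae_neq (a : R) : {ae mu, forall x : R, x != a}.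
Proof.
exists [set a]; split; [exact: measurable_set1|exact: lebesgue_measure_set1|].
by move=> x /= /negP; rewrite negbK => /eqP.
Qed.

End AlmostEverywhere.

Section SquareIntegrable.
Context {d} {T : measurableType d} {R : realType}.
Variables (m : {measure set T -> \bar R}) (D : set T).
Hypothesis mD : measurable D.
Implicit Types (f g h : T -> R).

Local Notation sqi := (square_integrable m D).
Local Notation itg f := (m.-integrable D (EFin \o f)).

Lemma itg_eq f g : (forall x, D x -> f x = g x) -> itg f -> itg g.
Proof.
by move=> fg; apply: eq_integrable => // x /set_mem Dx; rewrite /= fg.
Qed.

Lemma itgD f g : itg f -> itg g -> itg (fun x => f x + g x).
Proof. by move=> hf hg; exact: (integrableD mD hf hg). Qed.

Lemma itgB f g : itg f -> itg g -> itg (fun x => f x - g x).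
Proof. by move=> hf hg; exact: (integrableB mD hf hg). Qed.

Lemma itgZ (c : R) f : itg f -> itg (fun x => c * f x).
Proof. by move=> hf; exact: (integrableZl mD c hf). Qed.

Lemma itg_le f g : measurable_fun D f -> (forall x, D x -> `|f x| <= g x) -> itg g -> itg f.
Proof.
move=> mf fg; apply: le_integrable => //; first exact/measurable_EFinP.
by move=> x Dx /=; rewrite lee_fin; apply: le_trans (fg x Dx) (ler_norm _).
Qed.

Lemma itg_mul f g : sqi f -> sqi g -> itg (fun x => f x * g x).
Proof.
move=> [mf f2] [mg g2]; apply: (@itg_le _ (fun x => f x ^+ 2 + g x ^+ 2)).
- exact: measurable_funM.
- move=> x _; rewrite normrM; have := sqr_ge0 (`|f x| - `|g x|).
  rewrite -[f x ^+ 2]real_normK ?num_real // -[g x ^+ 2]real_normK ?num_real // sqrrB.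
  have := mulr_ge0 (normr_ge0 (f x)) (normr_ge0 (g x)).
  by move: (`|f x|) (`|g x|) => p q; rewrite -mulr_natr; lra.
- exact: itgD.
Qed.

Lemma sqi_le f g : measurable_fun D f -> (forall x, D x -> `|f x| <= g x) -> sqi g -> sqi f.
Proof.
move=> mf fg [mg g2]; split => //.
apply: (@itg_le (fun x => f x ^+ 2) (fun x => g x ^+ 2)) => //; first exact: measurable_funX.
move=> x Dx; rewrite normrX lerXn2r ?nnegrE // ?fg //.
exact: le_trans (normr_ge0 _) (fg x Dx).
Qed.

Lemma sqiZ (c : R) f : sqi f -> sqi (fun x => c * f x).
Proof.
move=> [mf f2]; split; first exact: measurable_funM.
by apply: (itg_eq _ (itgZ (c ^+ 2) f2)) => x _ /=; rewrite exprMn.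
Qed.

Lemma sqiD f g : sqi f -> sqi g -> sqi (fun x => f x + g x).
Proof.
move=> hf hg; split; first by apply: measurable_funD; [exact: hf.1|exact: hg.1].
apply: (itg_eq _ (itgD (itgD hf.2 (itgZ 2 (itg_mul hf hg))) hg.2)) => x _ /=.
by rewrite sqrrD mulr_natl.
Qed.

Lemma sqiB f g : sqi f -> sqi g -> sqi (fun x => f x - g x).
Proof.
move=> hf hg; split; first by apply: measurable_funB; [exact: hf.1|exact: hg.1].
apply: (itg_eq _ (itgD (itgB hf.2 (itgZ 2 (itg_mul hf hg))) hg.2)) => x _ /=.
by rewrite sqrrB mulr_natl.
Qed.

Lemma sqi_bounded (M : R) f h : measurable_fun D h -> (forall x, D x -> `|h x| <= M) -> sqi f ->
  sqi (fun x => h x * f x).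
Proof.
move=> mh hM hf; have := sqiZ M hf; move: hf => [mf f2] [mg g2].
split; first exact: measurable_funM.
apply: itg_le g2; first by apply: measurable_funX; exact: measurable_funM.
move=> x Dx; rewrite !exprMn normrM !normrX ler_pM ?exprn_ge0 //; last by rewrite real_normK ?num_real.
have := hM x Dx; have := normr_ge0 (h x) => h0 h1.
by rewrite lerXn2r ?nnegrE // (le_trans h0).
Qed.

Definition inner f g := \int[m]_(x in D) (f x * g x).
Definition norm2 f := Num.sqrt (\int[m]_(x in D) (f x ^+ 2)).

Lemma norm2_ge0 f : 0 <= norm2 f. Proof. exact: sqrtr_ge0. Qed.

Lemma norm2_sqr f : norm2 f ^+ 2 = inner f f.
Proof.
rewrite /norm2 sqr_sqrtr //; apply: Rintegral_ge0 => x _; exact: sqr_ge0.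
Qed.

Lemma innerC f g : inner f g = inner g f.
Proof. by apply: eq_Rintegral => x _; rewrite mulrC. Qed.

Lemma innerDl f g h : sqi f -> sqi g -> sqi h -> inner (fun x => f x + g x) h = inner f h + inner g h.
Proof.
move=> hf hg hh; rewrite /inner -RintegralD //; [|exact: itg_mul|exact: itg_mul].
by apply: eq_Rintegral => x _; rewrite mulrDl.
Qed.

Lemma innerBl f g h : sqi f -> sqi g -> sqi h -> inner (fun x => f x - g x) h = inner f h - inner g h.
Proof.
move=> hf hg hh; rewrite /inner -RintegralB //; [|exact: itg_mul|exact: itg_mul].
by apply: eq_Rintegral => x _; rewrite mulrBl.
Qed.

Lemma innerZl (c : R) f g : sqi f -> sqi g -> inner (fun x => c * f x) g = c * inner f g.
Proof.
move=> hf hg; rewrite /inner -RintegralZl //; last exact: itg_mul.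
by apply: eq_Rintegral => x _; rewrite mulrA.
Qed.

Lemma inner_ge0 f : 0 <= inner f f.
Proof. by rewrite -norm2_sqr sqr_ge0. Qed.

(** The polynomial [Q] in [l] is nonnegative. If [inner g g] is positive, its minimum gives the
    inequality; otherwise [Q] is affine in [l], and a nonzero slope would let it take the value
    -1. *)
Lemma cauchy_schwarz f g : sqi f -> sqi g -> `|inner f g| <= norm2 f * norm2 g.
Proof.
move=> hf hg.
have Q (l : R) : 0 <= inner f f - 2 * l * inner f g + l ^+ 2 * inner g g.
  have := inner_ge0 (fun x => f x - l * g x).
  have hlg := sqiZ l hg; rewrite innerBl //; last exact: sqiB.
  rewrite innerC innerBl // [inner (fun x => l * g x) (fun x => f x - l * g x)]innerC innerBl //.
  rewrite [inner f (fun x => l * _)]innerC !innerZl // (innerC g f).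
  by rewrite [inner g (fun x => l * _)]innerC innerZl //; lra.
rewrite -(@ler_pXn2r _ 2) ?nnegrE ?mulr_ge0 ?norm2_ge0 // exprMn !norm2_sqr real_normK ?num_real //.
have [g0|g0] := leP (inner g g) 0.
  have gg : inner g g = 0 by apply/eqP; rewrite eq_le g0 inner_ge0.
  rewrite gg mulr0; have [->|fg] := eqVneq (inner f g) 0; first by rewrite expr0n.
  have := Q ((inner f f + 1) / (2 * inner f g)); rewrite gg mulr0 addr0.
  rewrite (_ : 2 * _ * _ = inner f f + 1); first by lra.
  by field.
have := Q (inner f g / inner g g).
rewrite (_ : _ + _ = inner f f - inner f g ^+ 2 / inner g g); last by field; rewrite gt_eqF.
by rewrite subr_ge0 ler_pdivrMr.
Qed.

Lemma norm2D f g : sqi f -> sqi g -> norm2 (fun x => f x + g x) <= norm2 f + norm2 g.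
Proof.
move=> hf hg; rewrite -(@ler_pXn2r _ 2) ?nnegrE ?addr_ge0 ?norm2_ge0 //.
pose s x := f x + g x; have hs : sqi s := sqiD hf hg.
have E h : sqi h -> inner s h = inner f h + inner g h by move=> hh; exact: innerDl.
rewrite norm2_sqr -/s E // (innerC f) (innerC g) !E //.
rewrite (innerC g f) sqrrD !norm2_sqr -mulr_natr.
by have := cauchy_schwarz hf hg; have := ler_norm (inner f g); lra.
Qed.

Lemma norm2_eq f g : (forall x, D x -> f x = g x) -> norm2 f = norm2 g.
Proof.
by move=> fg; congr Num.sqrt; apply: eq_Rintegral => x /set_mem Dx; rewrite fg.
Qed.

Lemma norm2N f : norm2 (fun x => - f x) = norm2 f.
Proof. by congr Num.sqrt; apply: eq_Rintegral => x _; rewrite sqrrN. Qed.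

Lemma norm2B f g : sqi f -> sqi g -> norm2 f - norm2 g <= norm2 (fun x => f x - g x).
Proof.
move=> hf hg; rewrite lerBlDr; apply: le_trans (norm2D (sqiB hf hg) hg).
by rewrite le_eqVlt; apply/orP; left; apply/eqP/norm2_eq => x _; rewrite subrK.
Qed.

Lemma Rintegral_ae f g : itg f -> itg g -> {ae m, forall x, D x -> f x = g x} ->
  \int[m]_(x in D) f x = \int[m]_(x in D) g x.
Proof.
move=> hf hg fg; congr fine; apply: ae_eq_integral => //.
- exact: (measurable_int _ hf).
- exact: (measurable_int _ hg).
- by apply: filterS fg => x h Dx; rewrite h.
Qed.

Lemma le_Rintegral_ae f g : itg f -> itg g -> {ae m, forall x, D x -> f x <= g x} ->
  \int[m]_(x in D) f x <= \int[m]_(x in D) g x.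
Proof.
move=> hf hg fg.
have mf : measurable_fun D f by apply/measurable_EFinP; exact: (measurable_int _ hf).
have mg : measurable_fun D g by apply/measurable_EFinP; exact: (measurable_int _ hg).
(* The minimum of [f] and [g] is equal to [f] almost everywhere and below [g] everywhere. *)
have hm : itg (fun x => Num.min (f x) (g x)).
  apply: (@itg_le _ (fun x => `|f x| + `|g x|)).
  - exact: measurable_minr.
  - move=> x _; rewrite /Num.min; case: ifP => _; [rewrite lerDl|rewrite lerDr]; exact: normr_ge0.
  - by apply: itgD; exact: integrable_norm.
rewrite (@Rintegral_ae f _ hf hm); last first.
  by apply: filterS fg => x h Dx; rewrite min_l // h.
by apply: le_Rintegral => // x _; rewrite ge_min lexx orbT.
Qed.

Lemma norm2_ae0 f : sqi f -> {ae m, forall x, D x -> f x = 0} -> norm2 f = 0.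
Proof.
move=> hf f0; rewrite /norm2 (@Rintegral_ae _ (fun=> 0) hf.2).
- by rewrite Rintegral_cst // mul0r sqrtr0.
- have := itgZ 0 hf.2; apply: itg_eq => x _ /=; exact: mul0r.
- by apply: filterS f0 => x h Dx; rewrite h // expr0n.
Qed.

End SquareIntegrable.

(** * Weak derivatives of classical functions *)

Section ContinuousL2.
Context {R : realType}.
Local Notation mu := (@lebesgue_measure R).
Implicit Types (f g h v phi : R -> R) (a b x y : R).

Lemma der_derive1 f x (l : R) : der f x l -> derive1 f x = l.
Proof. by case=> _; rewrite derive1E. Qed.

Lemma oo_lty a b : (mu `]a, b[ < +oo)%E.
Proof. by rewrite lebesgue_measure_itv /=; case: ifP => _; rewrite ?ltry // -EFinD ltry. Qed.

Lemma cont_integrable_oo f a b : continuous f -> mu.-integrable `]a, b[ (EFin \o f).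
Proof.
move=> cf; apply: (@integrableS _ _ _ mu `[a, b]) => //.
- by move=> x; rewrite /= !in_itv /= => /andP[ax xb]; rewrite !ltW.
- exact: cont_integrable.
Qed.

Lemma int_prim f a b : continuous f -> a < b ->
  \int[mu]_(x in `]a, b[) f x = prim f b - prim f a.
Proof.
move=> cf ab.
have i1 : mu.-integrable `]a, b[ (EFin \o f) by exact: cont_integrable_oo.
have i2 : mu.-integrable `[a, b[ (EFin \o f).
  apply: (@integrableS _ _ _ mu `[a, b]) => //; last exact: cont_integrable.
  by move=> x; rewrite /= !in_itv /= => /andP[ax xb]; rewrite ax ltW.
rewrite Rintegral_itv_obnd_cbnd // Rintegral_itv_bndo_bndc //.
have cp x : {for x, continuous (prim f)} := der_cont (prim_der x cf).
rewrite /Rintegral (@continuous_FTC2 R f (prim f) a b) //.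
- exact: continuous_subspaceT.
- split.
  + by move=> x _; have [] := prim_der x cf.
  + by apply: cvg_at_right_filter; exact: cp.
  + by apply: cvg_at_left_filter; exact: cp.
- by move=> x _; exact: der_derive1 (prim_der x cf).
Qed.

Lemma Rint_eq f g a b : (forall x, a < x < b -> f x = g x) ->
  \int[mu]_(x in `]a, b[) f x = \int[mu]_(x in `]a, b[) g x.
Proof. by move=> fg; apply: eq_Rintegral => x /set_mem /=; rewrite in_itv /= => /fg. Qed.

Lemma sqi_cont f g a b : continuous g -> (forall x, a < x < b -> f x = g x) -> L2_interval a b f.
Proof.
move=> cg fg; split.
  apply: (@eq_measurable_fun _ _ _ _ _ g).
    by move=> x /set_mem /=; rewrite in_itv /= => /fg ->.
  by apply: measurable_funTS; exact: continuous_measurable_fun.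
have h : mu.-integrable `]a, b[ (EFin \o (fun x => g x ^+ 2)).
  by apply: cont_integrable_oo => x; apply: cvgM; exact: cg.
by apply: eq_integrable h => // x /set_mem /=; rewrite in_itv /= => /fg ->.
Qed.

Lemma test_function_cont a b phi : test_function a b phi -> continuous phi.
Proof. by case=> h _ _ x; apply: (der_cont (l := 'D_1 phi x)); exact: (DeriveDef (h x)). Qed.

(** The functions [w] and [g] are continuous on the line and replace [v] and [dv] on [[a, b]], so
    that both integrals become increments of [prim]; the sum of the two primitives minus [v * phi]
    has zero derivative. *)
Lemma weak_ibp a b v dv w g : a < b -> continuous w -> continuous g ->
  (forall x, a <= x <= b -> v x = w x) -> (forall x, a <= x <= b -> dv x = g x) ->
  (forall x, a <= x <= b -> der v x (dv x)) -> weak_derivative a b v dv.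
Proof.
move=> ab cw cg vw dvg dv_der phi tphi; have cphi := test_function_cont tphi.
case: tphi => dphi c1phi [a' [b' [aa bb supp]]].
have phia : phi a = 0 by apply: supp; rewrite in_itv /= negb_and -!ltNge aa.
have phib : phi b = 0 by apply: supp; rewrite in_itv /= negb_and -!ltNge bb orbT.
have phider x : der phi x (derive1 phi x) by apply: DeriveDef; rewrite ?derive1E.
rewrite (@Rint_eq (fun x => v x * derive1 phi x) (fun x => w x * derive1 phi x)); last first.
  by move=> x /andP[ax xb]; rewrite vw // !ltW.
rewrite (@Rint_eq (fun x => dv x * phi x) (fun x => g x * phi x)); last first.
  by move=> x /andP[ax xb]; rewrite dvg // !ltW.
have c1 : continuous (fun x => w x * derive1 phi x) by move=> x; apply: cvgM; [exact: cw|exact: c1phi].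
have c2 : continuous (fun x => g x * phi x) by move=> x; apply: cvgM; [exact: cg|exact: cphi].
rewrite !int_prim //.
have := @der_const_seg R (fun x => prim (fun x => w x * derive1 phi x) x + prim (fun x => g x * phi x) x - v x * phi x)
   (fun x => w x * derive1 phi x + g x * phi x - (dv x * phi x + v x * derive1 phi x)) a b (ltW ab).
rewrite phia phib !mulr0 !subr0 => H.
have {H} : prim (fun x => w x * derive1 phi x) a + prim (fun x => g x * phi x) a =
  prim (fun x => w x * derive1 phi x) b + prim (fun x => g x * phi x) b.
  apply: H => x hx; last by rewrite vw // dvg //; ring.
  by apply: derB; [apply: derD; exact: prim_der|exact: (derM (dv_der x hx) (phider x))].
by lra.
Qed.

(** An open subset of the plane is a countable union of squares with rational centres and radii, and
    these are measurable rectangles. *)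
Lemma cont2_measurable (h : R * R -> R) : continuous h -> measurable_fun setT h.
Proof.
move=> /continuousP ch; apply: (measurability _ (RGenOInfty.measurableE R)).
move=> _ [_ [a ->] <-]; rewrite setTI.
have oO : open (h @^-1` `]a, +oo[) by apply: ch; exact: interval_open.
set O := _ @^-1` _ in oO *.
pose F (q : rat * rat * rat) : set (R * R) :=
  if `[< ball (ratr q.1.1 : R) (ratr q.2) `*` ball (ratr q.1.2 : R) (ratr q.2) `<=` O >]
  then ball (ratr q.1.1 : R) (ratr q.2) `*` ball (ratr q.1.2 : R) (ratr q.2) else set0.
have mF q : measurable (F q).
  rewrite /F; case: asboolP => _ //; apply: measurableX; exact: measurable_ball.
suff -> : O = \bigcup_q F q by exact: countable_bigcupT_measurable.
apply/seteqP; split => [[x y] Oxy|[x y] [q _]]; last first.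
  by rewrite /F; case: asboolP => // sub; exact: sub.
have [[A B] /= [[e1 /= e10 hA] [e2 /= e20 hB]] hAB] : nbhs (x, y) O by exact: open_nbhs_nbhs.
pose e := Num.min e1 e2.
have e0 : 0 < e by rewrite lt_min e10.
have [r] : exists q : rat, ratr q \in `](0 : R), (e / 2)[ by apply: rat_in_itvoo; rewrite divr_gt0.
rewrite in_itv /= => /andP[r0 re].
have pick (z : R) : exists q : rat, `|ratr q - z| < ratr r.
  have [q] : exists q : rat, ratr q \in `](z - ratr r), (z + ratr r)[ by apply: rat_in_itvoo; lra.
  by rewrite in_itv /= => /andP[h1 h2]; exists q; rewrite ltr_norml; apply/andP; split; lra.
have [p hp] := pick x; have [q hq] := pick y.
exists (p, q, r) => //; rewrite /F /=; case: asboolP => [_|].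
  by split; rewrite /= /ball /=.
case=> -[u w] [/= hu hw]; apply: hAB; split => /=.
  apply: hA => /=; move: hu; rewrite /ball /= => hu.
  have := ler_normD (x - ratr p) (ratr p - u); rewrite addrA subrK distrC in hp *.
  have em : e <= e1 by rewrite /e ge_min lexx.
  by move: hp; rewrite distrC; lra.
apply: hB => /=; move: hw; rewrite /ball /= => hw.
have := ler_normD (y - ratr q) (ratr q - w); rewrite addrA subrK distrC in hq *.
have em : e <= e2 by rewrite /e ge_min lexx orbT.
by move: hq; rewrite distrC; lra.
Qed.

Lemma jc_L2_cylinder (T : R) (g : R -> R -> R) : jc g -> L2_cylinder T g.
Proof.
move=> cg; pose D : set (R * R) := `]0, T[ `*` `]0, 1[.
have mD : measurable D by apply: measurableX; exact: measurable_itv.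
have [M hM] := @jc_bounded R g 0 T cg.
have mg : measurable_fun D (fun p : R * R => g p.1 p.2).
  apply: (@eq_measurable_fun _ _ _ _ _ (fun p => g p.1 (clamp p.2))).
    move=> [t x] /set_mem [_ /=]; rewrite in_itv /= => /andP[x0 x1].
    by rewrite clamp_id // !ltW.
  by apply: measurable_funTS; exact: cont2_measurable.
split; first exact: mg.
have mfin : ((mu \x mu) D < +oo)%E.
  rewrite product_measure1E //; try exact: measurable_itv.
  by rewrite lte_mul_pinfty ?ge0_fin_numE //; exact: oo_lty.
apply: (@measurable_bounded_integrable _ _ R (mu \x mu)%E (fun p => g p.1 p.2 ^+ 2) D mD mfin).
  exact: measurable_funX.
exists (M ^+ 2); split; first exact: num_real.
move=> N MN [t x] [/=]; rewrite !in_itv /= => /andP[t0 tT] /andP[x0 x1].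
apply: le_trans (ltW MN); rewrite normrX.
have h1 : `|g t x| <= M by apply: hM; rewrite !ltW.
by rewrite lerXn2r ?nnegrE // (le_trans (normr_ge0 _) h1).
Qed.

End ContinuousL2.

(** * Classical functions in [H^1] and [H^1_0] *)

Section SobolevC1.
Context {R : realType}.
Local Notation mu := (@lebesgue_measure R).

Lemma L2norm_le (f g : R -> R) (M : R) : continuous g -> (forall x, 0 < x < 1 -> f x = g x) ->
  0 <= M -> (forall x, 0 <= x <= 1 -> `|g x| <= M) -> L2norm f <= M.
Proof.
move=> cg fg M0 hM.
rewrite /L2norm -[leRHS](ger0_norm M0) -sqrtr_sqr ler_sqrt ?sqr_ge0 //.
rewrite (@Rint_eq R _ (fun x => g x ^+ 2)); last by move=> x /fg ->.
have c2 : continuous (fun x => g x ^+ 2) by move=> x; apply: cvgM; exact: cg.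
rewrite int_prim // prim0 subr0.
apply: le_trans (ler_norm _) _; rewrite -[leRHS]mulr1.
apply: prim_bound => // y hy; rewrite normrX lerXn2r ?nnegrE //; exact: hM.
Qed.

Lemma H1_C1 (v dv w g : R -> R) : continuous w -> continuous g ->
  (forall x, 0 <= x <= 1 -> v x = w x) -> (forall x, 0 <= x <= 1 -> dv x = g x) ->
  (forall x : R, 0 <= x <= 1 -> der v x (dv x)) -> H1 v dv.
Proof.
move=> cw cg vw dg d; split.
- by apply: (sqi_cont cw) => x /andP[x0 x1]; rewrite vw // !ltW.
- by apply: (sqi_cont cg) => x /andP[x0 x1]; rewrite dg // !ltW.
- exact: (weak_ibp ltr01 cw cg).
Qed.

Lemma H1norm_le (v dv : R -> R) (M : R) : 0 <= M -> L2norm v <= M -> L2norm dv <= M -> H1norm v dv <= 2 * M.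
Proof.
move=> M0 h1 h2; rewrite /H1norm.
have h3 : 0 <= L2norm v := sqrtr_ge0 _; have h4 : 0 <= L2norm dv := sqrtr_ge0 _.
rewrite -[leRHS](ger0_norm (mulr_ge0 (ler0n R 2) M0)) -sqrtr_sqr ler_sqrt ?sqr_ge0 //.
have : L2norm v ^+ 2 <= M ^+ 2 by rewrite lerXn2r ?nnegrE.
have : L2norm dv ^+ 2 <= M ^+ 2 by rewrite lerXn2r ?nnegrE.
by rewrite exprMn; have := sqr_ge0 M; rewrite (_ : 2 ^+ 2 = 4 :> R); [lra|ring].
Qed.

(* The layers of width [2 eta] at both ends carry all of the error [q]. *)
Lemma layer_bound (q : R -> R) (K eta : R) : continuous q -> 0 < eta -> eta <= 1 / 4 -> 0 <= K ->
  (forall x, 0 <= x <= 1 -> `|q x| <= K) -> (forall x, 2 * eta <= x <= 1 - 2 * eta -> q x = 0) ->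
  \int[mu]_(x in `]0, 1[) q x <= 4 * K * eta.
Proof.
move=> cq eta0 eta4 K0 hK hz; rewrite int_prim // prim0 subr0.
have dq x := prim_der x cq.
have z : prim q (2 * eta) = prim q (1 - 2 * eta).
  by apply: (der_const_seg (df := q)) => //; lra.
have b1 : `|prim q (2 * eta) - prim q 0| <= K * `|2 * eta - 0|.
  apply: (@der_bound R _ q) => // x.
  by rewrite min_l ?max_r; try lra; move=> /andP[x0 x1]; apply: hK; apply/andP; split; lra.
have b2 : `|prim q 1 - prim q (1 - 2 * eta)| <= K * `|1 - (1 - 2 * eta)|.
  apply: (@der_bound R _ q) => // x.
  by rewrite min_l ?max_r; try lra; move=> /andP[x0 x1]; apply: hK; apply/andP; split; lra.
move: b1 b2; rewrite prim0 !subr0 -z (_ : 1 - (1 - 2 * eta) = 2 * eta); last by ring.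
rewrite (@ger0_norm _ (2 * eta)); last by lra.
have := ler_norm (prim q (2 * eta)); have := ler_norm (prim q 1 - prim q (2 * eta)); lra.
Qed.

(** The test function is [v] times a cutoff. The slope of the cutoff is of order [1 / eta], but [v]
    vanishes at the ends and is of order [eta] in the layers: the error is bounded there, and its
    square integral is of order [eta]. *)
Lemma H10_C1 (v dv w g : R -> R) : continuous w -> continuous g ->
  (forall x, 0 <= x <= 1 -> v x = w x) -> (forall x, 0 <= x <= 1 -> dv x = g x) ->
  (forall x : R, 0 <= x <= 1 -> der v x (dv x)) -> v 0 = 0 -> v 1 = 0 -> H10 v dv.
Proof.
move=> cw cg vw dg dv_der v0 v1; split; first exact: H1_C1 vw dg dv_der.
move=> e e0.
have [M0 hM0] : exists M : R, forall x, 0 <= x <= 1 -> `|g x| <= M.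
  have [M hM] := @jc_bounded R (fun _ y => g y) 0 0 (jc_space (cont_clamp cg)).
  by exists M => y hy; apply: (hM 0); rewrite ?lexx.
pose M := Num.max M0 0.
have M_ge0 : 0 <= M by rewrite le_max lexx orbT.
have hM x : 0 <= x <= 1 -> `|dv x| <= M by move=> hx; rewrite dg // le_max hM0.
have [A A0 hA] := @gstep_bound R.
pose B := A * 8.
have B0 : 0 < B by rewrite mulr_gt0.
have hB t : `|gstep 1 t| <= B by have := hA 1%N t; rewrite expr1 (_ : 1`! = 1)%N ?mulr1.
(* This bounds the squared errors pointwise: [M] comes from [(1 - chi) * dv], and [4 * M * B] from
   the product of [2 * B / eta], for [chi1], with [2 * M * eta], for [v] in the layers. *)
pose K := (M + 4 * M * B) ^+ 2.
have K0 : 0 <= K by rewrite sqr_ge0.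
(* The first bound keeps the layers disjoint; by the second, two squared errors of at most
   [4 * K * eta] add up to less than [e ^+ 2]. *)
pose eta := Num.min (1 / 8) (e ^+ 2 / (16 * (K + 1))).
have K1 : 0 < 16 * (K + 1) by rewrite mulr_gt0 // ltr_wpDl.
have eta0 : 0 < eta by rewrite lt_min !divr_gt0 // exprn_gt0.
have eta8 : eta <= 1 / 8 by rewrite ge_min lexx.
have etaK : 16 * (K + 1) * eta <= e ^+ 2 by rewrite mulrC -ler_pdivlMr // ge_min lexx orbT.
pose l x : R := (x - eta) / eta; pose r x : R := (1 - x - eta) / eta.
pose chi x := gstep 0 (l x) * gstep 0 (r x).
pose chi1 x := gstep 1 (l x) / eta * gstep 0 (r x) - gstep 0 (l x) * (gstep 1 (r x) / eta).
have en0 : eta != 0 by rewrite gt_eqF.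
have dl (x : R) : der l x eta^-1.
  by apply: der_ext (der_affine eta^-1 (-1) x) => y; rewrite /l; field.
have dr (x : R) : der r x (- eta^-1).
  by apply: der_ext (der_affine (- eta^-1) ((1 - eta) / eta) x) => y; rewrite /r; field.
have dchi (x : R) : der chi x (chi1 x).
  apply: der_eq (derM (der_comp (gstep_der 0 _) (dl x)) (der_comp (gstep_der 0 _) (dr x))) _.
  by rewrite /chi1; ring.
have cgs k : continuous (@gstep R k) by move=> x; exact: (der_cont (gstep_der k x)).
have cl k : continuous (fun x => gstep k (l x)).
  by move=> x; apply: (@continuous_comp _ _ _ l (gstep k)); [exact: (der_cont (dl x))|exact: cgs].
have cr k : continuous (fun x => gstep k (r x)).
  by move=> x; apply: (@continuous_comp _ _ _ r (gstep k)); [exact: (der_cont (dr x))|exact: cgs].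
have cchi : continuous chi by move=> x; apply: cvgM; [exact: cl|exact: cr].
have cchi1 : continuous chi1.
  move=> x; apply: cvgB; apply: cvgM; try exact: cl; try exact: cr.
    by apply: cvgM; [exact: cl|exact: cvg_cst].
  by apply: cvgM; [exact: cr|exact: cvg_cst].
have out x : x <= eta \/ 1 - eta <= x -> chi x = 0 /\ chi1 x = 0.
  case=> h.
    have hl : l x <= 0 by rewrite /l pmulr_lle0 ?invr_gt0 // subr_le0.
    by rewrite /chi /chi1 !(gstep_le0 _ hl) !mul0r subrr.
  have hr : r x <= 0 by rewrite /r pmulr_lle0 ?invr_gt0 //; lra.
  by rewrite /chi /chi1 !(gstep_le0 _ hr) !mul0r !mulr0 subrr.
have mid x : 2 * eta <= x <= 1 - 2 * eta -> chi x = 1 /\ chi1 x = 0.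
  move=> /andP[x1 x2].
  have hl : 1 <= l x by rewrite /l ler_pdivlMr // mul1r; lra.
  have hr : 1 <= r x by rewrite /r ler_pdivlMr // mul1r; lra.
  by rewrite /chi /chi1 !(gstep_ge1 _ hl) !(gstep_ge1 _ hr) /= !mul0r !mulr0 mulr1 subrr.
have chi01 x : 0 <= chi x <= 1.
  have /andP[p1 p2] := gstep01 (l x); have /andP[p3 p4] := gstep01 (r x).
  by rewrite /chi mulr_ge0 // mulr_ile1.
have hchi1 x : `|chi1 x| <= 2 * B / eta.
  have hh (s t : R) : `|gstep 1 s / eta * gstep 0 t| <= B / eta.
    rewrite normrM -[leRHS]mulr1; apply: ler_pM => //.
      by rewrite normrM normfV (gtr0_norm eta0) ler_wpM2r // invr_ge0 ltW.
    by have /andP[p1 p2] := gstep01 t; rewrite ger0_norm.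
  apply: le_trans (ler_normB _ _) _; have := hh (l x) (r x); have := hh (r x) (l x).
  by rewrite [in X in X <= _ -> _]mulrC (_ : 2 * B / eta = B / eta + B / eta); [lra|ring].
pose phi x := chi x * v x.
pose psi x := chi1 x * w (clamp x) + chi x * g (clamp x).
have cpsi : continuous psi.
  by move=> x; apply: cvgD; apply: cvgM; [exact: cchi1|exact: cont_clamp|exact: cchi|exact: cont_clamp].
have dphi (x : R) : der phi x (psi x).
  have [hx|hx] := boolP (0 <= x <= 1).
    by apply: der_eq (derM (dchi x) (dv_der x hx)) _; rewrite /psi clamp_id // vw // dg.
  have ox : x < 0 \/ 1 < x.
    by move: hx; rewrite negb_and -!ltNge => /orP[]; [left|right].
  have [c0 c1] : chi x = 0 /\ chi1 x = 0 by apply: out; case: ox => ?; [left|right]; lra.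
  rewrite /psi c0 c1 !mul0r addr0.
  apply: der_near (derC 0 x).
  case: ox => ox.
    exists (- x); first by rewrite /= oppr_gt0.
    move=> y; rewrite /ball /= => xy; rewrite /phi; have [->] : chi y = 0 /\ chi1 y = 0; last by rewrite mul0r.
    by apply: out; left; have := ler_norm (- (x - y)); rewrite normrN; lra.
  exists (x - 1); first by rewrite /= subr_gt0.
  move=> y; rewrite /ball /= => xy; rewrite /phi; have [->] : chi y = 0 /\ chi1 y = 0; last by rewrite mul0r.
  by apply: out; right; have := ler_norm (x - y); lra.
have d1phi : derive1 phi = psi by apply/funext => x; exact: der_derive1 (dphi x).
exists phi.
  split; first by move=> x; have [] := dphi x.
    by rewrite d1phi.
  exists eta, (1 - eta); split => //; first by rewrite gtrBl.
  move=> x; rewrite in_itv /= negb_and -!ltNge => hx.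
  have [c0 _] : chi x = 0 /\ chi1 x = 0; last by rewrite /phi c0 mul0r.
  by apply: out; case/orP: hx => /ltW; [left|right].
rewrite d1phi.
have vb x : 0 <= x <= 1 -> x <= 2 * eta \/ 1 - 2 * eta <= x -> `|v x| <= 2 * M * eta.
  move=> /andP[x0 x1] hx.
  have [xl|xr] : x <= 2 * eta \/ 1 - 2 * eta <= x by [].
    have := @der_bound R v dv M 0 x; rewrite min_l // max_r // v0 !subr0 (ger0_norm x0) => H.
    apply: le_trans (H _ _) _.
    - by move=> y /andP[y0 yx]; apply: dv_der; rewrite y0 (le_trans yx).
    - by move=> y /andP[y0 yx]; apply: hM; rewrite y0 (le_trans yx).
    by rewrite mulrAC [M * x]mulrC ler_wpM2r.
  have := @der_bound R v dv M 1 x; rewrite min_r // max_l // v1 subr0 distrC (ger0_norm (_ : 0 <= 1 - x)) ?subr_ge0 // => H.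
  apply: le_trans (H _ _) _.
  - by move=> y /andP[y0 yx]; apply: dv_der; rewrite yx (le_trans x0).
  - by move=> y /andP[y0 yx]; apply: hM; rewrite yx (le_trans x0).
  by rewrite mulrAC [M * _]mulrC ler_wpM2r //; lra.
pose q1 x := ((1 - chi x) * w (clamp x)) ^+ 2.
pose q2 x := ((1 - chi x) * g (clamp x) - chi1 x * w (clamp x)) ^+ 2.
have cm : continuous (fun x => 1 - chi x) by move=> x; apply: cvgB; [exact: cvg_cst|exact: cchi].
have cq1' : continuous (fun x => (1 - chi x) * w (clamp x)).
  by move=> x; apply: cvgM; [exact: cm|exact: cont_clamp].
have cq1 : continuous q1 by move=> x; apply: cvgM; exact: cq1'.
have cq2' : continuous (fun x => (1 - chi x) * g (clamp x) - chi1 x * w (clamp x)).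
  by move=> x; apply: cvgB; apply: cvgM; [exact: cm|exact: cont_clamp|exact: cchi1|exact: cont_clamp].
have cq2 : continuous q2 by move=> x; apply: cvgM; exact: cq2'.
have sq_le (z Z : R) : `|z| <= M + 4 * M * B -> `|z ^+ 2| <= K.
  by move=> hz; rewrite normrX lerXn2r ?nnegrE // (le_trans (normr_ge0 _) hz).
have split3 x : 0 <= x <= 1 -> (2 * eta <= x <= 1 - 2 * eta) \/ (x <= 2 * eta \/ 1 - 2 * eta <= x).
  move=> _; have [h1|h1] := leP (2 * eta) x; have [h2|h2] := leP x (1 - 2 * eta).
  - by left.
  - by right; right; exact: ltW.
  - by right; left; exact: ltW.
  - by right; left; exact: ltW.
have MB0 : 0 <= 4 * M * B by rewrite !mulr_ge0 // ltW.
have one_chi x : `|1 - chi x| <= 1.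
  by have /andP[p1 p2] := chi01 x; rewrite ger0_norm ?subr_ge0 // gerBl.
have b1 x : 0 <= x <= 1 -> `|q1 x| <= K.
  move=> hx; apply: sq_le => //; rewrite clamp_id // -vw //.
  case: (split3 x hx) => [/mid [-> _]|h]; first by rewrite subrr mul0r normr0 addr_ge0.
  have := vb x hx h; have := one_chi x; have := normr_ge0 (v x); have := normr_ge0 (1 - chi x).
  rewrite normrM => p1 p2 p3 p4.
  have p5 : 2 * M * eta <= M by nra.
  by apply: le_trans (ler_pM p1 p2 p3 p4) _; rewrite mul1r; lra.
have b2 x : 0 <= x <= 1 -> `|q2 x| <= K.
  move=> hx; apply: sq_le => //; rewrite clamp_id // -vw // -dg //.
  case: (split3 x hx) => [/mid [-> ->]|h]; first by rewrite subrr !mul0r subrr normr0 addr_ge0.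
  apply: le_trans (ler_normB _ _) _; apply: lerD.
    by rewrite normrM -[leRHS]mul1r ler_pM // hM.
  rewrite normrM; apply: le_trans (ler_pM _ _ (hchi1 x) (vb x hx h)) _ => //.
  by rewrite le_eqVlt; apply/orP; left; apply/eqP; field.
have eta4 : eta <= 1 / 4 by lra.
have i1 : \int[mu]_(x in `]0, 1[) q1 x <= 4 * K * eta.
  by apply: layer_bound => // x hx; rewrite /q1; have [-> _] := mid x hx; rewrite subrr mul0r expr0n.
have i2 : \int[mu]_(x in `]0, 1[) q2 x <= 4 * K * eta.
  by apply: layer_bound => // x hx; rewrite /q2; have [-> ->] := mid x hx; rewrite subrr !mul0r subrr expr0n.
have n1 : L2norm (fun x => v x - phi x) ^+ 2 <= 4 * K * eta.
  rewrite /L2norm sqr_sqrtr; last by apply: Rintegral_ge0 => x _; exact: sqr_ge0.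
  apply: le_trans i1; rewrite (@Rint_eq R _ q1) // => x /andP[x0 x1].
  by rewrite /q1 /phi clamp_id ?ltW // -vw ?ltW //; congr (_ ^+ 2); ring.
have n2 : L2norm (fun x => dv x - psi x) ^+ 2 <= 4 * K * eta.
  rewrite /L2norm sqr_sqrtr; last by apply: Rintegral_ge0 => x _; exact: sqr_ge0.
  apply: le_trans i2; rewrite (@Rint_eq R _ q2) // => x /andP[x0 x1].
  by rewrite /q2 /psi clamp_id ?ltW // -vw ?ltW // -dg ?ltW //; congr (_ ^+ 2); ring.
rewrite /H1norm -(@ltr_pXn2r _ 2) ?nnegrE ?sqrtr_ge0 ?(ltW e0) // sqr_sqrtr ?addr_ge0 ?sqr_ge0 //.
have : 0 < eta * 16 by rewrite mulr_gt0.
have : 0 <= K * eta by rewrite mulr_ge0 // ltW.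
by move: etaK n1 n2; rewrite mulrDr mulr1 mulrDl -mulrA -[4 * K * eta]mulrA; lra.
Qed.

End SobolevC1.

(** * The trajectory is a strong solution *)

Section Existence.
Context {R : realType} (alpha beta gamma : R) (delta : nat) (b c : R).
Local Notation mu := (@lebesgue_measure R).
Implicit Types (v vx vxx vt : R -> R -> R) (u : R -> R) (T : R).

Definition residual v vx vxx vt t x : R :=
  vt t x - rhs alpha beta gamma delta (v t x) (vx t x) (vxx t x).

Lemma jc_residual v vx vxx vt : traj v vx vxx vt -> jc (residual v vx vxx vt).
Proof.
move=> h; apply: (@jc_ext R (fun t x => vt t x - (vxx t x - peval (Fexpr beta gamma delta alpha) (v t x) (vx t x)))).
  by move=> t x _; rewrite /residual FexprE.
apply: jcB; first exact: (traj_cont_t h).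
by apply: jcB; [exact: (traj_cont_xx h)|apply: jc_peval; [exact: (traj_cont h)|exact: (traj_cont_x h)]].
Qed.

Lemma traj_H10 v vx vxx vt t : traj v vx vxx vt -> v t 0 = 0 -> v t 1 = 0 -> H10 (v t) (vx t).
Proof.
move=> h h0 h1.
apply: (@H10_C1 R (v t) (vx t) (fun x => v t (clamp x)) (fun x => vx t (clamp x)) (@jc_slice R v t (traj_cont h)) (@jc_slice R vx t (traj_cont_x h))) => //.
- by move=> x hx; rewrite clamp_id.
- by move=> x hx; rewrite clamp_id.
- exact: (traj_x h).
Qed.

Lemma strong_solution_traj v vx vxx vt u T : 0 < T ->
  traj v vx vxx vt -> pde alpha beta gamma delta b c v vx vxx vt ->
  (forall t, v t 0 = 0 /\ v t 1 = 0) -> (forall x, 0 <= x <= 1 -> v 0 x = u x) ->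
  strong_solution_with alpha beta gamma delta b c T (residual v vx vxx vt) u v vx vxx vt.
Proof.
move=> T0 h hp hb hi.
have cc t := @jc_slice R v t (traj_cont h); have ccx t := @jc_slice R vx t (traj_cont_x h).
have ccxx t := @jc_slice R vxx t (traj_cont_xx h).
split.
- by move=> t _; have [h0 h1] := hb t; exact: traj_H10 h h0 h1.
- move=> t0 _; apply/cvgrPdist_le => /= e e0.
  have e2 : 0 < e / 2 by rewrite divr_gt0.
  have n1 := jc_uniform t0 (traj_cont h) e2; have n2 := jc_uniform t0 (traj_cont_x h) e2.
  have : \forall t \near t0, `|0 - H1norm (fun x => v t x - v t0 x) (fun x => vx t x - vx t0 x)| <= e.
    near=> t.
    have k1 : forall x, 0 <= x <= 1 -> `|v t x - v t0 x| <= e / 2 by near: t.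
    have k2 : forall x, 0 <= x <= 1 -> `|vx t x - vx t0 x| <= e / 2 by near: t.
    rewrite sub0r normrN ger0_norm ?sqrtr_ge0 //.
    rewrite (_ : e = 2 * (e / 2)); last by field.
    apply: H1norm_le; first exact: ltW.
      apply: (@L2norm_le R _ (fun x => v t (clamp x) - v t0 (clamp x))).
      + by move=> x; apply: cvgB; exact: cc.
      + by move=> x /andP[x0 x1]; rewrite clamp_id // !ltW.
      + exact: ltW.
      + by move=> x _; apply: k1; exact: clamp_itv.
    apply: (@L2norm_le R _ (fun x => vx t (clamp x) - vx t0 (clamp x))).
    + by move=> x; apply: cvgB; exact: ccx.
    + by move=> x /andP[x0 x1]; rewrite clamp_id // !ltW.
    + exact: ltW.
    + by move=> x _; apply: k2; exact: clamp_itv.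
  by apply: filterS => t ht _.
- apply: aeW => t _; apply: (@H1_C1 R (vx t) (vxx t) _ _ (ccx t) (ccxx t)).
  + by move=> x hx; rewrite clamp_id.
  + by move=> x hx; rewrite clamp_id.
  + exact: (traj_xx h).
- by split; apply: jc_L2_cylinder; [exact: (traj_cont h)|exact: (traj_cont_x h)|exact: (traj_cont_xx h)].
- move=> phi tphi; apply: aeW => x; rewrite in_itv /= => /andP[x0 x1].
  have hx : 0 <= x <= 1 by rewrite !ltW.
  apply: (@weak_ibp R 0 T (fun t => v t x) (fun t => vt t x) (fun t => v t (clamp x)) (fun t => vt t (clamp x))) => //.
  + exact: (@jc_slice_time R v x (traj_cont h)).
  + exact: (@jc_slice_time R vt x (traj_cont_t h)).
  + by move=> t _; rewrite clamp_id.
  + by move=> t _; rewrite clamp_id.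
  + by move=> t _; exact: (traj_t h).
- exact: jc_L2_cylinder (traj_cont_t h).
- by apply: aeW => x; rewrite in_itv /= => /andP[x0 x1]; rewrite hi // !ltW.
- apply: aeW => t _.
  (* The points [b] and [c] are covered neither by the indicator nor by [pde]; they form a null
     set. *)
  apply: (ae_imp2 (ae_neq b) (ae_neq c)) => x xb xc; rewrite in_itv /= => /andP[x0 x1].
  rewrite indicE; have [xin|xin] := boolP (x \in `]b, c[).
    rewrite mem_set // mul1r /residual addrC subrK //.
  rewrite memNset ?mul0r ?addr0; last by move=> /=; exact/negP.
  apply: hp; move: xin; rewrite in_itv /= negb_and -!leNgt => /orP[h1|h1]; [left|right].
    by rewrite x0 lt_neqAle xb.
  by rewrite x1 andbT lt_neqAle eq_sym xc.
Unshelve. all: by end_near.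
Qed.

End Existence.

(** * Weak time derivatives tested in space *)

Lemma in_rect (S T : Type) (A : set S) (B : set T) s t : ((s, t) \in A `*` B) = (s \in A) && (t \in B).
Proof. by apply/idP/andP; rewrite !inE. Qed.

Section RectangleFubini.
Context {R : realType}.
Local Notation mu := (@lebesgue_measure R).
Local Notation mu2 := (mu \x mu)%E.
Variables (A B : set R).
Hypotheses (mA : measurable A) (mB : measurable B).
Implicit Types (h : R * R -> R) (t x : R).

Let mAB : measurable (A `*` B) := measurableX mA mB.

(** Extension by zero reduces a rectangle to the whole plane. *)
Let ext h : R * R -> \bar R := (EFin \o h) \_ (A `*` B).

Let ext_slice1 h t : (\int[mu]_x ext h (t, x) = ((fun t => \int[mu]_(x in B) (h (t, x))%:E) \_ A) t)%E.
Proof.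
rewrite patchE; case: ifPn => At.
  by rewrite [RHS]integral_mkcond; apply: eq_integral => x _; rewrite /ext !patchE in_rect At.
by apply: integral0_eq => x _; rewrite /ext patchE in_rect (negbTE At).
Qed.

Let ext_slice2 h x : (\int[mu]_t ext h (t, x) = ((fun x => \int[mu]_(t in A) (h (t, x))%:E) \_ B) x)%E.
Proof.
rewrite patchE; case: ifPn => Bx.
  by rewrite [RHS]integral_mkcond; apply: eq_integral => t _; rewrite /ext !patchE in_rect Bx andbT.
by apply: integral0_eq => t _; rewrite /ext patchE in_rect (negbTE Bx) andbF.
Qed.

(** An inner integral may be infinite on a null set, where [fine] gives 0; neither integrability nor
    the integral is affected. *)
Let fine_itg (C : set R) (F : R -> \bar R) : measurable C -> mu.-integrable C F ->
  mu.-integrable C (EFin \o (fine \o F)) /\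
  (\int[mu]_(t in C) (fine (F t))%:E = \int[mu]_(t in C) F t)%E.
Proof.
move=> mC hF; have mF := measurable_int _ hF.
have mfF : measurable_fun C (EFin \o (fine \o F)).
  by apply/measurable_EFinP; apply: measurableT_comp => //; exact: measurable_fine.
split.
  apply: (le_integrable _ _ _ hF) => // t Ct /=.
  by case: (F t) => [r| |] //=; rewrite normr0 leey.
apply: ae_eq_integral => //.
have := @integrable_ae _ _ _ mu C mC F hF.
by apply: filterS => t ht Ct; rewrite /= fineK // ht.
Qed.

Variable h : R * R -> R.
Hypothesis ih : mu2.-integrable (A `*` B) (EFin \o h).

Let ihT : mu2.-integrable setT (ext h).
Proof. by apply/(@integrable_mkcond _ _ _ mu2 _ (EFin \o h) mAB). Qed.

Let F1 (t : R) := (\int[mu]_(x in B) (h (t, x))%:E)%E.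
Let F2 (x : R) := (\int[mu]_(t in A) (h (t, x))%:E)%E.

Let iF1 : mu.-integrable A F1.
Proof.
apply/(@integrable_mkcond _ _ _ mu _ _ mA).
apply: eq_integrable (integrable_fubini_F ihT) => // t _.
by rewrite /fubini_F ext_slice1.
Qed.

Let fubini_G_integrable : mu.-integrable setT (fubini_G mu (ext h)).
Proof.
have mf := measurable_int _ ihT.
have mG := measurable_fubini_G ihT.
apply/integrableP; split => //.
apply: le_lt_trans ((integrable21ltyP mu mu mf).1 ihT).
apply: ge0_le_integral => //.
- exact: measurableT_comp.
- by apply: (measurable_fun_fubini_tonelli_G (m1 := mu) (abse \o ext h)); [exact: measurableT_comp|move=> p /=; exact: abse_ge0].
- by move=> x _; apply: le_abse_integral => //; exact: measurableT_comp.
Qed.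

Let iF2 : mu.-integrable B F2.
Proof.
apply/(@integrable_mkcond _ _ _ mu _ _ mB).
apply: eq_integrable fubini_G_integrable => // x _.
by rewrite /fubini_G ext_slice2.
Qed.

Lemma rect_itg1 : mu.-integrable A (EFin \o (fun t => \int[mu]_(x in B) h (t, x))).
Proof. exact: (fine_itg mA iF1).1. Qed.

Lemma rect_itg2 : mu.-integrable B (EFin \o (fun x => \int[mu]_(t in A) h (t, x))).
Proof. exact: (fine_itg mB iF2).1. Qed.

Lemma rect_fubini : \int[mu]_(t in A) (\int[mu]_(x in B) h (t, x)) =
  \int[mu]_(x in B) (\int[mu]_(t in A) h (t, x)).
Proof.
rewrite [LHS]/Rintegral [RHS]/Rintegral; congr fine.
transitivity (\int[mu]_(t in A) F1 t)%E; first exact: (fine_itg mA iF1).2.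
transitivity (\int[mu]_(x in B) F2 x)%E; last exact/esym/(fine_itg mB iF2).2.
rewrite integral_mkcond [RHS]integral_mkcond.
transitivity (\int[mu]_t \int[mu]_x ext h (t, x))%E.
  by apply: eq_integral => t _; rewrite ext_slice1.
rewrite (Fubini ihT); apply: eq_integral => x _; exact: ext_slice2.
Qed.

Lemma rect_ae1 : {ae mu, forall t : R, A t -> mu.-integrable B (EFin \o (fun x => h (t, x)))}.
Proof.
apply: (ae_imp (ae_integrable1 ihT)) => t ht At.
apply/(@integrable_mkcond _ _ _ mu _ _ mB); apply: eq_integrable ht => // x _.
by rewrite /ext !patchE in_rect mem_set.
Qed.

Lemma rect_ae2 : {ae mu, forall x : R, B x -> mu.-integrable A (EFin \o (fun t => h (t, x)))}.
Proof.
apply: (ae_imp (ae_integrable2 ihT)) => x hx Bx.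
apply/(@integrable_mkcond _ _ _ mu _ _ mA); apply: eq_integrable hx => // t _.
by rewrite /ext !patchE in_rect (mem_set Bx) andbT.
Qed.

End RectangleFubini.

Section TimeDerivative.
Context {R : realType}.
Local Notation mu := (@lebesgue_measure R).
Local Notation mu2 := (mu \x mu)%E.
Implicit Types (T : R).

Lemma sqi_space (A B : set R) (psi : R -> R) : measurable A -> measurable B -> (mu A < +oo)%E ->
  square_integrable mu B psi -> square_integrable mu2 (A `*` B) (fun p => psi p.2).
Proof.
move=> mA mB fA [mpsi ipsi]; have mAB : measurable (A `*` B) := measurableX mA mB.
have m1 : measurable_fun (A `*` B) (fun p : R * R => psi p.2).
  by apply: (@measurable_comp _ _ _ _ _ _ B) => //; [move=> _ [[t x] [_ Bx] <-]|exact: measurable_funTS measurable_snd].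
split => //.
apply/(@integrable_mkcond _ _ _ mu2 _ _ mAB).
have mH : measurable_fun setT ((EFin \o (fun p : R * R => psi p.2 ^+ 2)) \_ (A `*` B)).
  by apply/(measurable_restrictT _ mAB)/measurable_EFinP; exact: measurable_funX.
apply/(integrable12ltyP mu mu mH).
have fin : (\int[mu]_(x in B) `|(psi x ^+ 2)%:E| < +oo)%E by case/integrableP: ipsi.
have cst_int : (\int[mu]_(t in A) (\int[mu]_(x in B) `|(psi x ^+ 2)%:E|) < +oo)%E.
  rewrite integral_cst // lte_mul_pinfty ?ge0_fin_numE //; exact: integral_ge0.
apply: le_lt_trans cst_int; rewrite [X in (_ <= X)%E]integral_mkcond.
rewrite le_eqVlt; apply/orP; left; apply/eqP; apply: eq_integral => t _.
rewrite [RHS]patchE; case: ifPn => At.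
  rewrite [RHS]integral_mkcond; apply: eq_integral => x _; rewrite !patchE in_rect At.
  by rewrite /=; case: ifP => // _; exact: abse0.
by apply: integral0_eq => x _; rewrite patchE in_rect (negbTE At); exact: abse0.
Qed.

Lemma test_function_bounded (a b : R) (phi : R -> R) : test_function a b phi ->
  exists M : R, forall t, a < t < b -> `|phi t| <= M /\ `|derive1 phi t| <= M.
Proof.
move=> tphi; have cphi := test_function_cont tphi; have [_ c1 _] := tphi.
have H (f : R -> R) : continuous f -> exists M : R, forall t, a <= t <= b -> `|f t| <= M.
  move=> cf; have [M hM] := @jc_bounded R (fun t _ => f t) a b (jc_time cf).
  by exists M => t ht; apply: (hM t 0) => //; rewrite lexx ler01.
have [M1 h1] := H _ cphi; have [M2 h2] := H _ c1.
exists (Num.max M1 M2) => t /andP[ta tb].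
have ht : a <= t <= b by rewrite !ltW.
by split; rewrite le_max ?h1 ?h2 ?orbT.
Qed.

Lemma weak_product_itg T (u : R -> R -> R) (psi a : R -> R) (M : R) :
  L2_cylinder T u -> L2_interval 0 1 psi -> continuous a -> (forall t, 0 < t < T -> `|a t| <= M) ->
  mu2.-integrable (`]0, T[ `*` `]0, 1[) (EFin \o (fun p => u p.1 p.2 * psi p.2 * a p.1)).
Proof.
move=> hu hpsi ca hM.
have m1 : measurable (`]0, T[%classic : set R) by exact: measurable_itv.
have m2 : measurable (`]0, 1[%classic : set R) by exact: measurable_itv.
have mD : measurable (`]0, T[ `*` `]0, 1[ : set (R * R)) := measurableX m1 m2.
have hp := sqi_space m1 m2 (oo_lty 0 T) hpsi.
have ma : measurable_fun (`]0, T[ `*` `]0, 1[ : set (R * R)) (fun p : R * R => a p.1).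
  apply: measurable_funTS; apply: (measurableT_comp _ measurable_fst).
  exact: continuous_measurable_fun.
have hq : square_integrable mu2 (`]0, T[ `*` `]0, 1[) (fun p : R * R => a p.1 * psi p.2).
  apply: (@sqi_bounded _ _ _ mu2 _ mD M) => // -[t x] [/= ht _]; apply: hM.
  by move: ht; rewrite in_itv.
have := @itg_mul _ _ _ mu2 _ mD _ _ hu hq; apply: (@itg_eq _ _ _ mu2 _ mD) => p _ /=; ring.
Qed.

Lemma itg_mul_bounded (a b M : R) (F w : R -> R) : continuous w -> (forall t, a < t < b -> `|w t| <= M) ->
  mu.-integrable `]a, b[ (EFin \o F) -> mu.-integrable `]a, b[ (EFin \o (fun t => F t * w t)).
Proof.
move=> cw hM hF; have m1 : measurable (`]a, b[%classic : set R) by exact: measurable_itv.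
have mF : measurable_fun `]a, b[ F by apply/measurable_EFinP; exact: (measurable_int _ hF).
apply: (@itg_le _ _ _ mu _ m1 _ (fun t => M * `|F t|)).
- by apply: measurable_funM => //; apply: measurable_funTS; exact: continuous_measurable_fun.
- move=> t /=; rewrite in_itv /= => /hM ht; rewrite normrM mulrC ler_wpM2r //.
- by apply: (@itgZ _ _ _ mu _ m1); exact: (@integrable_norm _ _ _ mu _ _ hF).
Qed.

Lemma L2_one (a b : R) : L2_interval a b (fun=> 1).
Proof. by apply: (@sqi_cont R _ (fun=> 1)) => // x; exact: cvg_cst. Qed.

Lemma inner_slice_itg T (u : R -> R -> R) (psi : R -> R) : L2_cylinder T u -> L2_interval 0 1 psi ->
  mu.-integrable `]0, T[ (EFin \o (fun t => inner mu `]0, 1[ (u t) psi)) /\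
  {ae mu, forall t : R, `]0, T[%classic t -> mu.-integrable `]0, 1[ (EFin \o (fun x => u t x * psi x))}.
Proof.
move=> hu hpsi.
have m1 : measurable (`]0, T[%classic : set R) by exact: measurable_itv.
have m2 : measurable (`]0, 1[%classic : set R) by exact: measurable_itv.
have c1 : continuous (fun _ : R => 1 : R) by move=> x; exact: cvg_cst.
have i1 := weak_product_itg hu hpsi c1 (M := 1) (fun t ht => eq_ind_r (fun z => z <= 1) (lexx 1) (normr1 R)).
have i2 : mu2.-integrable (`]0, T[ `*` `]0, 1[) (EFin \o (fun p => u p.1 p.2 * psi p.2)).
  by apply: (@itg_eq _ _ _ mu2 _ (measurableX m1 m2) _ _ _ i1) => p _; rewrite mulr1.
split; [exact: (rect_itg1 m1 m2 i2)|exact: (rect_ae1 m1 m2 i2)].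
Qed.

(** The weak derivative is known for almost every [x] once the test function in time is fixed.
    Multiplying by [psi], integrating in [x] and exchanging the integrals makes it a statement about
    one scalar function of time. *)
Lemma weak_time_inner T (u dtu : R -> R -> R) (psi phi : R -> R) :
  L2_cylinder T u -> L2_cylinder T dtu -> weak_time_derivative T u dtu ->
  L2_interval 0 1 psi -> test_function 0 T phi ->
  \int[mu]_(t in `]0, T[) (inner mu `]0, 1[ (u t) psi * derive1 phi t) =
  - \int[mu]_(t in `]0, T[) (inner mu `]0, 1[ (dtu t) psi * phi t).
Proof.
move=> hu hdu hw hpsi tphi.
have [M hM] := test_function_bounded tphi.
have cphi := test_function_cont tphi; have [_ c1 _] := tphi.
have m1 : measurable (`]0, T[%classic : set R) by exact: measurable_itv.
have m2 : measurable (`]0, 1[%classic : set R) by exact: measurable_itv.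
have swap (w : R -> R -> R) (a : R -> R) : L2_cylinder T w -> continuous a -> (forall t, 0 < t < T -> `|a t| <= M) ->
    [/\ \int[mu]_(t in `]0, T[) (inner mu `]0, 1[ (w t) psi * a t) =
        \int[mu]_(x in `]0, 1[) \int[mu]_(t in `]0, T[) (w t x * psi x * a t),
      mu.-integrable `]0, 1[ (EFin \o (fun x => \int[mu]_(t in `]0, T[) (w t x * psi x * a t)))
    & {ae mu, forall x : R, `]0, 1[%classic x ->
        \int[mu]_(t in `]0, T[) (w t x * psi x * a t) = psi x * \int[mu]_(t in `]0, T[) (w t x * a t)}].
  move=> hwc ca ha.
  have i1 := weak_product_itg hwc hpsi ca ha.
  have [g1 g2] := inner_slice_itg hwc hpsi.
  have i2 := weak_product_itg hwc (L2_one 0 1) ca ha.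
  split.
  - rewrite -(rect_fubini m1 m2 i1); apply: (@Rintegral_ae _ _ _ mu _ m1).
    + exact: itg_mul_bounded ca ha g1.
    + exact: (rect_itg1 m1 m2 i1).
    + apply: (ae_imp g2) => t ht Dt.
      rewrite /inner -RintegralZr //; exact: ht.
  - exact: (rect_itg2 m1 m2 i1).
  - apply: (ae_imp (rect_ae2 m1 m2 i2)) => x hx Dx.
    rewrite -RintegralZl //.
      by apply: eq_Rintegral => t _; ring.
    by apply: (@itg_eq _ _ _ mu _ m1 _ _ _ (hx Dx)) => t _ /=; rewrite mulr1.
have [e1 g1 a1] := swap u _ hu c1 (fun t ht => (hM t ht).2).
have [e2 g2 a2] := swap dtu _ hdu cphi (fun t ht => (hM t ht).1).
rewrite e1 e2 -mulN1r -RintegralZl //.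
apply: (@Rintegral_ae _ _ _ mu _ m2) => //; first exact: (@itgZ _ _ _ mu _ m2 (-1)).
have a3 : {ae mu, forall x : R, `]0, 1[%classic x ->
    \int[mu]_(t in `]0, T[) (u t x * derive1 phi t) = - \int[mu]_(t in `]0, T[) (dtu t x * phi t)} := hw phi tphi.
apply: (ae_imp3 a1 a2 a3) => x h1 h2 h3 Dx.
by rewrite h1 // h2 // h3 //; ring.
Qed.

End TimeDerivative.

(** * The Sobolev space H^1_0 *)

Section SobolevSpace.
Context {R : realType}.
Local Notation mu := (@lebesgue_measure R).
Local Notation ip := (inner mu `]0, 1[).
Local Notation nm := (norm2 mu `]0, 1[).
Implicit Types (f g p q dp dq phi : R -> R).

Let m01 : measurable (`]0, 1[%classic : set R). Proof. exact: measurable_itv. Qed.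

Lemma L2B f g : L2_interval 0 1 f -> L2_interval 0 1 g -> L2_interval 0 1 (fun x => f x - g x).
Proof. exact: sqiB. Qed.

Lemma L2D f g : L2_interval 0 1 f -> L2_interval 0 1 g -> L2_interval 0 1 (fun x => f x + g x).
Proof. exact: sqiD. Qed.

Lemma L2Z (k : R) f : L2_interval 0 1 f -> L2_interval 0 1 (fun x => k * f x).
Proof. exact: sqiZ. Qed.

Lemma nmD f g : L2_interval 0 1 f -> L2_interval 0 1 g -> nm (fun x => f x + g x) <= nm f + nm g.
Proof. exact: norm2D. Qed.

Lemma nmB f g : L2_interval 0 1 f -> L2_interval 0 1 g -> nm f - nm g <= nm (fun x => f x - g x).
Proof. exact: norm2B. Qed.

Lemma ipBl f g h : L2_interval 0 1 f -> L2_interval 0 1 g -> L2_interval 0 1 h ->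
  ip (fun x => f x - g x) h = ip f h - ip g h.
Proof. exact: innerBl. Qed.

Lemma L2_le f g : measurable_fun (`]0, 1[%classic : set R) f -> (forall x, 0 < x < 1 -> `|f x| <= g x) ->
  L2_interval 0 1 g -> L2_interval 0 1 f.
Proof.
by move=> mf fg; apply: sqi_le => // x /=; rewrite in_itv /=; exact: fg.
Qed.

Lemma cs01 f g : L2_interval 0 1 f -> L2_interval 0 1 g -> `|ip f g| <= nm f * nm g.
Proof. exact: cauchy_schwarz. Qed.

Lemma norm2_eq0_ae f : L2_interval 0 1 f -> nm f = 0 ->
  {ae mu, forall x : R, `]0, 1[%classic x -> f x = 0}.
Proof.
move=> [mf f2] nf.
have mf2 := measurable_int _ f2.
have e0 : \int[mu]_(x in `]0, 1[) (f x ^+ 2) = 0.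
  transitivity (nm f ^+ 2); last by rewrite nf expr0n.
  by rewrite norm2_sqr; apply: eq_Rintegral => x _; rewrite expr2.
have fin := @integrable_fin_num _ _ _ mu _ m01 _ f2.
have e1 : (\int[mu]_(x in `]0%R, 1%R[) `|(f x ^+ 2)%:E| = 0)%E.
  transitivity (\int[mu]_(x in `]0%R, 1%R[) (f x ^+ 2)%:E)%E.
    by apply: eq_integral => x _; rewrite gee0_abs // lee_fin sqr_ge0.
  by rewrite -(fineK fin); congr EFin.
have := (@ae_eq_integral_abs _ _ _ mu _ m01 _ mf2).1 e1.
by apply: filterS => x h Dx; have [/eqP] := h Dx; rewrite sqrf_eq0 => /eqP.
Qed.

Lemma L2_cst (c : R) : L2_interval 0 1 (fun=> c).
Proof. by apply: (@sqi_cont R _ (fun=> c)) => // x; exact: cvg_cst. Qed.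

Lemma norm2_cst (c : R) : nm (fun=> c) = `|c|.
Proof.
rewrite /norm2 int_prim //; last by move=> x; exact: cvg_cst.
by rewrite !prim_const mulr1 mulr0 subr0 sqrtr_sqr.
Qed.

Lemma norm2_abs f : nm (fun x => `|f x|) = nm f.
Proof. by congr Num.sqrt; apply: eq_Rintegral => x _; rewrite real_normK ?num_real. Qed.

Lemma L2_abs f : L2_interval 0 1 f -> L2_interval 0 1 (fun x => `|f x|).
Proof.
move=> hf; split; first by apply: measurableT_comp hf.1; exact: normr_measurable.
by apply: (@itg_eq _ _ _ mu _ m01 _ _ _ hf.2) => x _; rewrite real_normK ?num_real.
Qed.

Lemma le_norm2 f g : L2_interval 0 1 f -> L2_interval 0 1 g ->
  {ae mu, forall x : R, `]0, 1[%classic x -> `|f x| <= `|g x|} -> nm f <= nm g.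
Proof.
move=> hf hg h; rewrite /norm2 ler_wsqrtr //.
apply: (@le_Rintegral_ae _ _ _ mu _ m01 _ _ hf.2 hg.2).
apply: (ae_imp h) => x hx Dx.
by have := hx Dx; rewrite -(@ler_pXn2r _ 2) ?nnegrE // !real_normK ?num_real.
Qed.

Lemma norm2Z (k : R) f : L2_interval 0 1 f -> nm (fun x => k * f x) = `|k| * nm f.
Proof.
move=> hf; rewrite /norm2.
under eq_Rintegral do rewrite exprMn.
rewrite RintegralZl //; last exact: hf.2.
by rewrite sqrtrM ?sqr_ge0 // sqrtr_sqr.
Qed.

Lemma nm_sub_le f g : L2_interval 0 1 f -> L2_interval 0 1 g -> nm (fun x => f x - g x) <= nm f + nm g.
Proof.
move=> hf hg; rewrite (_ : (fun x => f x - g x) = (fun x => f x + -1 * g x)).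
  by apply: le_trans (nmD hf (L2Z (-1) hg)) _; rewrite norm2Z // normrN1 mul1r.
by apply/funext => x; rewrite mulN1r.
Qed.

Lemma nm_tri f g h : L2_interval 0 1 f -> L2_interval 0 1 g -> L2_interval 0 1 h ->
  nm (fun x => f x - g x) <= nm (fun x => f x - h x) + nm (fun x => g x - h x).
Proof.
move=> hf hg hh; apply: le_trans (nm_sub_le (L2B hf hh) (L2B hg hh)).
by rewrite le_eqVlt; apply/orP; left; apply/eqP/norm2_eq => x _; ring.
Qed.

Lemma nm_sub4 f1 f2 g1 g2 : L2_interval 0 1 f1 -> L2_interval 0 1 f2 -> L2_interval 0 1 g1 -> L2_interval 0 1 g2 ->
  nm (fun x => f1 x - f2 x - (g1 x - g2 x)) <= nm (fun x => f1 x - g1 x) + nm (fun x => f2 x - g2 x).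
Proof.
move=> a1 a2 b1 b2; apply: le_trans (nm_sub_le (L2B a1 b1) (L2B a2 b2)).
by rewrite le_eqVlt; apply/orP; left; apply/eqP/norm2_eq => x _; ring.
Qed.

Lemma nmB_le f g e : L2_interval 0 1 f -> L2_interval 0 1 g -> nm (fun x => f x - g x) <= e -> nm f <= nm g + e.
Proof. by move=> hf hg he; rewrite -lerBlDl; exact: le_trans (nmB hf hg) he. Qed.

Lemma nm_subC f g : nm (fun x => f x - g x) = nm (fun x => g x - f x).
Proof. by rewrite -norm2N; apply: norm2_eq => x _; rewrite opprB. Qed.

Lemma H1norm_ge p dp : nm p <= H1norm p dp /\ nm dp <= H1norm p dp.
Proof.
rewrite /H1norm -[X in X <= _](ger0_norm (norm2_ge0 mu _ p)).
rewrite -[X in _ /\ X <= _](ger0_norm (norm2_ge0 mu _ dp)) -!sqrtr_sqr.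
by split; apply: ler_wsqrtr; rewrite ?lerDl ?lerDr sqr_ge0.
Qed.

Lemma test_function_L2 phi : test_function 0 1 phi ->
  L2_interval 0 1 phi /\ L2_interval 0 1 (derive1 phi).
Proof.
move=> tphi; have c0 := test_function_cont tphi; have [_ c1 _] := tphi.
by split; [apply: (sqi_cont c0)|apply: (sqi_cont c1)].
Qed.

Lemma test_function_der a b phi (x : R) : test_function a b phi -> der phi x (derive1 phi x).
Proof. by case=> d _ _; apply: DeriveDef; rewrite ?derive1E. Qed.

Lemma H10_approx p dp e : H10 p dp -> 0 < e -> exists2 phi, test_function 0 1 phi &
  nm (fun x => p x - phi x) <= e /\ nm (fun x => dp x - derive1 phi x) <= e.
Proof.
move=> [_ h] e0; have [phi tphi hphi] := h e e0; exists phi => //.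
have [h1 h2] := H1norm_ge (fun x => p x - phi x) (fun x => dp x - derive1 phi x).
by split; apply: le_trans (ltW hphi).
Qed.

(** For a test function in place of [p] this is the definition of the weak derivative of [q]; both
    sides are continuous in [p] for the [H^1] norm. *)
Lemma H10_ibp p dp q dq : H10 p dp -> H1 q dq -> ip dp q = - ip p dq.
Proof.
move=> hp [q2 dq2 wq]; have [[p2 dp2 _] _] := hp.
apply/eqP; rewrite -addr_eq0 -normr_eq0 eq_le normr_ge0 andbT.
apply/ler_addgt0Pl => e e0; rewrite addr0.
pose N := nm q + nm dq + 1.
have N0 : 0 < N by rewrite ltr_wpDl // addr_ge0 // norm2_ge0.
have e1 : 0 < e / N by rewrite divr_gt0.
have [phi tphi [h1 h2]] := H10_approx hp e1.
have [phi2 dphi2] := test_function_L2 tphi.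
have w : ip (derive1 phi) q = - ip phi dq.
  rewrite innerC; have := wq phi tphi; rewrite -/(ip q (derive1 phi)) => ->.
  by rewrite -/(ip dq phi) innerC.
have -> : ip dp q + ip p dq = ip (fun x => dp x - derive1 phi x) q + ip (fun x => p x - phi x) dq.
  by rewrite !ipBl // w; ring.
have b1 := cs01 (L2B dp2 dphi2) q2; have b2 := cs01 (L2B p2 phi2) dq2.
apply: le_trans (ler_normD _ _) _; apply: le_trans (lerD b1 b2) _.
have c1 := ler_wpM2r (norm2_ge0 mu `]0, 1[ q) h2; have c2 := ler_wpM2r (norm2_ge0 mu `]0, 1[ dq) h1.
apply: le_trans (lerD c1 c2) _; rewrite -mulrDr mulrAC ler_pdivrMr // ler_wpM2l ?(ltW e0) //.
by rewrite lerDl.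
Qed.

Lemma test_function_sup phi x : test_function 0 1 phi -> 0 < x < 1 -> `|phi x| <= nm (derive1 phi).
Proof.
move=> tphi /andP[x0 x1]; have [_ c1 [a' [b' [aa bb supp]]]] := tphi.
have [_ dphi2] := test_function_L2 tphi.
have phi0 : phi 0 = 0 by apply: supp; rewrite in_itv /= negb_and -!ltNge aa.
pose g y := `|derive1 phi y|.
have cg : continuous g by move=> y; apply: cvg_norm; exact: c1.
have := @der_mono_norm R phi (derive1 phi) (prim g) g 0 x (ltW x0).
rewrite phi0 !subr0 prim0 subr0 => H.
have {}H := H (fun y _ => test_function_der y tphi) (fun y _ => prim_der y cg) (fun y _ => lexx _).
apply: (le_trans H).
have le1 : prim g x <= prim g 1.
  have := @der_mono R (fun=> 0) (fun=> 0) (prim g) g x 1 (ltW x1) (fun y _ => derC 0 y)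
    (fun y _ => prim_der y cg) (fun y _ => normr_ge0 _).
  by rewrite subrr subr_ge0.
have e1 : prim g 1 = ip g (fun=> 1).
  have := int_prim cg ltr01; rewrite prim0 subr0 => <-.
  by apply: eq_Rintegral => y _; rewrite mulr1.
apply: (le_trans le1); rewrite e1.
apply: le_trans (ler_norm _) _; apply: le_trans (cs01 (L2_abs dphi2) (L2_cst 1)) _.
by rewrite norm2_abs norm2_cst normr1 mulr1.
Qed.

(* The excess [r] of [`|q|] over the bound is at most the distance from [q] to
   a test function, up to an arbitrarily small constant. *)
Lemma H10_sup q dq : H10 q dq -> {ae mu, forall x : R, `]0, 1[%classic x -> `|q x| <= nm dq}.
Proof.
move=> hq; have [[q2 dq2 _] _] := hq.
pose r x := Num.max 0 (`|q x| - nm dq).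
have mr : measurable_fun (`]0, 1[%classic : set R) r.
  apply: measurable_maxr; first exact: measurable_cst.
  by apply: measurable_funB; [exact: (L2_abs q2).1|exact: measurable_cst].
have r_ge0 x : 0 <= r x by rewrite le_max lexx.
have r_le x : r x <= `|q x|.
  by rewrite ge_max normr_ge0 gerBl norm2_ge0.
have r2 : L2_interval 0 1 r.
  by apply: (L2_le mr _ (L2_abs q2)) => x _; rewrite ger0_norm.
have r0 : nm r = 0.
  apply/eqP; rewrite eq_le norm2_ge0 andbT; apply/ler_addgt0Pl => e e0; rewrite addr0.
  have e2 : 0 < e / 2 by rewrite divr_gt0.
  have [phi tphi [h1 h2]] := H10_approx hq e2.
  have [phi2 dphi2] := test_function_L2 tphi.
  have d2 := L2B q2 phi2.
  have nphi : nm (derive1 phi) <= nm dq + e / 2.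
    by apply: nmB_le => //; rewrite nm_subC.
  have r_bound (x : R) : 0 < x < 1 -> `|r x| <= `|q x - phi x| + e / 2.
    move=> hx; have hphi := test_function_sup tphi hx.
    have tri : `|q x| <= `|q x - phi x| + `|phi x| by rewrite -{1}(subrK (phi x) (q x)) ler_normD.
    rewrite (ger0_norm (r_ge0 x)) ge_max addr_ge0 ?(ltW e2) //=.
    rewrite lerBlDr; apply: le_trans tri _; rewrite -addrA lerD2l addrC.
    exact: le_trans hphi nphi.
  apply: (@le_trans _ _ (nm (fun x => `|q x - phi x| + e / 2))).
    apply: le_norm2 => //; first exact: L2D (L2_abs d2) (L2_cst _).
    apply: aeW => x /=; rewrite in_itv /= => /r_bound h; exact: le_trans h (ler_norm _).
  apply: le_trans (nmD (L2_abs d2) (L2_cst _)) _.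
  by rewrite norm2_abs norm2_cst (gtr0_norm e2) [leRHS]splitr lerD2r.
apply: (ae_imp (norm2_eq0_ae r2 r0)) => x h Dx.
have : `|q x| - nm dq <= r x by rewrite le_max lexx orbT.
by rewrite (h Dx) subr_le0.
Qed.

Lemma weak_derivativeB (v dv w dw : R -> R) : H1 v dv -> H1 w dw ->
  weak_derivative 0 1 (fun x : R => v x - w x) (fun x : R => dv x - dw x).
Proof.
move=> [v2 dv2 hv] [w2 dw2 hw] phi tphi; have [phi2 dphi2] := test_function_L2 tphi.
have e1 := ipBl v2 w2 dphi2; have e2 := ipBl dv2 dw2 phi2.
rewrite /inner in e1 e2; rewrite e1 e2 hv // hw //; ring.
Qed.

Lemma H1B (v dv w dw : R -> R) : H1 v dv -> H1 w dw -> H1 (fun x : R => v x - w x) (fun x : R => dv x - dw x).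
Proof.
move=> hv hw; have [v2 dv2 _] := hv; have [w2 dw2 _] := hw.
by split; [exact: L2B|exact: L2B|exact: weak_derivativeB].
Qed.

Lemma test_functionB phi psi : test_function 0 1 phi -> test_function 0 1 psi ->
  test_function 0 1 (fun x : R => phi x - psi x) /\
  derive1 (fun x : R => phi x - psi x) = (fun x => derive1 phi x - derive1 psi x).
Proof.
move=> t1 t2.
have e : derive1 (fun x : R => phi x - psi x) = (fun x => derive1 phi x - derive1 psi x).
  by apply/funext => x; apply: der_derive1; exact: (derB (test_function_der x t1) (test_function_der x t2)).
split => //; have [d1 c1 [a1 [b1 [h1 h2 s1]]]] := t1; have [d2 c2 [a2 [b2 [h3 h4 s2]]]] := t2.
split.
- by move=> x; have [] := derB (test_function_der x t1) (test_function_der x t2).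
- by rewrite e => x; apply: cvgB; [exact: c1|exact: c2].
- exists (Num.min a1 a2), (Num.max b1 b2); split; first by rewrite lt_min h1.
    by rewrite gt_max h2.
  move=> x; rewrite in_itv /= negb_and -!ltNge lt_min gt_max => hx.
  have hx1 : x \notin `[a1, b1].
    by rewrite in_itv /= negb_and -!ltNge; case/orP: hx => /andP[-> _]; rewrite ?orbT.
  have hx2 : x \notin `[a2, b2].
    by rewrite in_itv /= negb_and -!ltNge; case/orP: hx => /andP[_ ->]; rewrite ?orbT.
  by rewrite s1 // s2 // subrr.
Qed.

Lemma H10B (v dv w dw : R -> R) : H10 v dv -> H10 w dw -> H10 (fun x : R => v x - w x) (fun x : R => dv x - dw x).
Proof.
move=> hv hw; have [hv1 _] := hv; have [hw1 _] := hw; split; first exact: H1B.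
have [v2 dv2 _] := hv1; have [w2 dw2 _] := hw1.
move=> e e0; have e5 : 0 < e / 5 by rewrite divr_gt0.
have e45 : 2 * (2 * (e / 5)) < e by clear -e0; lra.
have [phi tphi [h1 h2]] := H10_approx hv e5.
have [psi tpsi [h3 h4]] := H10_approx hw e5.
have [t et] := test_functionB tphi tpsi.
have [p2 dp2] := test_function_L2 tphi; have [q2 dq2] := test_function_L2 tpsi.
exists (fun x => phi x - psi x) => //; rewrite et.
have tri f1 g1 f2 g2 : L2_interval 0 1 f1 -> L2_interval 0 1 g1 -> L2_interval 0 1 f2 -> L2_interval 0 1 g2 ->
    nm (fun x => f1 x - g1 x) <= e / 5 -> nm (fun x => f2 x - g2 x) <= e / 5 ->
    L2norm (fun x => f1 x - f2 x - (g1 x - g2 x)) <= 2 * (e / 5).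
  by move=> a1 a2 a3 a4 b1 b2; apply: le_trans (nm_sub4 a1 a3 a2 a4) _; rewrite mulr_natl mulr2n lerD.
have e4 : 0 <= 2 * (e / 5) by rewrite mulr_ge0 // ltW.
apply: le_lt_trans (H1norm_le e4 (tri _ _ _ _ v2 p2 w2 q2 h1 h3) (tri _ _ _ _ dv2 dp2 dw2 dq2 h2 h4)) _.
exact: e45.
Qed.

End SobolevSpace.

(** * Growth estimates *)

Section Growth.
Context {R : realType}.
Local Notation mu := (@lebesgue_measure R).
Implicit Types (g G k E : R -> R) (s h t T e K C l : R).

Lemma gstep1_ge0 t : 0 <= gstep 1 t.
Proof. by rewrite /gstep mul1r divr_ge0 ?bump_jet0_ge0 // ltW ?bump_mass_gt0. Qed.

Lemma gstep0_mono s t : s <= t -> gstep 0 s <= gstep 0 t.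
Proof. by move=> st; rewrite /gstep ler_wpM2r ?prim_bump_mono // invr_ge0 ltW ?bump_mass_gt0. Qed.

(** An approximate identity supported in [[s, s + h]]. It is the derivative of a rescaled step, so
    that the difference of two of them has a compactly supported primitive, which can serve as a
    test function. *)
Definition mollifier s h t : R := gstep 1 ((t - s) / h) / h.

Lemma mollifier_der s h t : 0 < h -> der (fun t => gstep 0 ((t - s) / h)) t (mollifier s h t).
Proof.
move=> h0; have hn : h != 0 by rewrite gt_eqF.
have d : der (fun t => (t - s) / h) t h^-1.
  by apply: der_ext (der_affine h^-1 (- s / h) t) => y; field.
by apply: der_eq (der_comp (gstep_der 0 _) d) _; rewrite mul1r.
Qed.

Lemma mollifier_cont s h : continuous (mollifier s h).
Proof.
move=> t; apply: cvgM; last exact: cvg_cst.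
apply: (@continuous_comp _ _ _ (fun t => (t - s) / h) (gstep 1)); last exact: (der_cont (gstep_der 1 _)).
by apply: cvgM; [apply: cvgB; [exact: cvg_id|exact: cvg_cst]|exact: cvg_cst].
Qed.

Lemma mollifier_ge0 s h t : 0 < h -> 0 <= mollifier s h t.
Proof. by move=> h0; rewrite divr_ge0 ?gstep1_ge0 // ltW. Qed.

Lemma mollifier_out s h t : 0 < h -> ~~ (s <= t <= s + h) -> mollifier s h t = 0.
Proof.
move=> h0; rewrite negb_and -!ltNge /mollifier => /orP[ts|ts].
  by rewrite gstep_le0 ?mul0r // pmulr_lle0 ?invr_gt0 // subr_le0 ltW.
by rewrite gstep_ge1 ?mul0r // ler_pdivlMr // mul1r; lra.
Qed.

Lemma mollifier_bound s h : 0 < h -> exists M : R, forall t, `|mollifier s h t| <= M.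
Proof.
move=> h0; have [A _ hA] := @gstep_bound R.
exists (A * (8 ^+ 1 * 1`!%:R) / h) => t.
by rewrite normrM normfV (gtr0_norm h0) ler_wpM2r // invr_ge0 ltW.
Qed.

Lemma mollifier_mass s h T : 0 < h -> 0 <= s -> s + h <= T ->
  \int[mu]_(t in `]0, T[) mollifier s h t = 1.
Proof.
move=> h0 s0 sT; have T0 : 0 < T by lra.
rewrite int_prim //; last exact: mollifier_cont.
rewrite prim0 subr0.
have d (t : R) : der (fun t => gstep 0 ((t - s) / h) - gstep 0 (- s / h)) t (mollifier s h t).
  by apply: der_eq (derB (mollifier_der s t h0) (derC _ t)) _; rewrite subr0.
rewrite -(@prim_uniq R (mollifier s h) _ T (@mollifier_cont s h) _ (fun t _ => d t)); last first.
  by rewrite sub0r subrr.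
rewrite [X in X - _]gstep_ge1; last by rewrite ler_pdivlMr // mul1r; lra.
by rewrite gstep_le0 ?subr0 // mulNr oppr_le0 divr_ge0 // ltW.
Qed.

Lemma mollifier_itg k s h T : 0 < h -> mu.-integrable `]0, T[ (EFin \o k) ->
  mu.-integrable `]0, T[ (EFin \o (fun t => k t * mollifier s h t)).
Proof.
move=> h0 ik; have [M hM] := mollifier_bound s h0.
exact: (itg_mul_bounded (@mollifier_cont s h) (fun t _ => hM t) ik).
Qed.

Lemma mollify k s h T l e : mu.-integrable `]0, T[ (EFin \o k) -> 0 < h -> 0 <= s -> s + h <= T ->
  (forall t, 0 < t < T -> s <= t <= s + h -> `|k t - l| <= e) ->
  `|\int[mu]_(t in `]0, T[) (k t * mollifier s h t) - l| <= e.
Proof.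
move=> ik h0 s0 sT hk.
have m1 : measurable (`]0, T[%classic : set R) by exact: measurable_itv.
have ir : mu.-integrable `]0, T[ (EFin \o mollifier s h).
  by apply: cont_integrable_oo; exact: mollifier_cont.
have ic (c : R) : mu.-integrable `]0, T[ (EFin \o (fun t => c * mollifier s h t)).
  exact: (@itgZ _ _ _ mu _ m1 c _ ir).
have mass (c : R) : \int[mu]_(t in `]0, T[) (c * mollifier s h t) = c.
  by rewrite RintegralZl // mollifier_mass // mulr1.
have bd t : 0 < t < T -> (l - e) * mollifier s h t <= k t * mollifier s h t <= (l + e) * mollifier s h t.
  move=> ht; have [hs|hs] := boolP (s <= t <= s + h); last by rewrite mollifier_out // !mulr0 lexx.
  have := hk t ht hs; have r0 := mollifier_ge0 s t h0.
  by rewrite ler_norml => /andP[h1 h2]; rewrite !ler_wpM2r //; lra.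
rewrite ler_norml; apply/andP; split.
  rewrite lerBrDr addrC -[X in X <= _](mass (l - e)).
  apply: (@le_Rintegral_ae _ _ _ mu _ m1 _ _ (ic _) (mollifier_itg s h0 ik)).
  by apply: aeW => t /=; rewrite in_itv /= => /bd /andP[].
rewrite lerBlDl -[X in _ <= X](mass (l + e)).
apply: (@le_Rintegral_ae _ _ _ mu _ m1 _ _ (mollifier_itg s h0 ik) (ic _)).
by apply: aeW => t /=; rewrite in_itv /= => /bd /andP[].
Qed.

Definition cont_on (I : R -> bool) g := forall t0, I t0 -> forall e, 0 < e -> exists2 d, 0 < d &
  forall t, I t -> `|t - t0| < d -> `|g t - g t0| <= e.

(* Testing against the difference of two steps, at [t1] and at [t2], compares the
   averages of [g] just after [t1] and just after [t2]. *)
Lemma weak_growth T g G K t1 t2 t3 :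
  mu.-integrable `]0, T[ (EFin \o g) -> mu.-integrable `]0, T[ (EFin \o G) ->
  weak_derivative 0 T g G -> cont_on (fun t => 0 < t < T) g ->
  0 < t1 -> t1 < t2 -> t2 < t3 -> t3 <= T ->
  {ae mu, forall t : R, t1 < t < t3 -> G t <= K} -> g t2 - g t1 <= K * (t2 - t1).
Proof.
move=> ig iG wg cg t10 t12 t23 t3T hG.
have m1 : measurable (`]0, T[%classic : set R) by exact: measurable_itv.
have T0 : 0 < T by lra.
apply/ler_addgt0Pl => e e0.
have arith (I1 I2 J1 J2 k1 k2 g1 g2 c1 c2 : R) : I1 - k1 <= e / 2 -> - (e / 2) <= I2 - k2 -> J1 <= J2 ->
    k1 = g1 - c1 -> k2 = g2 - c2 -> I1 - I2 = - J1 - - J2 -> g2 - g1 <= e + (c2 - c1).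
  by clear; lra.
have e4 : 0 < e / 4 by rewrite divr_gt0.
have ht1 : 0 < t1 < T by apply/andP; split; lra.
have ht2 : 0 < t2 < T by apply/andP; split; lra.
have [d1 d10 hd1] := cg t1 ht1 (e / 4) e4.
have [d2 d20 hd2] := cg t2 ht2 (e / 4) e4.
have K1 : 0 < `|K| + 1 by rewrite ltr_wpDl.
(* On windows of length [h] both [g] and [K * t] vary by at most [e / 4], and the second window ends
   before [t3]. The division by 2 makes the inequalities strict. *)
pose h := Num.min (Num.min d1 d2) (Num.min (t3 - t2) (e / 4 / (`|K| + 1))) / 2.
have hh : 0 < 2 * h.
  by rewrite /h mulrC divfK // !lt_min d10 d20 subr_gt0 t23 divr_gt0.
have h0 : 0 < h by lra.
have /andP[/andP[hd1' hd2'] /andP[ht3 hK]] : (2 * h <= d1) && (2 * h <= d2) && ((2 * h <= t3 - t2) && (2 * h <= e / 4 / (`|K| + 1))).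
  by rewrite -!le_min /h mulrC divfK.
have hKe : `|K| * h <= e / 4.
  rewrite ler_pdivlMr // in hK; have := normr_ge0 K; nra.
(* After subtracting [K * t] it remains to see that the average of [k] near [t2] does not exceed the
   one near [t1]: their difference is the integral of [(G - K) * phi]. *)
pose k t := g t - K * t.
have cK : continuous (fun t => K * t : R) by move=> t; apply: cvgM; [exact: cvg_cst|exact: cvg_id].
have ik : mu.-integrable `]0, T[ (EFin \o k).
  by apply: (@itgB _ _ _ mu _ m1 _ _ ig); exact: cont_integrable_oo.
have kbd s d : 2 * h <= d -> (forall t, 0 < t < T -> `|t - s| < d -> `|g t - g s| <= e / 4) ->
    forall t, 0 < t < T -> s <= t <= s + h -> `|k t - k s| <= e / 2.
  move=> hd hg t ht /andP[st ts].
  have ns : `|t - s| = t - s by rewrite ger0_norm // subr_ge0.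
  have := hg t ht; rewrite ns => /(_ _); rewrite (_ : t - s < d); last by lra.
  move=> /(_ isT) b1; have b2 : `|K * (t - s)| <= e / 4.
    by rewrite normrM ns; apply: le_trans hKe; rewrite ler_wpM2l //; lra.
  rewrite (_ : k t - k s = (g t - g s) - K * (t - s)); last by rewrite /k; ring.
  by apply: le_trans (ler_normB _ _) _; lra.
have b1 := mollify ik h0 (ltW t10) (_ : t1 + h <= T) (kbd t1 d1 hd1' hd1).
have b2 := mollify ik h0 (_ : 0 <= t2) (_ : t2 + h <= T) (kbd t2 d2 hd2' hd2).
have {}b1 : `|\int[mu]_(t in `]0, T[) (k t * mollifier t1 h t) - k t1| <= e / 2 by apply: b1; lra.
have {}b2 : `|\int[mu]_(t in `]0, T[) (k t * mollifier t2 h t) - k t2| <= e / 2 by apply: b2; lra.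
pose phi t := gstep 0 ((t - t1) / h) - gstep 0 ((t - t2) / h).
have dphi t : der phi t (mollifier t1 h t - mollifier t2 h t).
  by apply: derB; exact: mollifier_der.
have dphiE : derive1 phi = (fun t => mollifier t1 h t - mollifier t2 h t).
  by apply/funext => t; exact: der_derive1 (dphi t).
have phi_out t : ~~ (t1 <= t <= t2 + h) -> phi t = 0.
  rewrite negb_and -!ltNge /phi => /orP[tt|tt].
    by rewrite !gstep_le0 ?subrr // pmulr_lle0 ?invr_gt0 //; lra.
  by rewrite !gstep_ge1 ?subrr // ler_pdivlMr // mul1r; lra.
have phi_ge0 t : 0 <= phi t.
  by rewrite subr_ge0; apply: gstep0_mono; rewrite ler_wpM2r ?invr_ge0 ?(ltW h0) //; lra.
have tphi : test_function 0 T phi.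
  split; first by move=> t; have [] := dphi t.
    by rewrite dphiE => t; apply: cvgB; exact: mollifier_cont.
  exists t1, (t2 + h); split => //; first by lra.
have cphi := test_function_cont tphi; have [M hM] := test_function_bounded tphi.
have w1 := wg phi tphi.
have w2 : \int[mu]_(t in `]0, T[) ((K * t) * derive1 phi t) = - \int[mu]_(t in `]0, T[) (K * phi t).
  apply: (@weak_ibp R 0 T (fun t => K * t) (fun=> K) (fun t => K * t) (fun=> K)) => //.
    by move=> t; exact: cvg_cst.
  by move=> t _; apply: der_eq (derZ K (derI t)) _; rewrite mulr1.
have le1 : \int[mu]_(t in `]0, T[) (G t * phi t) <= \int[mu]_(t in `]0, T[) (K * phi t).
  apply: (@le_Rintegral_ae _ _ _ mu _ m1).
  - exact: (itg_mul_bounded cphi (fun t ht => (hM t ht).1) iG).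
  - by apply: (@itgZ _ _ _ mu _ m1 K phi); exact: cont_integrable_oo.
  - apply: (ae_imp2 hG (ae_neq t1)) => t hGt tt1 _; have [ht|ht] := boolP (t1 <= t <= t2 + h); last by rewrite phi_out // !mulr0.
    rewrite ler_wpM2r //; apply: hGt; move/andP: ht => [h1 h2].
    by rewrite lt_neqAle eq_sym tt1 h1 /=; lra.
have i1 := mollifier_itg t1 h0 ik; have i2 := mollifier_itg t2 h0 ik.
have e1 : \int[mu]_(t in `]0, T[) (k t * mollifier t1 h t) - \int[mu]_(t in `]0, T[) (k t * mollifier t2 h t) =
    \int[mu]_(t in `]0, T[) (g t * derive1 phi t) - \int[mu]_(t in `]0, T[) ((K * t) * derive1 phi t).
  rewrite -RintegralB // -RintegralB //.
  - by apply: eq_Rintegral => t _; rewrite dphiE /k; ring.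
  - have [_ c1 _] := tphi; exact: (itg_mul_bounded c1 (fun t ht => (hM t ht).2) ig).
  - have [_ c1 _] := tphi; apply: cont_integrable_oo => t; apply: cvgM; [exact: cK|exact: c1].
move: b1 b2; rewrite !ler_norml => /andP[_ b1] /andP[b2 _].
move: e1; rewrite w1 w2 mulrBr => e1.
exact: (arith _ _ _ _ _ _ _ _ _ _ b1 b2 le1 erefl erefl e1).
Qed.

(* [E] cannot cross any of the barriers [e * expR ((C + 1) * t)]. *)
Lemma dini_gronwall T E C : 0 < T -> 0 <= C -> E 0 = 0 -> cont_on (fun t => 0 <= t <= T) E ->
  (forall t1 e, 0 < t1 < T -> 0 < e -> exists2 d, 0 < d &
     forall t2, t1 < t2 < t1 + d -> t2 < T -> E t2 - E t1 <= (C * E t1 + e) * (t2 - t1)) ->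
  forall t, 0 <= t <= T -> E t <= 0.
Proof.
move=> T0 C0 E0 cE hE t ht.
pose P e := (fun t => e * expR ((C + 1) * t)).
have C1 : 0 <= C + 1 by rewrite addr_ge0.
suff main e : 0 < e -> E t <= P e t.
  apply/ler_addgt0Pl => e e0; rewrite addr0.
  have := main (e / expR ((C + 1) * t)); rewrite /P divfK ?gt_eqF ?expR_gt0 //; apply.
  by rewrite divr_gt0 ?expR_gt0.
move=> e0.
have P0 s : 0 < P e s by rewrite mulr_gt0 ?expR_gt0.
have Pmono s r : s <= r -> P e s + (C + 1) * P e s * (r - s) <= P e r.
  move=> sr; rewrite /P (_ : (C + 1) * r = (C + 1) * s + (C + 1) * (r - s)); last by ring.
  have := @expR_ge1Dx R ((C + 1) * (r - s)); rewrite expRD.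
  have := P0 s; rewrite /P; move: (expR ((C + 1) * s)) (expR ((C + 1) * (r - s))) => x y x0 hy.
  have := ler_wpM2l (ltW x0) hy; lra.
rewrite leNgt; apply/negP => bad.
(* The set of times above the barrier. At its infimum [E] is still below the barrier and stays below
   just after it, which is absurd. *)
pose A := [set s | 0 <= s <= T /\ P e s < E s].
have At : A t by [].
have hinf : has_inf A by split; [exists t|exists 0 => s [/andP[]]].
pose m := inf A.
have m0 : 0 <= m by apply: lb_le_inf; [exists t|move=> s [/andP[]]].
have mt : m <= t by apply: ge_inf => //; exact: hinf.2.
have mT : 0 <= m <= T by rewrite m0 /= (le_trans mt) //; case/andP: ht.
have below s : 0 <= s -> s < m -> E s <= P e s.
  move=> s0 sm; rewrite leNgt; apply/negP => sb.
  have : m <= s; last by rewrite leNgt sm.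
  apply: ge_inf; first exact: hinf.2.
  by split => //; rewrite s0 /=; case/andP: mT => _; apply: le_trans; exact: ltW.
have Em : E m <= P e m.
  move: (m0); rewrite le_eqVlt => /orP[/eqP <-|mp]; first by rewrite E0 ltW.
  rewrite leNgt; apply/negP => mb.
  have e2 : 0 < (E m - P e m) / 2 by rewrite divr_gt0 // subr_gt0.
  have [d d0 hd] := cE m mT _ e2.
  pose s := Num.max (m / 2) (m - d / 2).
  have s0 : 0 <= s by rewrite le_max divr_ge0.
  have sm : s < m by rewrite gt_max; apply/andP; split; lra.
  have sd : m - d / 2 <= s by rewrite le_max lexx orbT.
  have := hd s; rewrite s0 /=; case/andP: mT => _ mT' /(_ (ltW (lt_le_trans sm mT'))).
  rewrite distrC gtr0_norm ?subr_gt0 // => /(_ _); rewrite (_ : m - s < d); last by lra.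
  move=> /(_ isT); rewrite ler_norml => /andP[h1 _].
  have := below s s0 sm; have := Pmono s m (ltW sm).
  have : 0 <= (C + 1) * P e s * (m - s) by apply: mulr_ge0; [apply: mulr_ge0 => //; exact: ltW|rewrite subr_ge0 ltW].
  lra.
have mltT : m < T.
  rewrite lt_neqAle; case/andP: mT => _ ->; rewrite andbT; apply/eqP => mT'.
  have tm : t = m by apply/eqP; rewrite eq_le mt mT'; case/andP: ht => _ ->.
  by move: bad; rewrite tm ltNge Em.
have [d d0 hd] : exists2 d, 0 < d & forall s, m < s < m + d -> s < T -> E s <= P e s.
  move: (m0); rewrite le_eqVlt => /orP[/eqP m0'|mp].
    (* At time 0 no growth rate is available; continuity suffices because [E] starts at 0 and the
       barrier at [e]. *)
    have [d d0 hd] := cE m mT e e0; exists d => // s /andP[ms sd] sT.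
    have s0 : 0 <= s by rewrite (le_trans m0) // ltW.
    have := hd s; rewrite s0 (ltW sT) ger0_norm ?subr_ge0 ?(ltW ms) // => /(_ isT).
    rewrite ltrBlDl sd -m0' E0 subr0 ler_norml => /(_ isT) /andP[_ h1].
    apply: le_trans h1 _; rewrite /P ler_peMr ?(ltW e0) // -[X in X <= _]expR0 ler_expR.
    exact: mulr_ge0.
  have hm : 0 < m < T by rewrite mp.
  (* With slack [P e m] the growth rate of [E] is at most [(C + 1) * P e m], the slope of the
     barrier, which stays above its tangent by convexity. *)
  have [d d0 hd] := hE m (P e m) hm (P0 m); exists d => // s hs sT.
  have := hd s hs sT; case/andP: hs => ms _.
  have := Pmono s; have := Pmono m s (ltW ms).
  have : (C * E m + P e m) * (s - m) <= (C * P e m + P e m) * (s - m).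
    by rewrite ler_wpM2r ?subr_ge0 ?(ltW ms) // lerD2r ler_wpM2l.
  lra.
have d'0 : 0 < Num.min d (T - m) by rewrite lt_min d0 subr_gt0.
have [s As smin] := inf_adherent d'0 hinf.
have /andP[sm sT] : (s < m + d) && (s < T).
  have h1 : Num.min d (T - m) <= d by rewrite ge_min lexx.
  have h2 : Num.min d (T - m) <= T - m by rewrite ge_min lexx orbT.
  by rewrite -/m in smin; apply/andP; split; lra.
have ms : m <= s by apply: ge_inf => //; exact: hinf.2.
have [_ sb] := As.
move: ms; rewrite le_eqVlt => /orP[/eqP ms|ms]; first by move: sb; rewrite -ms ltNge Em.
by move: sb; rewrite ltNge hd // ms.
Qed.

End Growth.

(** * Uniqueness of strong solutions *)

Section Uniqueness.
Context {R : realType}.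
Local Notation mu := (@lebesgue_measure R).
Local Notation ip := (inner mu `]0, 1[).
Local Notation nm := (norm2 mu `]0, 1[).

Lemma cont_on_bounded (T : R) (g : R -> R) : 0 <= T -> cont_on (fun t => 0 <= t <= T) g ->
  exists N, forall t, 0 <= t <= T -> g t <= N.
Proof.
move=> T0 cg.
have [c _ hc] : exists2 c, c \in `[0, T] & forall t, t \in `[0, T] -> g t <= g c.
  apply: EVT_max => //; apply/subspace_continuousP => t; rewrite /= in_itv /= => ht.
  apply/cvgrPdist_le => /= e e0; have [d d0 hd] := cg t ht e e0.
  exists d => //= s; rewrite /ball /= => ts; rewrite in_itv /= => hs.
  by rewrite distrC hd // distrC.
by exists (g c) => t ht; apply: hc; rewrite in_itv.
Qed.

Lemma L2_le_ae (f g : R -> R) : measurable_fun (`]0, 1[%classic : set R) f -> L2_interval 0 1 g ->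
  {ae mu, forall x : R, `]0, 1[%classic x -> `|f x| <= g x} -> L2_interval 0 1 f.
Proof.
move=> mf [mg g2] fg; have m01 : measurable (`]0, 1[%classic : set R) by exact: measurable_itv.
pose h x := Num.min `|f x| `|g x|.
have mh : measurable_fun (`]0, 1[%classic : set R) h.
  by apply: measurable_minr; apply: measurableT_comp => //; exact: normr_measurable.
have h2 : L2_interval 0 1 h.
  apply: (L2_le mh _ (L2_abs (conj mg g2))) => x _.
  by rewrite ger0_norm ?ge_min ?lexx ?orbT // le_min !normr_ge0.
split => //.
have e : {ae mu, forall x : R, `]0, 1[%classic x -> (h x ^+ 2)%:E = (f x ^+ 2)%:E}.
  apply: (ae_imp fg) => x hx Dx.
  rewrite /h min_l ?real_normK ?num_real //.
  exact: le_trans (hx Dx) (ler_norm _).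
have mf2 : measurable_fun (`]0, 1[%classic : set R) (fun x => (f x ^+ 2)%:E).
  by apply/measurable_EFinP; exact: measurable_funX.
have mh2 := measurable_int _ h2.2.
apply/integrableP; split; first exact: mf2.
have /integrableP[_] := h2.2; apply: le_lt_trans; rewrite le_eqVlt; apply/orP; left; apply/eqP.
apply: ae_eq_integral => //.
- exact: measurableT_comp mf2.
- exact: measurableT_comp mh2.
- by apply: (ae_imp e) => x hx Dx; rewrite (hx Dx).
Qed.

Lemma pow_lip (M : R) n : exists2 L : R, 0 <= L & forall x y : R, `|x| <= M -> `|y| <= M ->
  `|x ^+ n - y ^+ n| <= L * `|x - y| /\ `|x ^+ n| <= L.
Proof.
elim: n => [|n [L L0 IH]].
  by exists 1 => // x y _ _; rewrite !expr0 subrr normr0 normr1 mul1r.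
have [M0|M0] := leP 0 M; last first.
  by exists 0 => // x y hx; have := lt_le_trans M0 (normr_ge0 x); rewrite ltNge hx.
exists (M * L + L); first by rewrite addr_ge0 // mulr_ge0.
move=> x y hx hy; have [h1 h2] := IH x y hx hy; rewrite !exprS; split.
  rewrite (_ : _ - _ = y * (x ^+ n - y ^+ n) + (x - y) * x ^+ n); last by ring.
  apply: le_trans (ler_normD _ _) _; rewrite [leRHS]mulrDl !normrM; apply: lerD.
    by rewrite -mulrA ler_pM.
  by rewrite mulrC ler_wpM2r.
by rewrite normrM; apply: le_trans (ler_pM _ _ hx h2) _; rewrite // lerDl.
Qed.

Definition reaction (beta gamma : R) (delta : nat) (v : R) : R :=
  beta * v * (1 - v ^+ delta) * (v ^+ delta - gamma).

Lemma reaction_lip (beta gamma M : R) delta : exists2 L : R, 0 <= L & forall x y : R, `|x| <= M -> `|y| <= M ->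
  `|reaction beta gamma delta x - reaction beta gamma delta y| <= L * `|x - y|.
Proof.
have [L1 L10 h1] := pow_lip M delta.+1; have [L2 L20 h2] := pow_lip M (delta + delta).+1.
pose b := `|beta|; pose g := `|gamma|.
have b0 : 0 <= b := normr_ge0 _; have g0 : 0 <= g := normr_ge0 _.
exists (b * (L1 + L2 + g * L1 + g)); first by rewrite mulr_ge0 // !addr_ge0 // mulr_ge0.
move=> x y hx hy; have [k1 _] := h1 x y hx hy; have [k2 _] := h2 x y hx hy.
(* The reaction is expanded into powers of [v], so that [pow_lip] applies to each of them. *)
rewrite (_ : _ - _ = beta * ((x ^+ delta.+1 - y ^+ delta.+1) - (x ^+ (delta + delta).+1 - y ^+ (delta + delta).+1)
   + gamma * (x ^+ delta.+1 - y ^+ delta.+1) - gamma * (x - y))); last first.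
  by rewrite /reaction !exprS !exprD; ring.
rewrite normrM -mulrA ler_wpM2l //.
apply: le_trans (ler_normB _ _) _; rewrite !mulrDl; apply: lerD; last by rewrite normrM.
apply: le_trans (ler_normD _ _) _; apply: lerD; last by rewrite normrM -mulrA ler_wpM2l.
by apply: le_trans (ler_normB _ _) _; exact: lerD.
Qed.

Variables (alpha beta gamma : R) (delta : nat) (b c T : R) (f : R -> R -> R) (u0 : R -> R).
Variables (u ux uxx ut v vx vxx vt : R -> R -> R).
Hypothesis T0 : 0 < T.
Hypothesis Su : strong_solution_with alpha beta gamma delta b c T f u0 u ux uxx ut.
Hypothesis Sv : strong_solution_with alpha beta gamma delta b c T f u0 v vx vxx vt.

Let w t x := u t x - v t x.
Let wx t x := ux t x - vx t x.
Let wxx t x := uxx t x - vxx t x.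
(** The difference of the two equations reads [w_t = w_xx - rho]; the control cancels. *)
Let rho t x := alpha * (u t x ^+ delta * ux t x - v t x ^+ delta * vx t x)
  - (reaction beta gamma delta (u t x) - reaction beta gamma delta (v t x)).

Let I0T (t : R) := 0 <= t <= T.

Lemma sol_near (z zx zxx zt : R -> R -> R) : strong_solution_with alpha beta gamma delta b c T f u0 z zx zxx zt ->
  forall t0 (e : R), I0T t0 -> 0 < e -> exists2 d, 0 < d & forall t, I0T t -> `|t - t0| < d ->
    nm (fun x => z t x - z t0 x) <= e /\ nm (fun x => zx t x - zx t0 x) <= e.
Proof.
move=> S t0 e ht0 e0.
have := sol_continuous S (t0 := t0); rewrite in_itv /= => /(_ ht0).
move/cvgrPdist_le => /(_ e e0) [d /= d0 hd]; exists d => // t ht td.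
have := hd t; rewrite /ball /= distrC => /(_ td); rewrite in_itv /= => /(_ ht).
rewrite sub0r normrN ger0_norm ?sqrtr_ge0 // => h.
have [h1 h2] := H1norm_ge (fun x => z t x - z t0 x) (fun x => zx t x - zx t0 x).
by split; [exact: le_trans h1 h|exact: le_trans h2 h].
Qed.

Lemma sol_slice (z zx zxx zt : R -> R -> R) t : strong_solution_with alpha beta gamma delta b c T f u0 z zx zxx zt ->
  I0T t -> H10 (z t) (zx t).
Proof. by move=> S ht; apply: (sol_H10 S); rewrite in_itv. Qed.

Lemma sol_slice_L2 (z zx zxx zt : R -> R -> R) t : strong_solution_with alpha beta gamma delta b c T f u0 z zx zxx zt ->
  I0T t -> L2_interval 0 1 (z t) /\ L2_interval 0 1 (zx t).
Proof. by move=> S ht; have [[h1 h2 _] _] := sol_slice S ht. Qed.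

Lemma norm_cont_on (z : R -> R -> R) : (forall t, I0T t -> L2_interval 0 1 (z t)) ->
  (forall t0 (e : R), I0T t0 -> 0 < e -> exists2 d, 0 < d & forall t, I0T t -> `|t - t0| < d ->
    nm (fun x => z t x - z t0 x) <= e) -> cont_on I0T (fun t => nm (z t)).
Proof.
move=> h2 h t0 ht0 e e0; have [d d0 hd] := h t0 e ht0 e0; exists d => // t ht td.
have h1 := hd t ht td; rewrite ler_distl lerBlDr; apply/andP; split; apply: nmB_le; try exact: h2.
  by rewrite nm_subC.
exact: h1.
Qed.

Lemma sol_bounded (z zx zxx zt : R -> R -> R) : strong_solution_with alpha beta gamma delta b c T f u0 z zx zxx zt ->
  exists N : R, forall t, I0T t -> nm (z t) <= N /\ nm (zx t) <= N.
Proof.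
move=> S.
have [N1 h1] : exists N, forall t, I0T t -> nm (z t) <= N.
  apply: cont_on_bounded (ltW T0) _; apply: norm_cont_on.
    by move=> t ht; exact: (sol_slice_L2 S ht).1.
  move=> t0 e ht0 e0; have [d d0 hd] := sol_near S ht0 e0; exists d => // t ht td.
  exact: (hd t ht td).1.
have [N2 h2] : exists N, forall t, I0T t -> nm (zx t) <= N.
  apply: cont_on_bounded (ltW T0) _; apply: norm_cont_on.
    by move=> t ht; exact: (sol_slice_L2 S ht).2.
  move=> t0 e ht0 e0; have [d d0 hd] := sol_near S ht0 e0; exists d => // t ht td.
  exact: (hd t ht td).2.
by exists (Num.max N1 N2) => t ht; rewrite !le_max h1 // h2 // orbT.
Qed.

Let wH10 t : I0T t -> H10 (w t) (wx t).
Proof. by move=> ht; exact: H10B (sol_slice Su ht) (sol_slice Sv ht). Qed.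

Let w2 t : I0T t -> L2_interval 0 1 (w t).
Proof. by move=> ht; have [[h _ _] _] := wH10 ht. Qed.

Let wx2 t : I0T t -> L2_interval 0 1 (wx t).
Proof. by move=> ht; have [[_ h _] _] := wH10 ht. Qed.

Let w_near t0 (e : R) : I0T t0 -> 0 < e -> exists2 d, 0 < d & forall t, I0T t -> `|t - t0| < d ->
    nm (fun x => w t x - w t0 x) <= e /\ nm (fun x => wx t x - wx t0 x) <= e.
Proof.
move=> ht0 e0; have e2 : 0 < e / 2 by rewrite divr_gt0.
have [d1 d10 hd1] := sol_near Su ht0 e2; have [d2 d20 hd2] := sol_near Sv ht0 e2.
exists (Num.min d1 d2) => [|t ht]; first by rewrite lt_min d10.
rewrite lt_min => /andP[/(hd1 _ ht) [a1 a2] /(hd2 _ ht) [a3 a4]].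
have [u2 ux2] := sol_slice_L2 Su ht; have [v2 vx2] := sol_slice_L2 Sv ht.
have [u02 ux02] := sol_slice_L2 Su ht0; have [v02 vx02] := sol_slice_L2 Sv ht0.
by split; (apply: le_trans; first exact: nm_sub4); rewrite [leRHS]splitr lerD.
Qed.

(** Solutions are bounded in [H^1] uniformly in time, hence pointwise by [H10_sup], and the powers
    are Lipschitz on that range. In the convection term [vx s] is only square integrable; its
    factor, controlled by [w s], is bounded pointwise by a multiple of [nm (wx s)]. *)
Lemma nonlinear_bound : exists kap, exists C, [/\ 0 <= kap, 0 <= C & forall s, I0T s ->
  L2_interval 0 1 (rho s) /\ nm (rho s) <= kap * nm (wx s) + C * nm (w s)].
Proof.
have [N1 hN1] := sol_bounded Su; have [N2 hN2] := sol_bounded Sv.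
pose N := Num.max 0 (Num.max N1 N2).
have N0 : 0 <= N by rewrite le_max lexx.
have [L1 L10 h1] := pow_lip N delta; have [L2 L20 h2] := reaction_lip beta gamma N delta.
pose a := `|alpha| * L1; have a0 : 0 <= a by rewrite mulr_ge0.
exists (a + a * N), L2; split => //; first by rewrite addr_ge0 // mulr_ge0.
move=> s hs.
have [u2 ux2] := sol_slice_L2 Su hs; have [v2 vx2] := sol_slice_L2 Sv hs.
have [_ uN] := hN1 s hs; have [_ vN] := hN2 s hs.
pose X := nm (wx s); have X0 : 0 <= X := norm2_ge0 _ _ _.
pose g x := a * `|wx s x| + a * X * `|vx s x| + L2 * `|w s x|.
have g1 := L2Z a (L2_abs (wx2 hs)); have g2 := L2Z (a * X) (L2_abs vx2); have g3 := L2Z L2 (L2_abs (w2 hs)).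
have Lg : L2_interval 0 1 g := L2D (L2D g1 g2) g3.
have ae_g : {ae mu, forall x : R, `]0, 1[%classic x -> `|rho s x| <= g x}.
  apply: (ae_imp3 (H10_sup (sol_slice Su hs))
    (H10_sup (sol_slice Sv hs)) (H10_sup (wH10 hs))) => x k1 k2 k3 Dx.
  have m1 : `|u s x| <= N by apply: le_trans (k1 Dx) _; rewrite !le_max uN !orbT.
  have m2 : `|v s x| <= N by apply: le_trans (k2 Dx) _; rewrite !le_max vN !orbT.
  have [p1 p2] := h1 _ _ m1 m2; have p3 := h2 _ _ m1 m2; have m3 : `|w s x| <= X := k3 Dx.
  have -> : rho s x = alpha * (u s x ^+ delta * wx s x) + alpha * ((u s x ^+ delta - v s x ^+ delta) * vx s x)
      - (reaction beta gamma delta (u s x) - reaction beta gamma delta (v s x)).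
    by rewrite /rho /wx; ring.
  apply: le_trans (ler_normB _ _) _; apply: lerD; last exact: p3.
  apply: le_trans (ler_normD _ _) _; apply: lerD.
    by rewrite !normrM /a -mulrA ler_wpM2l // ler_wpM2r.
  rewrite !normrM /a -!mulrA ler_wpM2l // mulrA ler_wpM2r //.
  by apply: le_trans p1 _; rewrite ler_wpM2l.
have mrho : measurable_fun (`]0, 1[%classic : set R) (rho s).
  have mu1 := u2.1; have mv1 := v2.1; have mux := ux2.1; have mvx := vx2.1.
  have mr (z : R -> R) : measurable_fun (`]0, 1[%classic : set R) z ->
      measurable_fun (`]0, 1[%classic : set R) (fun x => reaction beta gamma delta (z x)).
    move=> mz; apply: measurable_funM.
      apply: measurable_funM; first by apply: measurable_funM.
      by apply: measurable_funB => //; exact: measurable_funX.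
    by apply: measurable_funB => //; exact: measurable_funX.
  apply: measurable_funB; last by apply: measurable_funB; exact: mr.
  apply: measurable_funM => //.
  by apply: measurable_funB; apply: measurable_funM => //; exact: measurable_funX.
have Lr := L2_le_ae mrho Lg ae_g; split => //.
apply: (@le_trans _ _ (nm g)).
  apply: le_norm2 => //.
  apply: (ae_imp ae_g) => x hx Dx.
  exact: le_trans (hx Dx) (ler_norm _).
apply: le_trans (nmD (L2D g1 g2) g3) _; rewrite [X in _ + X]norm2Z; last exact: L2_abs (w2 hs).
rewrite norm2_abs (ger0_norm L20) lerD2r.
apply: le_trans (nmD g1 g2) _; rewrite !norm2Z; [|exact: L2_abs|exact: L2_abs (wx2 hs)].
rewrite !norm2_abs (ger0_norm a0) ger0_norm; last by rewrite mulr_ge0.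
rewrite mulrDl lerD2l mulrAC ler_wpM2r // ler_wpM2l //.
by rewrite !le_max vN !orbT.
Qed.

(* [w s] is only tested against [w tau] for a fixed [tau], because the equation and
   the time derivative are only known almost everywhere in time. *)
Lemma energy_identity tau : I0T tau -> {ae mu, forall s : R, 0 < s < T ->
  ip (ut s) (w tau) - ip (vt s) (w tau) = - ip (wx s) (wx tau) - ip (rho s) (w tau)}.
Proof.
move=> htau; have m01 : measurable (`]0, 1[%classic : set R) by exact: measurable_itv.
have [kap [C [_ _ hrho]]] := nonlinear_bound.
have [_ iu] := inner_slice_itg (sol_dt_L2 Su) (w2 htau).
have [_ iv] := inner_slice_itg (sol_dt_L2 Sv) (w2 htau).
have Hu := ae_and (sol_H2 Su) (sol_equation Su).
have Hv := ae_and (sol_H2 Sv) (sol_equation Sv).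
have H0 := ae_and iu iv.
apply: (ae_imp3 Hu Hv H0) => s [k1 k2] [k3 k4] [k5 k6] hs.
have sin : s \in `]0, T[ by rewrite in_itv.
have hs' : I0T s by move/andP: hs => [a1 a2]; rewrite /I0T !ltW.
have [rho2 _] := hrho s hs'.
have hw := H1B (k1 sin) (k3 sin); have [_ wxx2 _] := hw.
have e1 : ip (wx s) (wx tau) = - ip (wxx s) (w tau).
  by rewrite [LHS]innerC (H10_ibp (wH10 htau) hw) [ip (w tau) _]innerC.
rewrite e1 opprK -(ipBl wxx2 rho2 (w2 htau)) /inner -RintegralB //; [|exact: k5|exact: k6].
apply: (@Rintegral_ae _ _ _ mu _ m01).
- by apply: (@itgB _ _ _ mu _ m01); [exact: k5|exact: k6].
- by apply: (@itg_mul _ _ _ mu _ m01); [exact: L2B|exact: w2].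
- apply: (ae_imp2 (k2 sin) (k4 sin)) => x q1 q2 Dx.
  rewrite q1 // q2 // /rho /rhs /reaction; ring.
Qed.

(** Here [X], [Y] and [Ys] are the norms of [wx s], [w tau] and [w s]. The coefficient
    [kap ^+ 2 / 4] comes from completing the square in [X]. *)
Let growth_arith (kap C X Y Ys N eta I1 I2 P : R) : 0 <= kap -> 0 <= C -> 0 <= X -> 0 <= Y -> 0 <= eta ->
  X <= N -> Y <= N -> Ys <= Y + eta -> X ^+ 2 - X * eta <= I1 -> P <= kap * X + C * Ys -> - I2 <= P * Y ->
  - I1 - I2 <= (kap ^+ 2 / 4 + C) * Y ^+ 2 + N * (1 + C) * eta.
Proof.
move=> k0 C0 X0 Y0 e0 XN YN h1 h2 h3 h4.
have h5 : C * Ys <= C * (Y + eta) by rewrite ler_wpM2l.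
have h6 : P * Y <= (kap * X + C * (Y + eta)) * Y by rewrite ler_wpM2r //; lra.
have h7 := sqr_ge0 (X - kap / 2 * Y).
have h8 : X * eta <= N * eta by rewrite ler_wpM2r.
have h9 : C * (Y * eta) <= C * (N * eta) by rewrite ler_wpM2l // ler_wpM2r.
move: h2 h4 h6 h7 h8 h9; rewrite !sqrrB; lra.
Qed.

(* The diffusion term [- nm (wx s) ^+ 2] absorbs the part of the nonlinearity that
   is controlled by [wx s]. *)
Lemma energy_rate : exists K, exists B, [/\ 0 <= K, 0 <= B & forall tau, I0T tau ->
  {ae mu, forall s : R, 0 < s < T -> forall eta, 0 <= eta -> nm (fun x => w s x - w tau x) <= eta ->
    nm (fun x => wx s x - wx tau x) <= eta ->
    ip (ut s) (w tau) - ip (vt s) (w tau) <= K * nm (w tau) ^+ 2 + B * eta}].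
Proof.
have [kap [C [kap0 C0 hrho]]] := nonlinear_bound.
have [N hN] : exists N : R, forall t, I0T t -> nm (w t) <= N /\ nm (wx t) <= N.
  have [N1 hN1] := sol_bounded Su; have [N2 hN2] := sol_bounded Sv; exists (N1 + N2) => t ht.
  have [u2 ux2] := sol_slice_L2 Su ht; have [v2 vx2] := sol_slice_L2 Sv ht.
  have [a1 a2] := hN1 t ht; have [a3 a4] := hN2 t ht.
  by split; (apply: le_trans; first exact: nm_sub_le); exact: lerD.
have N0 : 0 <= N.
  have := hN 0; rewrite /I0T lexx (ltW T0) => /(_ isT) [h _].
  exact: le_trans (norm2_ge0 _ _ _) h.
exists (kap ^+ 2 / 4 + C), (N * (1 + C)); split.
- by rewrite addr_ge0 // divr_ge0 // sqr_ge0.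
- by rewrite mulr_ge0 // addr_ge0.
move=> tau htau.
apply: (ae_imp (energy_identity htau)) => s hid hs eta eta0 d0 d1.
have hs' : I0T s by move/andP: hs => [a1 a2]; rewrite /I0T !ltW.
have [rho2 rhoN] := hrho s hs'; have [Ws Wxs] := hN s hs'; have [Wt Wxt] := hN tau htau.
rewrite hid //.
apply: (growth_arith kap0 C0 (norm2_ge0 mu `]0, 1[ (wx s)) (norm2_ge0 mu `]0, 1[ (w tau)) eta0 Wxs Wt _ _ rhoN).
- by apply: nmB_le; [exact: w2|exact: w2|].
- have dx2 := L2B (wx2 hs') (wx2 htau).
  have e1 : ip (wx s) (wx tau) = nm (wx s) ^+ 2 - ip (fun x => wx s x - wx tau x) (wx s).
    by rewrite ipBl ?norm2_sqr; [rewrite [ip (wx tau) _]innerC; ring|exact: wx2..].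
  rewrite e1 lerD2l lerN2; apply: le_trans (ler_norm _) _; apply: le_trans (cs01 dx2 (wx2 hs')) _.
  by rewrite mulrC ler_wpM2l // norm2_ge0.
- by apply: le_trans (cs01 rho2 (w2 htau)); rewrite -normrN ler_norm.
Qed.

Let inner_growth tau (K t1 t2 t3 : R) : I0T tau -> 0 < t1 -> t1 < t2 -> t2 < t3 -> t3 <= T ->
  {ae mu, forall s : R, t1 < s < t3 -> ip (ut s) (w tau) - ip (vt s) (w tau) <= K} ->
  ip (w t2) (w tau) - ip (w t1) (w tau) <= K * (t2 - t1).
Proof.
move=> htau t10 t12 t23 t3T hK.
have m1 : measurable (`]0, T[%classic : set R) by exact: measurable_itv.
pose g t := ip (u t) (w tau) - ip (v t) (w tau).
have gE t : I0T t -> g t = ip (w t) (w tau).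
  move=> ht; have [u2 _] := sol_slice_L2 Su ht; have [v2 _] := sol_slice_L2 Sv ht.
  by rewrite /g -(ipBl u2 v2 (w2 htau)).
have ht1 : I0T t1 by apply/andP; split; lra.
have ht2 : I0T t2 by apply/andP; split; lra.
have [Lu _ _] := sol_L2 Su; have [Lv _ _] := sol_L2 Sv.
have [gu _] := inner_slice_itg Lu (w2 htau); have [gv _] := inner_slice_itg Lv (w2 htau).
have [Gu _] := inner_slice_itg (sol_dt_L2 Su) (w2 htau); have [Gv _] := inner_slice_itg (sol_dt_L2 Sv) (w2 htau).
rewrite -!gE //; apply: (@weak_growth R T g (fun s => ip (ut s) (w tau) - ip (vt s) (w tau)) K t1 t2 t3) => //.
- exact: (@itgB _ _ _ mu _ m1 _ _ gu gv).
- exact: (@itgB _ _ _ mu _ m1 _ _ Gu Gv).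
- move=> phi tphi; have cphi := test_function_cont tphi; have [_ c1 _] := tphi.
  have [M hM] := test_function_bounded tphi.
  have k1 := itg_mul_bounded c1 (fun t ht => (hM t ht).2) gu; have k2 := itg_mul_bounded c1 (fun t ht => (hM t ht).2) gv.
  have k3 := itg_mul_bounded cphi (fun t ht => (hM t ht).1) Gu; have k4 := itg_mul_bounded cphi (fun t ht => (hM t ht).1) Gv.
  have e1 := weak_time_inner Lu (sol_dt_L2 Su) (sol_dt Su) (w2 htau) tphi.
  have e2 := weak_time_inner Lv (sol_dt_L2 Sv) (sol_dt Sv) (w2 htau) tphi.
  transitivity (\int[mu]_(t in `]0, T[) (ip (u t) (w tau) * derive1 phi t) - \int[mu]_(t in `]0, T[) (ip (v t) (w tau) * derive1 phi t)).
    by rewrite -RintegralB //; apply: eq_Rintegral => t _; rewrite mulrBl.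
  rewrite e1 e2 -opprB opprK addrC; congr (- _).
  by rewrite -RintegralB //; apply: eq_Rintegral => t _; rewrite mulrBl.
- move=> t0 ht0 e e0; have ht0' : I0T t0 by case/andP: ht0 => a1 a2; rewrite /I0T !ltW.
  pose Y := nm (w tau) + 1; have Y0 : 0 < Y by rewrite ltr_wpDl // norm2_ge0.
  have eY : 0 < e / Y by rewrite divr_gt0.
  have [d d0 hd] := w_near ht0' eY; exists d => // t ht td.
  have ht' : I0T t by case/andP: ht => a1 a2; rewrite /I0T !ltW.
  rewrite !gE // -(ipBl (w2 ht') (w2 ht0') (w2 htau)).
  apply: le_trans (cs01 (L2B (w2 ht') (w2 ht0')) (w2 htau)) _.
  apply: le_trans (ler_wpM2r (norm2_ge0 _ _ _) (hd t ht' td).1) _.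
  by rewrite mulrAC ler_pdivrMr // ler_wpM2l ?(ltW e0) // lerDl.
Qed.

Let step_arith (K B N eta e E1 E2 Y1 Y2 dt S1 S2 : R) : 0 <= K -> 0 <= B -> 0 <= N -> 0 <= eta -> 0 <= dt ->
  E1 = Y1 ^+ 2 -> E2 = Y2 ^+ 2 -> 0 <= Y1 -> 0 <= Y2 -> Y1 <= N -> Y2 <= N -> Y2 <= Y1 + eta ->
  (2 * K * N + 2 * B) * eta <= e ->
  S1 <= (K * E1 + B * eta) * dt -> S2 <= (K * E2 + B * eta) * dt -> S1 + S2 <= (2 * K * E1 + e) * dt.
Proof.
move=> K0 B0 N0 e0 dt0 -> -> Y10 Y20 Y1N Y2N Y12 he h1 h2.
have h3 : Y2 ^+ 2 <= Y1 ^+ 2 + 2 * N * eta.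
  have : Y2 * Y2 <= Y2 * (Y1 + eta) by rewrite ler_wpM2l.
  have : Y1 * Y2 <= Y1 * (Y1 + eta) by rewrite ler_wpM2l.
  have : Y1 * eta <= N * eta by rewrite ler_wpM2r.
  have : Y2 * eta <= N * eta by rewrite ler_wpM2r.
  rewrite !expr2; lra.
have h4 : K * Y2 ^+ 2 <= K * (Y1 ^+ 2 + 2 * N * eta) by rewrite ler_wpM2l.
apply: le_trans (lerD h1 h2) _; rewrite -mulrDl ler_wpM2r //.
by move: he h4; move: (Y1 ^+ 2) (Y2 ^+ 2) => y z; lra.
Qed.

Let sq_arith (N a a0 e : R) : 0 <= a -> 0 <= a0 -> a <= N -> a0 <= N -> 0 < e ->
  `|a - a0| <= e / (2 * N + 1) -> `|a ^+ 2 - a0 ^+ 2| <= e.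
Proof.
move=> p0 q0 pN qN e0 h; have N1 : 0 < 2 * N + 1 by lra.
rewrite subr_sqr normrM (ger0_norm (addr_ge0 p0 q0)).
rewrite ler_pdivlMr // in h; apply: le_trans h; rewrite ler_wpM2l //; lra.
Qed.

Lemma strong_solution_unique t : I0T t -> nm (fun x => u t x - v t x) = 0.
Proof.
move=> ht; have m01 : measurable (`]0, 1[%classic : set R) by exact: measurable_itv.
have [K [B [K0 B0 rate]]] := energy_rate.
pose E s := nm (w s) ^+ 2.
have cw : cont_on I0T (fun s => nm (w s)).
  apply: norm_cont_on w2 _ => t0 e ht0 e0; have [d d0 hd] := w_near ht0 e0.
  by exists d => // s hs sd; exact: (hd s hs sd).1.
have [N hN] := cont_on_bounded (ltW T0) cw.
have w0 s : 0 <= nm (w s) := norm2_ge0 _ _ _.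
have I0 : I0T 0 by rewrite /I0T lexx ltW.
have N0 : 0 <= N by exact: le_trans (w0 0) (hN 0 I0).
have cE : cont_on I0T E.
  move=> t0 ht0 e e0; have eN : 0 < e / (2 * N + 1) by rewrite divr_gt0 // ltr_wpDl // mulr_ge0.
  have [d d0 hd] := cw t0 ht0 _ eN; exists d => // s hs sd.
  exact: (sq_arith (w0 s) (w0 t0) (hN s hs) (hN t0 ht0) e0 (hd s hs sd)).
have E0 : E 0 = 0.
  rewrite /E (@norm2_ae0 _ _ _ mu _ m01 _ (w2 I0)) ?expr0n //.
  apply: (ae_imp2 (sol_initial Su) (sol_initial Sv)) => x h1 h2 Dx.
  by rewrite /w h1 // h2 // subrr.
have K2 : 0 <= 2 * K by rewrite mulr_ge0.
suff : E t <= 0.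
  by rewrite /E -[nm (w t)]/(nm (fun x => u t x - v t x)) real_exprn_even_le0 ?num_real //= => /eqP.
apply: (dini_gronwall T0 K2 E0 cE _ ht) => t1 e /andP[t10 t1T] e0.
pose D := 2 * K * N + 2 * B + 1.
have D0 : 0 < D by rewrite ltr_wpDl // addr_ge0 // mulr_ge0.
pose eta := e / D; have eta0 : 0 < eta by rewrite divr_gt0.
have etaD : (2 * K * N + 2 * B) * eta <= e.
  by rewrite -[leRHS](@divfK _ D) ?gt_eqF // -/eta mulrC ler_wpM2l ?(ltW eta0) // lerDl.
have ht1 : I0T t1 by rewrite /I0T !ltW.
(* With [eta / 2] around [t1], the triangle inequality gives [eta] around [t2]. *)
have eta2 : 0 < eta / 2 by rewrite divr_gt0.
have [d d0 hd] := w_near ht1 eta2; exists d => // t2 /andP[t12 t2d] t2T.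
have ht2 : I0T t2 by rewrite /I0T (ltW t2T) (ltW (lt_trans t10 t12)).
pose t3 := Num.min (t1 + d) T.
have t23 : t2 < t3 by rewrite lt_min t2d.
have t3T : t3 <= T by rewrite ge_min lexx orbT.
have nd2 : `|t2 - t1| < d by rewrite gtr0_norm ?subr_gt0 // ltrBlDl.
have [c1 c2] := hd t2 ht2 nd2.
have close s : t1 < s < t3 -> [/\ 0 < s < T, I0T s, nm (fun x => w s x - w t1 x) <= eta / 2 & nm (fun x => wx s x - wx t1 x) <= eta / 2].
  rewrite lt_min => /andP[s1 /andP[sd sT]].
  have hs : I0T s by rewrite /I0T (ltW sT) (ltW (lt_trans t10 s1)).
  have [|a1 a2] := hd s hs; first by rewrite gtr0_norm ?subr_gt0 // ltrBlDl.
  by split => //; rewrite sT (lt_trans t10).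
have half : eta / 2 <= eta by rewrite ler_pdivrMr // ler_peMr ?(ltW eta0) // ler1n.
(* The increment of [E] is the sum of the increments of [ip (w t) (w t1)] and [ip (w t) (w t2)],
   each with a fixed test function, as the cross terms cancel. *)
have S1 : ip (w t2) (w t1) - ip (w t1) (w t1) <= (K * E t1 + B * eta) * (t2 - t1).
  apply: (inner_growth ht1 t10 t12 t23 t3T).
  apply: (ae_imp (rate t1 ht1)) => s hs /close [a1 a2 a3 a4].
  by apply: hs a1 _ (ltW eta0) _ _; exact: le_trans half.
have S2 : ip (w t2) (w t2) - ip (w t1) (w t2) <= (K * E t2 + B * eta) * (t2 - t1).
  apply: (inner_growth ht2 t10 t12 t23 t3T).
  apply: (ae_imp (rate t2 ht2)) => s hs /close [a1 a2 a3 a4].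
  apply: hs a1 _ (ltW eta0) _ _.
    by apply: le_trans (nm_tri (w2 a2) (w2 ht2) (w2 ht1)) _; rewrite [leRHS]splitr lerD.
  by apply: le_trans (nm_tri (wx2 a2) (wx2 ht2) (wx2 ht1)) _; rewrite [leRHS]splitr lerD.
have Y12 : nm (w t2) <= nm (w t1) + eta by apply: nmB_le; [exact: w2|exact: w2|exact: le_trans half].
have dt0 : 0 <= t2 - t1 by rewrite subr_ge0 ltW.
have := step_arith K0 B0 N0 (ltW eta0) dt0 erefl erefl (w0 t1) (w0 t2) (hN _ ht1) (hN _ ht2) Y12 etaD S1 S2.
rewrite [ip (w t1) (w t2)]innerC /E !norm2_sqr.
by rewrite (addrC (_ - ip (w t1) (w t1))) addrA subrK.
Qed.

End Uniqueness.

Theorem theorem1p5 (R : realType) (alpha beta gamma : R) (delta : nat) (b c : R)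
  (alpha_gt0 : 0 < alpha) (beta_gt0 : 0 < beta) (gamma_gt0 : 0 < gamma)
  (delta_ge1 : (1 <= delta)%N)
  (b_gt0 : 0 < b) (b_lt_c : b < c) (c_lt1 : c < 1)
  (u0 u1 : R -> R)
  (u0_steady : steady_state alpha beta gamma delta b c u0)
  (u1_steady : steady_state alpha beta gamma delta b c u1)
  (u0_u1_path : steady_path_connected alpha beta gamma delta b c u0 u1)
  (hdelta : R) (hdelta_gt0 : 0 < hdelta) :
  exists2 T0 : R, 0 < T0 &
    forall T : R, T0 <= T ->
      exists f : R -> R -> R,
        [/\ L2_cylinder T f,
            exists u : R -> R -> R,
              strong_solution alpha beta gamma delta b c T f u0 u
          & forall u : R -> R -> R,
              strong_solution alpha beta gamma delta b c T f u0 u ->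
              L2norm (fun x => u T x - u1 x) <= hdelta].
Proof.
have [tau [v [vx [vxx [vt [[tau0 hv pv] [bc init final]]]]]]] :=
  path_reach b_gt0 b_lt_c c_lt1 u0_u1_path.
(* [tau] may be 0, while the final time must be positive. *)
exists (tau + 1) => [|T tauT]; first by rewrite ltr_wpDl.
have tT : tau <= T by apply: le_trans tauT; rewrite lerDl.
have T0 : 0 < T by apply: lt_le_trans tauT; rewrite ltr_wpDl.
have Sv := strong_solution_traj T0 hv pv bc (fun x => init 0 x (lexx 0)).
exists (residual alpha beta gamma delta v vx vxx vt); split.
- exact/jc_L2_cylinder/jc_residual.
- by exists v, vx, vxx, vt.
move=> u [ux [uxx [ut Su]]].
have TT : 0 <= T <= T by rewrite lexx ltW.
have E := strong_solution_unique T0 Su Sv TT.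
have -> : L2norm (fun x => u T x - u1 x) = 0; last exact: ltW.
rewrite -E; apply: norm2_eq => x /=; rewrite in_itv /= => /andP[x0 x1].
by rewrite (final T) // !ltW.
Qed.
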